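(* Let $k$ be a field of characteristic $0$. Let $R=E(x_1,\dots,x_n)/J$ be a quotient of an exterior algebra over $k$ on finitely many generators of degree $1$ by a homogeneous ideal $J$ generated by elements of degree $\ge 2$, and let $m$ be the augmentation ideal of $R$. Assume $m^3=0$. Let $B=\mathrm{Ext}^*_R(k,k)$ be the Yoneda Ext-algebra and let $A$ be the subalgebra of $B$ generated by $\mathrm{Ext}^1_R(k,k)$. Then for all $i\ge 1$ and all $j$ there are exact sequences $$0\longrightarrow \mathrm{Tor}^A_{i,j}(k,k)\longrightarrow \mathrm{Tor}^B_{i,j}(k,k)\longrightarrow \mathrm{Tor}^A_{i+2,j+1}(k,k)\longrightarrow 0,$$ where the first map is induced by the inclusion $A\subset B$. In particular: (a) $B$ is finitely generated if and only if the graded vector space $\mathrm{Tor}^A_{3,*}(k,k)$ has finite dimension. (b) $B$ is finitely presented if and only if the graded vector spaces $\mathrm{Tor}^A_{3,*}(k,k)$ and $\mathrm{Tor}^A_{4,*}(k,k)$ have finite dimension. (c) $B$ is finitely presented and has a finite number of relations between the minimal relations if and only if the graded vector spaces $\mathrm{Tor}^A_{3,*}(k,k)$, $\mathrm{Tor}^A_{4,*}(k,k)$ and $\mathrm{Tor}^A_{5,*}(k,k)$ have finite dimension.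
   Context: $E(x_1,\dots,x_n)$ is the exterior algebra over $k$. The algebra $B=\mathrm{Ext}^*_R(k,k)$ (Yoneda product) is graded by cohomological degree: $B=\bigoplus_{j\ge0}\mathrm{Ext}^j_R(k,k)$, and $A$ is a graded subalgebra. In $\mathrm{Tor}_{i,j}$ the index $i$ is the homological degree and $j$ is the degree induced by this cohomological grading of $A$, respectively $B$; $\mathrm{Tor}_{i,*}=\bigoplus_j\mathrm{Tor}_{i,j}$. For a graded connected $k$-algebra $C$, the dimension of $\mathrm{Tor}^C_{1}(k,k)$ is the minimal number of generators of $C$, that of $\mathrm{Tor}_2^C(k,k)$ is the minimal number of relations between a minimal system of generators, and that of $\mathrm{Tor}_3^C(k,k)$ is the minimal number of relations between these minimal relations. Thus ''finitely generated'' means $\mathrm{Tor}_1^C(k,k)$ is finite-dimensional, ''finitely presented'' means $\mathrm{Tor}_1^C(k,k)$ and $\mathrm{Tor}_2^C(k,k)$ are finite-dimensional, and ''a finite number of relations between the minimal relations'' means $\mathrm{Tor}_3^C(k,k)$ is finite-dimensional. *)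

(* Defs.v *)
From HB Require Import structures.
From mathcomp Require Import all_boot all_order all_algebra.
From mathcomp Require Import generic_quotient.
From mathcomp Require Import boolp functions.
From mathcomp Require Import ring.

Set Implicit Arguments.
Unset Strict Implicit.
Unset Printing Implicit Defensive.

Import GRing.Theory.
Local Open Scope ring_scope.
Local Open Scope quotient_scope.

(* [a : ext K n] is the vector \sum_S a S *: x_S, where x_S is the product of
   the x_i (i \in S) in increasing order. *)
Definition ext (K : fieldType) (n : nat) : Type := {ffun {set 'I_n} -> K}.

HB.instance Definition _ (K : fieldType) (n : nat) :=
  GRing.Zmodule.on (ext K n).
HB.instance Definition _ (K : fieldType) (n : nat) :=
  GRing.Lmodule.copy (ext K n) {ffun {set 'I_n} -> K^o}.

Section Exterior.
Variables (K : fieldType) (n : nat).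
Implicit Types (S T U W : {set 'I_n}) (a b c : ext K n).

(* x_S * x_T = (-1) ^+ (inversions S T) x_(S :|: T) when S, T are disjoint,
   and x_S * x_T = 0 otherwise. *)
Definition inversions S T : nat := \sum_(s in S) \sum_(t in T) (t < s).

Definition ext_mul a b : ext K n :=
  [ffun U : {set 'I_n} => \sum_(S : {set 'I_n})
     \sum_(T : {set 'I_n} | [disjoint S & T] && (S :|: T == U))
     (-1) ^+ inversions S T * (a S * b T)].

Definition ext_one : ext K n := [ffun S : {set 'I_n} => (S == set0)%:R].

Let sg S T : K := if [disjoint S & T] then (-1) ^+ inversions S T else 0.

Let ext_mulE a b U : ext_mul a b U =
  \sum_(S : {set 'I_n}) \sum_(T : {set 'I_n}) sg S T * (a S * b T) * (S :|: T == U)%:R.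
Proof.
rewrite ffunE; apply: eq_bigr => S _; rewrite big_mkcond.
apply: eq_bigr => T _; rewrite /sg.
by case: [disjoint _ & _]; case: eqP => _; rewrite /= ?mul0r ?mulr1 ?mulr0.
Qed.

Let disjUl S T U : [disjoint S :|: T & U] = [disjoint S & U] && [disjoint T & U].
Proof. by rewrite -!setI_eq0 setIUl setU_eq0. Qed.

Let disjUr S T U : [disjoint S & T :|: U] = [disjoint S & T] && [disjoint S & U].
Proof. by rewrite -!setI_eq0 setIUr setU_eq0. Qed.

Let sgA S T U : sg S T * sg (S :|: T) U = sg T U * sg S (T :|: U).
Proof.
rewrite /sg disjUl disjUr.
case dST: [disjoint S & T]; last by rewrite mul0r mulr0.
case dTU: [disjoint T & U]; last by rewrite andbF mul0r mulr0.
rewrite andbT andTb; case: ifP => dSU; last by rewrite !mulr0.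
rewrite -!exprD; congr (_ ^+ _).
have -> : inversions (S :|: T) U = (inversions S U + inversions T U)%N.
  rewrite /inversions -bigU //.
  by apply: eq_bigl => s; rewrite inE.
have -> : inversions S (T :|: U) = (inversions S T + inversions S U)%N.
  rewrite /inversions -big_split; apply: eq_bigr => s _ /=.
  rewrite -bigU //.
  by apply: eq_bigl => t; rewrite inE.
by rewrite addnA [RHS]addnC.
Qed.

Fact ext_mulA : associative ext_mul.
Proof.
move=> a b c; apply/ffunP => W; rewrite !ext_mulE.
pose F S T U : K :=
  sg S T * sg (S :|: T) U * (a S * b T * c U) * (S :|: T :|: U == W)%:R.
transitivity (\sum_(S : {set 'I_n}) \sum_(T : {set 'I_n})
                \sum_(U : {set 'I_n}) F S T U).
  apply: eq_bigr => S _.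
  transitivity (\sum_(X : {set 'I_n}) \sum_(T : {set 'I_n})
     \sum_(U : {set 'I_n})
     sg S X * (a S * (sg T U * (b T * c U))) * (S :|: X == W)%:R
       * (T :|: U == X)%:R).
    apply: eq_bigr => X _; rewrite ext_mulE !mulr_sumr mulr_suml.
    apply: eq_bigr => T _; rewrite !mulr_sumr mulr_suml.
    apply: eq_bigr => U _.
    by move: (sg _ _) (sg _ _) (_%:R) (_%:R) => *; ring.
  rewrite exchange_big; apply: eq_bigr => T _.
  rewrite exchange_big; apply: eq_bigr => U _.
  rewrite (bigD1 (T :|: U)) //= eqxx mulr1 big1 ?addr0 => [|X /negPf nX].
    rewrite /F sgA setUA.
    by move: (sg _ _) (sg _ _) (_%:R) => *; ring.
  by rewrite [T :|: U == X]eq_sym nX mulr0.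
transitivity (\sum_(U : {set 'I_n}) \sum_(S : {set 'I_n})
                \sum_(T : {set 'I_n}) F S T U).
  rewrite [RHS]exchange_big; apply: eq_bigr => S _.
  by rewrite exchange_big.
rewrite [RHS]exchange_big; apply: eq_bigr => U _.
transitivity (\sum_(X : {set 'I_n})
   \sum_(S : {set 'I_n}) \sum_(T : {set 'I_n})
   sg X U * (sg S T * (a S * b T) * c U) * (X :|: U == W)%:R
     * (S :|: T == X)%:R).
  rewrite [RHS]exchange_big; apply: eq_bigr => S _.
  rewrite [RHS]exchange_big; apply: eq_bigr => T _.
  rewrite (bigD1 (S :|: T)) //= eqxx mulr1 big1 ?addr0 => [|X /negPf nX].
    by rewrite /F; move: (sg _ _) (sg _ _) (_%:R) => *; ring.
  by rewrite [S :|: T == X]eq_sym nX mulr0.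
apply: eq_bigr => X _.
rewrite ext_mulE mulr_suml !mulr_sumr mulr_suml; apply: eq_bigr => S _.
rewrite mulr_suml !mulr_sumr mulr_suml; apply: eq_bigr => T _.
by move: (sg _ _) (sg _ _) (_%:R) (_%:R) => *; ring.
Qed.

Fact ext_mul1l : left_id ext_one ext_mul.
Proof.
move=> a; apply/ffunP => W; rewrite ext_mulE (bigD1 set0) //=.
rewrite [X in _ + X]big1 ?addr0 => [|S /negPf nS]; last first.
  by apply: big1 => T _; rewrite ffunE nS !(mul0r, mulr0).
rewrite (bigD1 W) //= big1 ?addr0 => [|T /negPf nT]; last first.
  by rewrite set0U nT mulr0.
rewrite set0U eqxx mulr1 ffunE eqxx mul1r /sg disjoints_subset sub0set.
by rewrite /inversions big_set0 mul1r.
Qed.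

Fact ext_mul1r : right_id ext_one ext_mul.
Proof.
move=> a; apply/ffunP => W; rewrite ext_mulE (bigD1 W) //=.
rewrite [X in _ + X]big1 ?addr0 => [|S /negPf nS]; last first.
  apply: big1 => T _; rewrite ffunE; case: eqP => [->|_].
    by rewrite setU0 nS mulr0.
  by rewrite !(mul0r, mulr0).
rewrite (bigD1 set0) //= big1 ?addr0 => [|T /negPf nT]; last first.
  by rewrite ffunE nT !(mul0r, mulr0).
rewrite setU0 eqxx mulr1 ffunE eqxx mulr1 /sg disjoint_sym.
rewrite disjoints_subset sub0set /inversions.
by rewrite big1 ?mul1r // => s _; rewrite big_set0.
Qed.

Let ext_addE a b S : (a + b) S = a S + b S.
Proof. by rewrite ffunE. Qed.

Fact ext_mulDl : left_distributive ext_mul +%R.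
Proof.
move=> a b c; apply/ffunP => W; rewrite ext_addE !ext_mulE -big_split.
apply: eq_bigr => S _; rewrite -big_split; apply: eq_bigr => T _.
by rewrite ext_addE mulrDl mulrDr mulrDl.
Qed.

Fact ext_mulDr : right_distributive ext_mul +%R.
Proof.
move=> a b c; apply/ffunP => W; rewrite ext_addE !ext_mulE -big_split.
apply: eq_bigr => S _; rewrite -big_split; apply: eq_bigr => T _.
by rewrite ext_addE mulrDr mulrDr mulrDl.
Qed.

Fact ext_one_neq0 : ext_one != 0.
Proof.
apply/eqP => /ffunP/(_ set0); rewrite !ffunE eqxx; apply/eqP.
exact: oner_neq0.
Qed.

HB.instance Definition _ := GRing.Zmodule_isNzRing.Build (ext K n)
  ext_mulA ext_mul1l ext_mul1r ext_mulDl ext_mulDr ext_one_neq0.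

Fact ext_scaleAl (r : K) (a b : ext K n) : r *: (a * b) = (r *: a) * b.
Proof.
apply/ffunP => W; rewrite !ffunE /GRing.scale /= mulr_sumr.
apply: eq_bigr => S _; rewrite mulr_sumr; apply: eq_bigr => T _.
by rewrite ffunE mulrCA; congr (_ * _); rewrite mulrA.
Qed.

HB.instance Definition _ :=
  GRing.Lmodule_isLalgebra.Build K (ext K n) ext_scaleAl.

Fact ext_scaleAr (r : K) (a b : ext K n) : r *: (a * b) = a * (r *: b).
Proof.
apply/ffunP => W; rewrite !ffunE /GRing.scale /= mulr_sumr.
apply: eq_bigr => S _; rewrite mulr_sumr; apply: eq_bigr => T _.
by rewrite ffunE mulrCA; congr (_ * _); rewrite mulrCA.
Qed.

HB.instance Definition _ :=
  GRing.Lalgebra_isAlgebra.Build K (ext K n) ext_scaleAr.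

Definition ext_homog (d : nat) a : Prop := forall S, #|S| != d -> a S = 0.

End Exterior.

Record two_sided_ideal (E : nzRingType) (I : E -> Prop) : Prop := {
  ideal0 : I 0;
  idealD : forall x y, I x -> I y -> I (x + y);
  idealMl : forall a x, I x -> I (a * x);
  idealMr : forall a x, I x -> I (x * a) }.

Definition generated_ideal (E : nzRingType) (G : E -> Prop) (a : E) : Prop :=
  forall I, two_sided_ideal I -> (forall g, G g -> I g) -> I a.

Record subalgebra (K : fieldType) (B : algType K) (S : B -> Prop) : Prop := {
  subalg1 : S 1;
  subalgP : forall (c : K) x y, S x -> S y -> S (c *: x + y);
  subalgM : forall x y, S x -> S y -> S (x * y) }.

Definition generated_subalgebra (K : fieldType) (B : algType K)
    (G : B -> Prop) (b : B) : Prop :=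
  forall S, subalgebra S -> (forall g, G g -> S g) -> S b.

Record subspace (K : fieldType) (V : lmodType K) := Subspace {
  in_subspace :> V -> Prop;
  subspace0 : in_subspace 0;
  subspaceP : forall (c : K) x y,
    in_subspace x -> in_subspace y -> in_subspace (c *: x + y) }.

Definition fin_dim (K : fieldType) (V : lmodType K) : Prop :=
  exists s : seq V, forall v, exists c : nat -> K,
    v = \sum_(i < size s) c i *: s`_i.

(* \bigoplus_j W j is finite-dimensional. *)
Definition graded_fin_dim (K : fieldType) (W : nat -> lmodType K) : Prop :=
  (forall j, fin_dim (W j)) /\
  (exists N, forall j, (N <= j)%N -> forall w : W j, w = 0).

Definition short_exact (K : fieldType) (U V W : lmodType K)
    (f : {linear U -> V}) (g : {linear V -> W}) : Prop :=
  [/\ injective f,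
      forall v, g v = 0 <-> exists u, f u = v
    & forall w, exists v, g v = w].

(* [subquot] is the vector space Z / (Z :&: D); [sq_class x] is the class of x
   when Z x, and 0 otherwise. *)
Section Subquotient.
Variables (K : fieldType) (V : lmodType K) (Z D : subspace V).

Let inZ : {pred V} := fun x => `[< Z x >].

Fact inZ_submod_closed : submod_closed inZ.
Proof.
split; first by apply/asboolP; apply: subspace0.
by move=> c x y /asboolP Zx /asboolP Zy; apply/asboolP; apply: subspaceP.
Qed.

HB.instance Definition _ := GRing.isSubmodClosed.Build K V inZ inZ_submod_closed.

Definition sq_sub : Type := {x : V | inZ x}.
HB.instance Definition _ := SubType.on sq_sub.
HB.instance Definition _ := [Choice of sq_sub by <:].
HB.instance Definition _ := [SubChoice_isSubLmodule of sq_sub by <:].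

Definition sq_equiv (x y : sq_sub) : bool := `[< D (val x - val y) >].

Fact sq_equivP : equiv_class_of sq_equiv.
Proof.
have DN x : D x -> D (- x).
  by move=> Dx; rewrite -scaleN1r -[_ *: _]addr0; apply: subspaceP => //;
    apply: subspace0.
have DD x y : D x -> D y -> D (x + y).
  by move=> Dx Dy; rewrite -[x]scale1r; apply: subspaceP.
split=> [x | x y | y x z].
- by apply/asboolP; rewrite subrr; apply: subspace0.
- by apply/asboolP/asboolP => /DN; rewrite opprB.
move=> /asboolP xy /asboolP yz; apply/asboolP.
by rewrite -[val x](addrNK (val y)) -addrA; apply: DD.
Qed.

Canonical sq_equivR := EquivRelPack sq_equivP.
Canonical sq_encModRel := defaultEncModRel sq_equiv.

Definition subquot : Type := {eq_quot sq_equiv}.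
HB.instance Definition _ : EqQuotient sq_sub sq_equiv subquot :=
  EqQuotient.on subquot.
HB.instance Definition _ := Choice.on subquot.

Definition sq_pi (x : sq_sub) : subquot := \pi_subquot x.

Let eq_pi x y : D (val x - val y) -> sq_pi x = sq_pi y.
Proof. by move=> Dxy; rewrite /sq_pi; apply/eqquotP/asboolP. Qed.

Let repr_pi x : D (val (repr (sq_pi x)) - val x).
Proof. by apply/asboolP/(@eqquotP _ _ subquot); rewrite reprK. Qed.

Definition sq_add (u v : subquot) := sq_pi (repr u + repr v).
Definition sq_opp (u : subquot) := sq_pi (- repr u).
Definition sq_scale (c : K) (u : subquot) := sq_pi (c *: repr u).

Let D0 : D 0. Proof. exact: subspace0. Qed.
Let DZ c x : D x -> D (c *: x).
Proof. by move=> Dx; rewrite -[_ *: _]addr0; apply: subspaceP. Qed.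
Let DD x y : D x -> D y -> D (x + y).
Proof. by move=> Dx Dy; rewrite -[x]scale1r; apply: subspaceP. Qed.

Let valD (x y : sq_sub) : val (x + y) = val x + val y.
Proof. by []. Qed.
Let valN (x : sq_sub) : val (- x) = - val x.
Proof. by []. Qed.
Let valZ c (x : sq_sub) : val (c *: x) = c *: val x.
Proof. by []. Qed.

Let piD x y : sq_add (sq_pi x) (sq_pi y) = sq_pi (x + y).
Proof.
by apply: eq_pi; rewrite !valD opprD addrACA; apply: DD; apply: repr_pi.
Qed.
Let piN x : sq_opp (sq_pi x) = sq_pi (- x).
Proof.
apply: eq_pi; rewrite !valN -opprD -[X in D X]scaleN1r.
apply: (@DZ (-1)); exact: repr_pi.
Qed.
Let piZ c x : sq_scale c (sq_pi x) = sq_pi (c *: x).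
Proof. by apply: eq_pi; rewrite !valZ -scalerBr; apply: (@DZ c); exact: repr_pi. Qed.
Let pi_ind (P : subquot -> Prop) : (forall x, P (sq_pi x)) -> forall u, P u.
Proof. by move=> H u; rewrite -[u]reprK; apply: H. Qed.

Fact sq_addA : associative sq_add.
Proof.
elim/pi_ind=> x; elim/pi_ind=> y; elim/pi_ind=> z.
by rewrite !piD addrA.
Qed.
Fact sq_addC : commutative sq_add.
Proof. by elim/pi_ind=> x; elim/pi_ind=> y; rewrite !piD addrC. Qed.
Fact sq_add0 : left_id (sq_pi 0) sq_add.
Proof. by elim/pi_ind=> x; rewrite piD add0r. Qed.
Fact sq_addN : left_inverse (sq_pi 0) sq_opp sq_add.
Proof. by elim/pi_ind=> x; rewrite piN piD addNr. Qed.

HB.instance Definition _ :=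
  GRing.isZmodule.Build subquot sq_addA sq_addC sq_add0 sq_addN.

Fact sq_scaleA c d (u : subquot) : sq_scale c (sq_scale d u) = sq_scale (c * d) u.
Proof. by elim/pi_ind: u => x; rewrite !piZ scalerA. Qed.
Fact sq_scale1 : left_id 1 sq_scale.
Proof. by elim/pi_ind=> x; rewrite piZ scale1r. Qed.
Fact sq_scaleDr : right_distributive sq_scale +%R.
Proof.
move=> c; elim/pi_ind=> x; elim/pi_ind=> y.
by rewrite [_ + _ in LHS]piD !piZ scalerDr [RHS]piD.
Qed.
Fact sq_scaleDl (u : subquot) : {morph sq_scale^~ u : c d / c + d}.
Proof. by elim/pi_ind: u => x c d; rewrite !piZ scalerDl [RHS]piD. Qed.

HB.instance Definition _ := GRing.Zmodule_isLmodule.Build K subquot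
  sq_scaleA sq_scale1 sq_scaleDr sq_scaleDl.

Definition sq_class (x : V) : subquot :=
  if insub x is Some z then sq_pi z else 0.

Lemma sq_classE x (Zx : inZ x) : sq_class x = sq_pi (Sub x Zx).
Proof. by rewrite /sq_class insubT. Qed.

Lemma sq_classP (c : K) x y :
  Z x -> Z y -> sq_class (c *: x + y) = c *: sq_class x + sq_class y.
Proof.
move=> Zx Zy; have Zxy : Z (c *: x + y) by apply: subspaceP.
move/asboolP in Zx; move/asboolP in Zy; move/asboolP in Zxy.
rewrite !sq_classE -[RHS]/(sq_add (sq_scale c _) _) piZ piD; apply: eq_pi.
by rewrite valD valZ /= subrr.
Qed.

Lemma sq_class_eq0 x : Z x -> sq_class x = 0 <-> D x.
Proof.
move=> /asboolP Zx; rewrite sq_classE -[0]/(sq_pi 0); split=> [|Dx].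
  by move/eqquotP/asboolP; rewrite [val (Sub _ _)]/= [val 0]/= subr0.
by apply: eq_pi; rewrite [val (Sub _ _)]/= [val 0]/= subr0.
Qed.

Lemma sq_class_surj u : exists2 x, Z x & u = sq_class x.
Proof.
elim/pi_ind: u => z; exists (val z); first exact/asboolP/(valP z).
by rewrite (sq_classE (valP z)); congr sq_pi; apply: val_inj.
Qed.

End Subquotient.

(* Below, [C] is a K-algebra with an augmentation ideal [I] (C = K 1 + I), and
   the ground field K is the C-module C / I. *)

Section Restriction.
Variables (K : fieldType) (C : algType K) (M : lmodType C).

Definition restrict : Type := M.
HB.instance Definition _ := GRing.Zmodule.on restrict.

Definition restrict_scale (c : K) (x : restrict) : restrict :=
  (c%:A : C) *: (x : M).

Fact restrict_scaleA c d x :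
  restrict_scale c (restrict_scale d x) = restrict_scale (c * d) x.
Proof. by rewrite /restrict_scale scalerA -scalerAl mul1r scalerA. Qed.
Fact restrict_scale1 : left_id 1 restrict_scale.
Proof. by move=> x; rewrite /restrict_scale !scale1r. Qed.
Fact restrict_scaleDr : right_distributive restrict_scale +%R.
Proof. by move=> c x y; rewrite /restrict_scale scalerDr. Qed.
Fact restrict_scaleDl x : {morph restrict_scale^~ x : c d / c + d}.
Proof. by move=> c d; rewrite /restrict_scale !scalerDl. Qed.

HB.instance Definition _ := GRing.Zmodule_isLmodule.Build K restrict
  restrict_scaleA restrict_scale1 restrict_scaleDr restrict_scaleDl.

End Restriction.

Section Resolution.
Variables (K : fieldType) (C : algType K) (I : C -> Prop).

(* phi is a C-linear map from M to C / I = K. *)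
Record hom_to_ground (M : lmodType C) (phi : M -> K) : Prop := {
  hom_linear : forall (c : K) x y, phi (c%:A *: x + y) = c * phi x + phi y;
  hom_aug : forall a x, I a -> phi (a *: x) = 0 }.

(* The submodule I M of M, so that k (x)_C M = M / I M. *)
Definition aug_mul (M : lmodType C) (x : M) : Prop :=
  exists s : seq (C * M),
    (forall p, p \in s -> I p.1) /\ x = \sum_(p <- s) p.1 *: p.2.

Record is_basis (M : lmodType C) (X : choiceType) (e : X -> M) : Prop := {
  basis_span : forall m, exists (s : seq X) (a : X -> C),
    m = \sum_(x <- s) a x *: e x;
  basis_free : forall (s : seq X) (a : X -> C), uniq s ->
    \sum_(x <- s) a x *: e x = 0 -> forall x, x \in s -> a x = 0 }.

(* Free resolutions ... -> res 1 -> res 0 -> k -> 0 of the C-module k. *)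
Record resolution := Resolution {
  res :> nat -> lmodType C;
  res_d : forall i, {linear res i.+1 -> res i};
  res_eps : res 0 -> K;
  res_free : forall i, exists (X : choiceType) (e : X -> res i), is_basis e;
  res_eps_hom : hom_to_ground res_eps;
  res_eps_surj : forall c, exists x, res_eps x = c;
  res_exact0 : forall x, res_eps x = 0 <-> exists y, res_d 0 y = x;
  res_exact : forall i x, res_d i x = 0 <-> exists y, res_d i.+1 y = x }.

End Resolution.

Section Ext.
Variables (K : fieldType) (R : algType K) (m : R -> Prop) (P : resolution m).

Definition is_cocycle j (phi : P j -> K^o) : Prop :=
  hom_to_ground m phi /\ forall x, phi (res_d P j x) = 0.

Definition is_coboundary j : (P j -> K^o) -> Prop :=
  match j with
  | 0 => fun phi => forall x, phi x = 0
  | j'.+1 => fun phi => exists psi : P j' -> K,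
      hom_to_ground m psi /\ forall x, phi x = psi (res_d P j' x)
  end.

Fact is_cocycle0 j : is_cocycle (0 : P j -> K^o).
Proof.
by split=> //; split=> // c x y; rewrite mulr0 addr0.
Qed.

Fact is_cocycleP j (c : K) (phi psi : P j -> K^o) :
  is_cocycle phi -> is_cocycle psi -> is_cocycle (c *: phi + psi).
Proof.
have E x : (c *: phi + psi) x = c * phi x + psi x by [].
move=> [[phiL phiI] phid] [[psiL psiI] psid]; split; last first.
  by move=> x; rewrite !E phid psid mulr0 addr0.
split=> [b x y | a x Ia]; last by rewrite !E phiI // psiI // mulr0 addr0.
by rewrite !E phiL psiL; ring.
Qed.

Fact is_coboundary0 j : is_coboundary (0 : P j -> K^o).
Proof.
case: j => [//|j] /=; exists (fun=> 0); split=> //; split=> // c x y.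
by rewrite mulr0 addr0.
Qed.

Fact is_coboundaryP j (c : K) (phi psi : P j -> K^o) :
  is_coboundary phi -> is_coboundary psi -> is_coboundary (c *: phi + psi).
Proof.
case: j phi psi => [|j] phi psi /=.
  by move=> phi0 psi0 x; rewrite -[LHS]/(c * phi x + psi x) phi0 psi0 mulr0 addr0.
move=> [f [[fL fI] phiE]] [g [[gL gI] psiE]].
exists (fun x => c * f x + g x); split; last first.
  by move=> x; rewrite -[LHS]/(c * phi x + psi x) phiE psiE.
split=> [b x y | a x Ia]; last by rewrite fI // gI // mulr0 addr0.
by rewrite fL gL; ring.
Qed.

Definition cocycles j : subspace (P j -> K^o) :=
  Subspace (@is_cocycle0 j) (@is_cocycleP j).

Definition coboundaries j : subspace (P j -> K^o) :=
  Subspace (@is_coboundary0 j) (@is_coboundaryP j).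

(* Ext^j_R(k, k) = H^j(Hom_R(P, k)) *)
Definition Ext j : lmodType K := subquot (cocycles j) (coboundaries j).

Definition ext_class j (phi : P j -> K^o) : Ext j :=
  sq_class (cocycles j) (coboundaries j) phi.

(* A chain map (P_(i + j) -> P_i)_i lifting psi : P_j -> k through P_0 -> k. *)
Record chain_lift j (psi : P j -> K) := ChainLift {
  lift_map :> forall i, {linear P (i + j)%N -> P i};
  lift_d : forall i x,
    res_d P i (lift_map i.+1 x) = lift_map i (res_d P (i + j)%N x);
  lift_eps : forall x, res_eps (lift_map 0 x) = psi x }.

(* B is the direct sum of the Ext^j_R(k, k), embedded by the maps [iota j],
   and its product is the Yoneda product: if the chain map Psi lifts psi, then
   [phi] [psi] = [phi o Psi]. Since chain maps commute with the differentials
   on the nose, no sign occurs; the other sign conventions in use give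
   isomorphic graded algebras. *)
Record is_yoneda_algebra (B : algType K)
    (iota : forall j, {linear Ext j -> B}) : Prop := {
  yoneda_span : forall b, exists N (x : forall j, Ext j),
    b = \sum_(j < N) iota j (x j);
  yoneda_direct : forall N (x : forall j, Ext j),
    \sum_(j < N) iota j (x j) = 0 -> forall j, (j < N)%N -> x j = 0;
  yoneda_mul : forall i j (phi : P i -> K^o) (psi : P j -> K^o)
      (Psi : chain_lift psi),
    is_cocycle phi -> is_cocycle psi ->
    iota i (ext_class phi) * iota j (ext_class psi) =
    iota (i + j)%N (ext_class (fun x => phi (Psi i x))) }.

(* The image of Ext^j_R(k, k) in B. *)
Definition ext_degree (B : algType K) (iota : forall j, {linear Ext j -> B})
  (j : nat) (b : B) : Prop := exists x, iota j x = b.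

End Ext.

(* [gr j] is the homogeneous component of degree j of the graded algebra C. *)
Section Graded.
Variables (K : fieldType) (C : algType K) (gr : nat -> C -> Prop).

Definition positive_part (a : C) : Prop := exists N (f : nat -> C),
  (forall j, gr j.+1 (f j)) /\ a = \sum_(j < N) f j.

Record is_graded_module (M : lmodType C) (grM : nat -> M -> Prop) : Prop := {
  grmod0 : forall j, grM j 0;
  grmodP : forall j (c : K) x y, grM j x -> grM j y -> grM j (c%:A *: x + y);
  grmod_span : forall x, exists N (f : nat -> M),
    (forall j, grM j (f j)) /\ x = \sum_(j < N) f j;
  grmod_direct : forall N (f : nat -> M), (forall j, grM j (f j)) ->
    \sum_(j < N) f j = 0 -> forall j, (j < N)%N -> f j = 0;
  grmod_scale : forall i j a x, gr i a -> grM j x -> grM (i + j)%N (a *: x) }.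

(* Resolutions of k by graded free modules, with maps of degree 0. *)
Record graded_resolution := GradedResolution {
  gres :> resolution positive_part;
  gres_deg : forall i, nat -> gres i -> Prop;
  gres_graded : forall i, is_graded_module (@gres_deg i);
  gres_free : forall i, exists (X : choiceType) (e : X -> gres i),
    is_basis e /\ forall x, exists j, gres_deg j (e x);
  gres_d : forall i j x, gres_deg j x -> gres_deg j (res_d gres i x);
  gres_eps : forall j x, gres_deg j.+1 x -> res_eps x = 0 }.

Variable F : graded_resolution.

(* x induces a cycle of degree i in k (x)_C F. *)
Definition tor_cycle i : F i -> Prop :=
  match i with
  | 0 => fun _ => True
  | i'.+1 => fun x => aug_mul positive_part (res_d F i' x)
  end.

(* x induces a boundary of degree i in k (x)_C F. *)
Definition tor_boundary i (x : F i) : Prop :=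
  exists y z, aug_mul positive_part z /\ x = res_d F i y + z.

Fact aug_mul0 (M : lmodType C) : aug_mul positive_part (0 : M).
Proof. by exists [::]; rewrite big_nil. Qed.

Fact aug_mulP (M : lmodType C) (c : K) (x y : M) :
  aug_mul positive_part x -> aug_mul positive_part y ->
  aug_mul positive_part (c%:A *: x + y).
Proof.
move=> [s [sI ->]] [t [tI ->]].
exists ([seq (p.1, (c%:A : C) *: p.2) | p <- s] ++ t); split=> [p|].
  by rewrite mem_cat => /orP[/mapP[q qs ->]|/tI //]; exact: (sI q).
rewrite big_cat big_map scaler_sumr; congr (_ + _); apply: eq_bigr => p _.
by rewrite !scalerA -scalerAl -scalerAr mul1r mulr1.
Qed.

Definition tor_cycles (i j : nat) : subspace (restrict (F i)).
Proof.
exists (fun x => gres_deg j x /\ tor_cycle x).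
  split; first exact: (grmod0 (gres_graded F i)).
  by case: i => //= i; rewrite linear0; apply: aug_mul0.
move=> c x y [jx zx] [jy zy]; split; first exact: (grmodP (gres_graded F i)).
case: i x y zx zy {jx jy} => //= i x y zx zy.
by rewrite linearP; apply: aug_mulP.
Defined.

Definition tor_boundaries i : subspace (restrict (F i)).
Proof.
exists (@tor_boundary i).
  by exists 0, 0; split; [apply: aug_mul0 | rewrite linear0 addr0].
move=> c x y [u [v [vI ->]]] [u' [v' [vI' ->]]].
exists (c%:A *: u + u'), (c%:A *: v + v'); split; first exact: aug_mulP.
by rewrite linearP [c *: _]scalerDr addrACA.
Defined.

(* Tor^C_{i,j}(k, k) = H_i(k (x)_C F)_j *)
Definition Tor (i j : nat) : lmodType K := subquot (tor_cycles i j) (tor_boundaries i).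

Definition tor_class i j (x : F i) : Tor i j :=
  sq_class (tor_cycles i j) (tor_boundaries i) x.

(* For graded connected C, Tor_1, Tor_2 and Tor_3 count the minimal generators,
   the minimal relations, and the minimal relations between these. *)
Definition finitely_generated : Prop := graded_fin_dim (Tor 1).

Definition finitely_presented : Prop :=
  graded_fin_dim (Tor 1) /\ graded_fin_dim (Tor 2).

Definition finitely_many_relations_between_relations : Prop :=
  graded_fin_dim (Tor 3).

End Graded.

Section Induced.
Variables (K : fieldType) (A B : algType K) (inc : {lrmorphism A -> B}).
Variables (grA : nat -> A -> Prop) (grB : nat -> B -> Prop).
Variables (FA : graded_resolution grA) (FB : graded_resolution grB).

(* A chain map of degree 0 over inc : A -> B, lifting the identity of k. *)
Record resolution_lift := ResolutionLift {
  rlift :> forall i, {linear FA i -> FB i | inc \; *:%R};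
  rlift_d : forall i x, res_d FB i (rlift i.+1 x) = rlift i (res_d FA i x);
  rlift_eps : forall x, res_eps (rlift 0 x) = res_eps x;
  rlift_deg : forall i j x, gres_deg j x -> gres_deg j (rlift i x) }.

Definition tor_induced (phi : resolution_lift) (i j : nat)
    (f : {linear Tor FA i j -> Tor FB i j}) : Prop :=
  forall x, tor_cycles FA i j x -> f (tor_class j x) = tor_class j (phi i x).

End Induced.

Section ExteriorQuotient.
Variables (K : fieldType) (n : nat) (R : algType K).
Variable pi : {lrmorphism ext K n -> R}.

(* pi exhibits R as the quotient of the exterior algebra by the ideal
   generated by G. *)
Definition is_quotient_by (G : ext K n -> Prop) : Prop :=
  (forall r, exists a, pi a = r) /\
  (forall a, pi a = 0 <-> generated_ideal G a).

(* [a set0] is the component of degree 0 of a. *)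
Definition augmentation_ideal (r : R) : Prop :=
  exists2 a : ext K n, a set0 = 0 & pi a = r.

End ExteriorQuotient.

(* Main.v *)
(* Let V be a complement of W = m^2 in m. As m^3 = 0, the algebra B is the
   cohomology of the cobar complex of functions on words with letters in bases of
   V and W, whose differential comes from the products V x V -> W. Restriction to
   the words without letters from W is a ring retraction rho : B -> A. Removing a
   last letter from W leads to an exact sequence of left B-modules
   B^q -> B^p -> B_+ -> B^q -> B^p (p = dim V, q = dim W), and induction on the
   degree then shows that the kernel N of rho is a free right B-module, with
   generators that correspond to a basis of S = Ker(A^q -> A^p). Here
   A^q -> A^p -> A is the beginning of a minimal resolution of k, so S is a third
   syzygy.

   Hence, for a graded free resolution FB of k over B, the complex FB / N FB of
   A-modules has homology k in degree 0, S in degree 1 and nothing else, so that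
   there is a long exact sequence relating Tor^A(k, k), Tor^B(k, k) and
   Tor^A_{i-1}(k, S) = Tor^A_{i+2}(k, k). It splits into short exact sequences
   because rho is a retraction of the inclusion of A in B. Finally, Tor^A_1 and
   Tor^A_2 are finite-dimensional. *)

Require Import Defs.
From HB Require Import structures.
From mathcomp Require Import all_boot all_order all_algebra.
From mathcomp Require Import generic_quotient boolp functions ring.

Set Implicit Arguments.
Unset Strict Implicit.
Unset Printing Implicit Defensive.

Import GRing.Theory.
Local Open Scope ring_scope.

(** * Finite-dimensional spaces *)

(** Neither FB / N FB nor a long exact sequence is formed: the argument uses chain maps between free
    modules and congruences modulo N FB. The maps [phi] and [beta] lift the inclusion and rho;
    [gamma : FB_{i+1} -> FA_{i+3}] and [delta] in the opposite direction come from S. Once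
    [beta phi], [gamma delta] and [phi beta + delta gamma] are homotopic to identities, the last one
    only modulo N FB, the short exact sequences follow formally. The obstacle is that
    [phi beta + delta gamma] is linear over inc o rho and not over B, so that its homotopy has to be
    started by hand in the lowest degrees. Freeness makes N FB a direct sum of copies of FB; hence
    the homology of FB / N FB in degree 1 is N / N B_+, which is identified with S by removing a
    last letter from W and projecting to A. The condition m^3 = 0 says that a letter from W cannot
    be merged with a neighbour. So it can be removed at the end of a word, and the differential
    changes the number of letters from W by exactly one. The shift (2, 1) arises as follows: S lies
    in A^q, whose generators have degree 2, and removing a letter lowers the degree by 1. *)

Section Span.
Variables (K : fieldType) (V : lmodType K).
Implicit Types (l s : seq V).

Definition lspan l v := exists c : nat -> K, v = \sum_(i < size l) c i *: l`_i.

Definition lfree l := forall c : nat -> K, \sum_(i < size l) c i *: l`_i = 0 ->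
  forall i, (i < size l)%N -> c i = 0.

Lemma lfree_size l s : lfree l -> {in l, forall v, lspan s v} ->
  (size l <= size s)%N.
Proof.
move=> lF ls; rewrite leqNgt; apply/negP => sl.
have : forall i : 'I_(size l), exists c : nat -> K,
    l`_i = \sum_(j < size s) c j *: s`_j.
  by move=> i; apply: ls; apply: mem_nth.
move/choice => [c cE].
pose M : 'M[K]_(size l, size s) := \matrix_(i, j) c i j.
have : kermx M != 0.
  rewrite -mxrank_eq0 mxrank_ker subn_eq0 -ltnNge.
  exact: leq_ltn_trans (rank_leq_col M) sl.
case/rowV0Pn => r /sub_kermxP rM; apply/negP; rewrite negbK.
pose a i := if insub i is Some j then r 0 (j : 'I_(size l)) else 0.
have aE (i : 'I_(size l)) : a i = r 0 i by rewrite /a valK.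
apply/eqP/rowP => i; rewrite mxE -aE; apply: (lF a) => //.
under eq_bigr do rewrite aE cE scaler_sumr.
rewrite exchange_big big1 // => j _ /=.
under eq_bigr do rewrite scalerA; rewrite -scaler_suml.
have /rowP/(_ j) := rM; rewrite !mxE => rj.
by rewrite (eq_bigr (fun i => r 0 i * M i j)) ?rj ?scale0r // => k _; rewrite mxE.
Qed.

Lemma lspan_rcons l v : lfree l -> ~ lspan l v -> lfree (rcons l v).
Proof.
move=> lF nv c; rewrite size_rcons big_ord_recr /= nth_rcons ltnn eqxx.
under eq_bigr => i _ do rewrite nth_rcons ltn_ord.
have [cl0|cl0] := eqVneq (c (size l)) 0.
  rewrite cl0 scale0r addr0 => s0 i; rewrite ltnS leq_eqVlt => /orP[/eqP -> //|].
  exact: lF.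
move/eqP; rewrite addrC addr_eq0 => /eqP vE; case: nv.
exists (fun i => - (c (size l))^-1 * c i).
under eq_bigr do rewrite -scalerA; rewrite -scaler_sumr scaleNr -scalerN -vE.
by rewrite scalerA mulVf // scale1r.
Qed.

(** A vector of [U] outside the span of a free list can be appended to it; [lfree_size] bounds the
    length by [size s], so the process stops. *)
Lemma basis_extension s (U : V -> Prop) l :
  (forall v, U v -> lspan s v) -> {in l, forall v, U v} -> lfree l ->
  exists l', [/\ {in l', forall v, U v}, lfree (l ++ l')
    & forall v, U v -> lspan (l ++ l') v].
Proof.
move=> Us; have [n] := ubnP (size s - size l).
elim: n l => // n IH l ln lU lF.
case: (pselect (forall v, U v -> lspan l v)) => [Ul|/existsNP[v /not_implyP[Uv nv]]].
  by exists [::]; rewrite cats0; split.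
have lvF := lspan_rcons lF nv.
have lvU : {in rcons l v, forall v, U v}.
  by move=> w; rewrite mem_rcons inE => /orP[/eqP ->|/lU].
have := lfree_size lvF (fun w wl => Us w (lvU w wl)); rewrite size_rcons => ls.
have [|l' [l'U l'F l'S]] := IH _ _ lvU lvF.
  by rewrite size_rcons; move: ln; rewrite ltnS; apply: leq_trans; rewrite ltn_sub2l.
exists (v :: l'); rewrite -cat_rcons; split=> // w; rewrite inE => /orP[/eqP -> //|].
exact: l'U.
Qed.

End Span.

Lemma lspan_map (K : fieldType) (V W : lmodType K) (f : {linear V -> W}) s v :
  lspan s v -> lspan (map f s) (f v).
Proof.
move=> [c ->]; exists c; rewrite linear_sum size_map; apply: eq_bigr => i _.
by rewrite linearZ (nth_map 0).
Qed.

Lemma lspan_cat (K : fieldType) (V : lmodType K) (s t : seq V) v w :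
  lspan s v -> lspan t w -> lspan (s ++ t) (v + w).
Proof.
move=> [c ->] [d ->].
exists (fun i => if (i < size s)%N then c i else d (i - size s)%N).
rewrite size_cat big_split_ord /=; congr (_ + _); apply: eq_bigr => i _.
  by rewrite nth_cat ltn_ord.
by rewrite nth_cat ltnNge leq_addr /= addKn.
Qed.

Lemma lspan_sum (K : fieldType) (V : lmodType K) (I : Type) (r : seq I)
    (c : I -> K) (g : I -> V) :
  lspan [seq g i | i <- r] (\sum_(i <- r) c i *: g i).
Proof.
elim: r => [|i r IH]; first by exists (fun=> 0); rewrite big_nil big_ord0.
rewrite big_cons -cat1s map_cat; apply: lspan_cat => //.
by exists (fun=> c i); rewrite big_ord1.
Qed.

Lemma fin_dim_surj (K : fieldType) (V W : lmodType K) (f : {linear V -> W}) :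
  (forall w, exists v, f v = w) -> fin_dim V -> fin_dim W.
Proof.
move=> f_surj [s sP]; exists (map f s) => w; have [v <-] := f_surj w.
by apply: lspan_map; apply: sP.
Qed.

(** A free list spanning the image is lifted vector by vector; [basis_extension] provides it from
    the spanning list of the larger space. *)
Lemma fin_dim_inj (K : fieldType) (U V : lmodType K) (f : {linear U -> V}) :
  injective f -> fin_dim V -> fin_dim U.
Proof.
move=> f_inj [s sP].
have [|||l [lU _ lS]] := @basis_extension _ V s (fun v => exists u, f u = v) [::].
- by move=> v _; apply: sP.
- by [].
- by move=> c _ i.
have : forall v, exists u, v \in l -> f u = v.
  move=> v; case vl : (v \in l); last by exists 0.
  by have [u] := lU v vl; exists u.
move/choice => [g gP]; exists (map g l) => u.
have [|c cE] := lS (f u); first by exists u.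
exists c; apply: f_inj; rewrite cE linear_sum size_map; apply: eq_bigr => i _.
by rewrite linearZ (nth_map 0) //= gP // mem_nth.
Qed.

Lemma fin_dim_extension (K : fieldType) (U V W : lmodType K)
    (f : {linear U -> V}) (g : {linear V -> W}) :
  short_exact f g -> fin_dim V <-> fin_dim U /\ fin_dim W.
Proof.
move=> [f_inj fg g_surj]; split=> [Vfin|[[s sP] [t tP]]].
  by split; [exact: (fin_dim_inj f_inj) | exact: (fin_dim_surj g_surj)].
have [r rP] := choice g_surj.
exists (map f s ++ map r t) => v.
have [c cE] := tP (g v).
pose w := \sum_(i < size t) c i *: r t`_i.
have gw : g (v - w) = 0.
  rewrite linearB cE linear_sum -sumrB big1 // => i _.
  by rewrite linearZ /= rP subrr.
have [u uE] := (fg _).1 gw.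
rewrite -[v](subrK w) -uE; apply: lspan_cat; first exact/lspan_map/sP.
by exists c; rewrite size_map; apply: eq_bigr => i _; rewrite (nth_map 0).
Qed.

Lemma fin_dim0 (K : fieldType) (V : lmodType K) : (forall v : V, v = 0) -> fin_dim V.
Proof. by move=> V0; exists [::] => v; exists (fun=> 0); rewrite big_ord0. Qed.

Lemma fin_dim_ffun (K : fieldType) n : fin_dim {ffun 'I_n -> K^o}.
Proof.
exists [seq ([ffun j => (i == j)%:R] : {ffun 'I_n -> K^o}) | i <- enum 'I_n] => v.
exists (fun i => if insub i is Some j then v (j : 'I_n) else 0).
apply/ffunP => j; rewrite sum_ffunE size_map size_enum_ord (bigD1 j) //=.
rewrite valK ffunE (nth_map j) ?size_enum_ord // ffunE nth_ord_enum eqxx.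
rewrite big1 ?addr0 => [|i ij]; first exact/esym/mulr1.
rewrite valK ffunE (nth_map j) ?size_enum_ord // ffunE nth_ord_enum (negPf ij).
exact: mulr0.
Qed.

(** [W] is indexed one degree higher, like the last term of the sequences of the theorem. Its degree
    0 part occurs in none of them, whence the separate hypothesis. *)
Lemma graded_fin_dim_extension (K : fieldType) (U V W : nat -> lmodType K) :
  (forall w : W 0, w = 0) ->
  (forall j, exists (f : {linear U j -> V j}) (g : {linear V j -> W j.+1}),
     short_exact f g) ->
  graded_fin_dim V <-> graded_fin_dim U /\ graded_fin_dim W.
Proof.
move=> W0 ses; split.
  move=> [Vfin [N VN]]; split; split.
  - move=> j; have [f [g /fin_dim_extension fg]] := ses j.
    by have [/(_ (Vfin j))[]] := fg.
  - exists N => j Nj u; have [f [g [f_inj _ _]]] := ses j.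
    by apply: f_inj; rewrite linear0; apply: VN.
  - case=> [|j]; first exact: fin_dim0.
    have [f [g /fin_dim_extension fg]] := ses j.
    by have [/(_ (Vfin j))[]] := fg.
  - exists N.+1 => -[//|j] Nj w; have [f [g [_ _ g_surj]]] := ses j.
    by have [v <-] := g_surj w; rewrite (VN j Nj v) linear0.
move=> [[Ufin [N UN]] [Wfin [N' WN]]]; split.
  move=> j; have [f [g /fin_dim_extension fg]] := ses j.
  by apply: fg.2.
exists (maxn N N') => j; rewrite geq_max => /andP[Nj N'j] v.
have [f [g [_ fg _]]] := ses j.
have [u <-] := (fg v).1 (WN _ (leqW N'j) _).
by rewrite (UN j Nj u) linear0.
Qed.

(** * Free modules and semilinear maps *)

(** A predicate on plain functions, so that the same lifting lemmas serve maps over the identity,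
    [inc], [rho] and the composite [inc \o rho]. *)
Definition semilin (C C' : nzRingType) (r : C -> C')
    (M : lmodType C) (M' : lmodType C') (f : M -> M') : Prop :=
  forall c x y, f (c *: x + y) = r c *: f x + f y.

Section Semilinear.
Variables (C C' : nzRingType) (r : {rmorphism C -> C'}).
Variables (M : lmodType C) (M' : lmodType C') (f : M -> M').
Hypothesis f_lin : semilin r f.

Lemma semilinD x y : f (x + y) = f x + f y.
Proof. by have := f_lin 1 x y; rewrite rmorph1 !scale1r. Qed.

Lemma semilin0 : f 0 = 0.
Proof. by apply: (@addrI _ (f 0)); rewrite -semilinD !addr0. Qed.

Lemma semilinZ c x : f (c *: x) = r c *: f x.
Proof. by have := f_lin c x 0; rewrite !addr0 semilin0 addr0. Qed.

Lemma semilinN x : f (- x) = - f x.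
Proof. by rewrite -scaleN1r semilinZ rmorphN rmorph1 scaleN1r. Qed.

Lemma semilinB x y : f (x - y) = f x - f y.
Proof. by rewrite semilinD semilinN. Qed.

Lemma semilin_sum I (s : seq I) (P : pred I) (F : I -> M) :
  f (\sum_(i <- s | P i) F i) = \sum_(i <- s | P i) f (F i).
Proof.
apply: (big_morph f) => [x y|]; [exact: semilinD | exact: semilin0].
Qed.

End Semilinear.

Lemma linear_semilin (C : nzRingType) (M M' : lmodType C)
  (f : {linear M -> M'}) : semilin idfun f.
Proof. by move=> c x y; rewrite linearP. Qed.

Lemma sum_fst_snd (I T : eqType) (V : zmodType) (F : T * I -> V)
    (l : seq (T * I)) :
  \sum_(p <- l) F p =
  \sum_(x <- undup (map snd l)) \sum_(p <- l | p.2 == x) F p.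
Proof.
rewrite (exchange_big_dep predT) //=; rewrite [LHS]big_seq [RHS]big_seq.
apply: eq_bigr => p pl.
rewrite -big_filter.
have -> : [seq i <- undup (map snd l) | p.2 == i] = [:: p.2].
  rewrite (eq_filter (a2 := pred1 p.2)) => [|i /=]; last by rewrite eq_sym.
  by rewrite filter_pred1_uniq ?undup_uniq // mem_undup map_f.
by rewrite big_seq1.
Qed.

Section FreeModule.
Variables (K : fieldType) (C : algType K) (M : lmodType C).
Variables (X : choiceType) (e : X -> M) (eB : is_basis e).

Lemma basis_list m : exists l : seq (C * X), m = \sum_(p <- l) p.1 *: e p.2.
Proof.
have [s [a ->]] := basis_span eB m.
by exists [seq (a x, x) | x <- s]; rewrite big_map.
Qed.

(** A list may mention a basis element several times, so only the total coefficient of each one is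
    determined. *)
Lemma basis_coef0 (l : seq (C * X)) : \sum_(p <- l) p.1 *: e p.2 = 0 ->
  forall x, \sum_(p <- l | p.2 == x) p.1 = 0.
Proof.
rewrite sum_fst_snd => l0 x.
have E y : \sum_(p <- l | p.2 == y) p.1 *: e p.2 =
    (\sum_(p <- l | p.2 == y) p.1) *: e y.
  by rewrite scaler_suml; apply: eq_bigr => p /eqP ->.
have {}l0 : \sum_(y <- undup (map snd l))
    (\sum_(p <- l | p.2 == y) p.1) *: e y = 0.
  by rewrite -[RHS]l0; apply: eq_bigr => y _; rewrite E.
case xl : (x \in map snd l).
  apply: (Defs.basis_free eB (a := fun y => \sum_(p <- l | p.2 == y) p.1)
    (undup_uniq _) l0).
  by rewrite mem_undup.
rewrite big_seq_cond big1 // => p /andP[pl /eqP px].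
by move/negP: xl; case; rewrite -px; apply: map_f.
Qed.

(** The prescribed values are only additive in the coefficient: besides semilinear maps this covers
    the derivation-like map [st] constructed from [sigma]. *)
Lemma free_extend (V : zmodType) (v : X -> C -> V) :
  (forall x c c', v x (c + c') = v x c + v x c') ->
  exists f : M -> V, forall l : seq (C * X),
    f (\sum_(p <- l) p.1 *: e p.2) = \sum_(p <- l) v p.2 p.1.
Proof.
move=> vD.
have v0 x : v x 0 = 0 by apply: (@addrI _ (v x 0)); rewrite -vD !addr0.
have vS x (l : seq (C * X)) P : v x (\sum_(p <- l | P p) p.1) =
    \sum_(p <- l | P p) v x p.1.
  by apply: (big_morph (v x)); [exact: vD | exact: v0].
have wd l : \sum_(p <- l) p.1 *: e p.2 = 0 -> \sum_(p <- l) v p.2 p.1 = 0.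
  move=> l0; rewrite sum_fst_snd big1 // => x _.
  transitivity (\sum_(p <- l | p.2 == x) v x p.1).
    by apply: eq_bigr => p /eqP ->.
  by rewrite -vS basis_coef0.
pose f m := \sum_(p <- sval (cid (basis_list m))) v p.2 p.1.
exists f => l; set m := \sum_(p <- l) _.
rewrite /f; case: (cid _) => /= l' mE.
have vN x c : v x (- c) = - v x c.
  by apply/eqP; rewrite -addr_eq0 -vD addNr v0.
have := wd (l' ++ [seq (- p.1, p.2) | p <- l]).
rewrite !big_cat !big_map /=.
have -> : \sum_(p <- l) - p.1 *: e p.2 = - m.
  by rewrite /m -sumrN; apply: eq_bigr => p _; rewrite scaleNr.
have -> : \sum_(p <- l) v p.2 (- p.1) = - \sum_(p <- l) v p.2 p.1.
  by rewrite -sumrN; apply: eq_bigr => p _; rewrite vN.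
rewrite -{}mE subrr => /(_ erefl) /eqP.
by rewrite subr_eq0 => /eqP.
Qed.

Lemma free_map (C' : nzRingType) (r : {rmorphism C -> C'})
    (M' : lmodType C') (v : X -> M') :
  exists2 f : M -> M', semilin r f & forall x, f (e x) = v x.
Proof.
have [|f fE] := @free_extend M' (fun x c => r c *: v x).
  by move=> x c c'; rewrite rmorphD scalerDl.
exists f => [c x y|x]; last first.
  have := fE [:: (1, x)]; rewrite !big_seq1 /= scale1r => ->.
  by rewrite rmorph1 scale1r.
have [lx ->] := basis_list x; have [ly ->] := basis_list y.
have := fE ([seq (c * p.1, p.2) | p <- lx] ++ ly).
rewrite !big_cat !big_map /= !fE.
under eq_bigr do rewrite -scalerA.
rewrite -scaler_sumr => ->; congr (_ + _); rewrite scaler_sumr.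
by apply: eq_bigr => p _; rewrite rmorphM scalerA.
Qed.

End FreeModule.

(** * Graded modules and homogeneous maps *)

Section GradedModule.
Variables (K : fieldType) (C : algType K) (gr : nat -> C -> Prop).
Variables (M : lmodType C) (grM : nat -> M -> Prop).
Hypothesis Mgr : is_graded_module gr grM.

Lemma homogD j x y : grM j x -> grM j y -> grM j (x + y).
Proof. by move=> jx jy; have := grmodP Mgr 1 jx jy; rewrite !scale1r. Qed.

Lemma homogN j x : grM j x -> grM j (- x).
Proof.
move=> jx; have := grmodP Mgr (-1) jx (grmod0 Mgr j).
by rewrite addr0 scaleN1r scaleNr scale1r.
Qed.

Lemma homogB j x y : grM j x -> grM j y -> grM j (x - y).
Proof. by move=> jx jy; apply: homogD => //; apply: homogN. Qed.

Lemma homog_sum j I (s : seq I) (P : pred I) (F : I -> M) :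
  (forall i, P i -> grM j (F i)) -> grM j (\sum_(i <- s | P i) F i).
Proof.
move=> FP; elim/big_ind: _ => //; [exact: (grmod0 Mgr) | exact: homogD].
Qed.

(** Directness is applied to the family that is m in degree j and 0 elsewhere, minus the parts of
    the list in each degree. *)
Lemma homog_component (l : seq (nat * M)) j m :
  {in l, forall p, grM p.1 p.2} -> grM j m -> m = \sum_(p <- l) p.2 ->
  m = \sum_(p <- l | p.1 == j) p.2.
Proof.
move=> lgr jm mE; pose N := (maxn j (\max_(p <- l) p.1)).+1.
pose f k := (if k == j then m else 0) - \sum_(p <- l | p.1 == k) p.2.
have fgr k : grM k (f k).
  apply: homogB; first by case: eqP => [->//|_]; apply: (grmod0 Mgr).
  rewrite big_seq_cond; apply: homog_sum => p /andP[pl /eqP <-].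
  exact: lgr.
have jN : (j < N)%N by rewrite ltnS leq_maxl.
have sf : \sum_(k < N) f k = 0.
  rewrite sumrB (bigD1 (Ordinal jN)) //= eqxx big1 ?addr0; last first.
    by move=> i /negPf; rewrite -val_eqE /= => ->.
  rewrite mE (exchange_big_dep predT) //= [X in X - _]big_seq.
  rewrite [X in _ - X]big_seq -sumrB big1 // => p pl.
  have pN : (p.1 < N)%N.
    by rewrite ltnS leq_max orbC (leq_bigmax_seq p).
  rewrite (bigD1 (Ordinal pN)) //= big1 ?addr0 ?subrr // => i /andP[/eqP ip].
  by rewrite -val_eqE /= -ip eqxx.
have /eqP := grmod_direct Mgr fgr sf jN.
by rewrite /f eqxx subr_eq0 => /eqP.
Qed.

(** Padding by zeros makes a prescribed component available even if x has no part in so high a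
    degree. *)
Lemma grmod_span_ge n x : exists N (f : nat -> M), [/\ (n <= N)%N,
  forall j, grM j (f j) & x = \sum_(j < N) f j].
Proof.
have [N [f [fgr ->]]] := grmod_span Mgr x.
exists (maxn n N), (fun j => if (j < N)%N then f j else 0).
split; first exact: leq_maxl.
  by move=> j; case: ifP => // _; apply: (grmod0 Mgr).
rewrite -(big_mkord predT (fun j => if (j < N)%N then f j else 0)).
rewrite (big_cat_nat _ (n := N)) ?leq_maxr //= [X in _ = _ + X]big1_seq ?addr0.
  by rewrite big_mkord; apply: eq_bigr => i _; rewrite ltn_ord.
by move=> j; rewrite mem_index_iota /= leqNgt => /andP[/negPf ->].
Qed.

(** Used with [D] zero and with [D] = N M. Computing modulo [D] replaces passing to the quotient
    module. *)
Record graded_submodule (D : M -> Prop) : Prop := {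
  gsub0 : D 0;
  gsubP : forall c x y, D x -> D y -> D (c *: x + y);
  gsub_comp : forall N (f : nat -> M), (forall k, grM k (f k)) ->
    D (\sum_(k < N) f k) -> forall k, (k < N)%N -> D (f k) }.

Section Submodule.
Variables (D : M -> Prop) (DP : graded_submodule D).

Lemma gsubD x y : D x -> D y -> D (x + y).
Proof. by move=> Dx Dy; have := gsubP DP 1 Dx Dy; rewrite scale1r. Qed.

Lemma gsubZ c x : D x -> D (c *: x).
Proof. by move=> Dx; have := gsubP DP c Dx (gsub0 DP); rewrite addr0. Qed.

Lemma gsubN x : D x -> D (- x).
Proof. by move=> Dx; have := gsubZ (-1) Dx; rewrite scaleN1r. Qed.

End Submodule.

Lemma zero_graded_submodule : graded_submodule (fun x => x = 0).
Proof.
split=> // [c x y -> ->|N f fgr f0 k kN]; first by rewrite scaler0 addr0.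
exact: (grmod_direct Mgr fgr f0).
Qed.

End GradedModule.

Section HomogeneousMaps.
Variables (K : fieldType) (C C' : algType K).
Variables (gr : nat -> C -> Prop) (gr' : nat -> C' -> Prop).
Variable r : {rmorphism C -> C'}.
Hypothesis r_deg : forall j c, gr j c -> gr' j (r c).
Hypothesis gr_span : forall c, exists N (f : nat -> C),
  (forall j, gr j (f j)) /\ c = \sum_(j < N) f j.

Lemma homog_expand (M : lmodType C) (grM : nat -> M -> Prop)
    (Mgr : is_graded_module gr grM) (X : choiceType) (e : X -> M) (dg : X -> nat)
    (eB : is_basis e) (e_deg : forall x, grM (dg x) (e x)) j m :
  grM j m -> exists l : seq (nat * (C * X)),
    [/\ m = \sum_(p <- l) p.2.1 *: e p.2.2, {in l, forall p, gr p.1 p.2.1}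
      & {in l, forall p, p.1 + dg p.2.2 = j}%N].
Proof.
move=> jm; have [l mE] := basis_list eB m.
have [l' [l'gr mE']] : exists l' : seq (nat * (C * X)),
    {in l', forall p, gr p.1 p.2.1} /\ m = \sum_(p <- l') p.2.1 *: e p.2.2.
  rewrite {}mE {jm}; elim: l => [|[c x] l [l' [l'gr IH]]].
    by exists [::]; rewrite !big_nil.
  have [N [f [fgr cE]]] := gr_span c.
  exists ([seq (k, (f k, x)) | k <- iota 0 N] ++ l'); split=> [p|].
    by rewrite mem_cat => /orP[/mapP[k _ ->]|/l'gr] //; apply: fgr.
  rewrite big_cons IH big_cat big_map /= cE scaler_suml; congr (_ + _).
  by rewrite -(big_mkord predT (fun i => f i *: e x)) /index_iota subn0.
exists [seq p <- l' | p.1 + dg p.2.2 == j]%N.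
split; last 2 first.
- by move=> p; rewrite mem_filter => /andP[_ /l'gr].
- by move=> p; rewrite mem_filter => /andP[/eqP].
pose h (p : nat * (C * X)) := ((p.1 + dg p.2.2)%N, p.2.1 *: e p.2.2).
rewrite big_filter (homog_component Mgr (l := map h l') _ jm) ?big_map //.
by move=> p /mapP[q ql ->]; apply: (grmod_scale Mgr) => //; apply: l'gr.
Qed.

Lemma semilin_homog (M : lmodType C) (grM : nat -> M -> Prop)
    (Mgr : is_graded_module gr grM) (X : choiceType) (e : X -> M) (dg : X -> nat)
    (eB : is_basis e) (e_deg : forall x, grM (dg x) (e x))
    (M' : lmodType C') (grM' : nat -> M' -> Prop)
    (Mgr' : is_graded_module gr' grM') (f : M -> M') (f_lin : semilin r f) :
  (forall x, grM' (dg x) (f (e x))) ->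
  forall j m, grM j m -> grM' j (f m).
Proof.
move=> fe j m jm; have [l [-> lgr ldg]] := homog_expand Mgr eB e_deg jm.
rewrite (semilin_sum f_lin) big_seq; apply: (homog_sum Mgr') => p pl.
rewrite (semilinZ f_lin) -(ldg p pl); apply: (grmod_scale Mgr') => //.
exact/r_deg/lgr.
Qed.

(** Only the component of y in degree j is kept: as [D] is graded, the congruence holds in each
    degree separately. *)
Lemma homog_preimage (N1 N0 : lmodType C') (gr1 : nat -> N1 -> Prop)
    (gr0 : nat -> N0 -> Prop) (N1gr : is_graded_module gr' gr1)
    (N0gr : is_graded_module gr' gr0) (d : {linear N1 -> N0})
    (d_deg : forall j x, gr1 j x -> gr0 j (d x))
    (D : N0 -> Prop) (DP : graded_submodule gr0 D) j z y :
  gr0 j z -> D (d y - z) -> exists2 y', gr1 j y' & D (d y' - z).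
Proof.
move=> jz Dyz; have [N [f [jN fgr yE]]] := grmod_span_ge N1gr j.+1 y.
exists (f j) => //; pose g k := d (f k) - (if k == j then z else 0).
have ggr k : gr0 k (g k).
  apply: (homogB N0gr); first exact: d_deg.
  by case: eqP => [->//|_]; apply: (grmod0 N0gr).
have := gsub_comp DP (N := N) ggr _ jN; rewrite /g eqxx; apply.
rewrite sumrB -linear_sum -yE (bigD1 (Ordinal jN) (F := fun k : 'I_N => if _ then _ else _)) //=.
rewrite eqxx big1 ?addr0 // => i /negPf.
by rewrite -val_eqE /= => ->.
Qed.

Section LiftStep.
Variables (M : lmodType C) (grM : nat -> M -> Prop).
Hypothesis Mgr : is_graded_module gr grM.
Hypothesis Mfree : exists (X : choiceType) (e : X -> M),
  is_basis e /\ forall x, exists j, grM j (e x).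
Variables (N1 N0 : lmodType C').
Variables (gr1 : nat -> N1 -> Prop) (gr0 : nat -> N0 -> Prop).
Hypothesis N1gr : is_graded_module gr' gr1.
Hypothesis N0gr : is_graded_module gr' gr0.
Variable d : {linear N1 -> N0}.
Hypothesis d_deg : forall j x, gr1 j x -> gr0 j (d x).
Variable D : N0 -> Prop.
Hypothesis DP : graded_submodule gr0 D.

Lemma lift_step_on (X : choiceType) (e : X -> M) (dg : X -> nat)
    (Q : X -> N1 -> Prop) :
  is_basis e -> (forall x, grM (dg x) (e x)) ->
  (forall x, exists2 y, gr1 (dg x) y & Q x y) ->
  exists h : M -> N1, [/\ semilin r h,
    forall j m, grM j m -> gr1 j (h m) & forall x, Q x (h (e x))].
Proof.
move=> eB edg H; have {}H x : exists y, gr1 (dg x) y /\ Q x y.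
  by have [y] := H x; exists y.
have [v vP] := choice H.
have [h h_lin hE] := free_map eB r v.
exists h; split=> // [|x]; last by rewrite hE; have [] := vP x.
apply: (semilin_homog Mgr eB edg N1gr h_lin) => x.
by rewrite hE; have [] := vP x.
Qed.

(** [E] measures the failure of an equation between maps that are semilinear only modulo [D]; such
    an equation may be tested on a basis. *)
Lemma semilin_mod_ind (E : M -> N0) :
  (forall c x y, D (E (c *: x + y) - (r c *: E x + E y))) ->
  forall (X : choiceType) (e : X -> M), is_basis e ->
  (forall x, D (E (e x))) -> forall m, D (E m).
Proof.
move=> Elin X e eB eD m; have [l ->] := basis_list eB m.
elim: l => [|p l IH].
  rewrite big_nil; have := Elin 1 0 0.
  rewrite scaler0 addr0 rmorph1 scale1r opprD addrA subrr add0r.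
  by move/(gsubN DP); rewrite opprK.
rewrite big_cons; set y := \sum_(_ <- l) _ in IH *.
have /(gsubD DP) := Elin p.1 (e p.2) y.
move/(_ _ (gsubP DP (r p.1) (eD p.2) IH)); by rewrite subrK.
Qed.

Lemma lift_step (f : M -> N0) :
  (forall c x y, D (f (c *: x + y) - (r c *: f x + f y))) ->
  (forall j x, grM j x -> gr0 j (f x)) ->
  (forall x, exists y, D (d y - f x)) ->
  exists h : M -> N1, [/\ semilin r h,
    forall j m, grM j m -> gr1 j (h m) & forall x, D (d (h x) - f x)].
Proof.
move=> f_lin f_deg H; have [X [e [eB e_deg]]] := Mfree.
have [dg dgP] := choice e_deg.
have [|h [h_lin h_deg hE]] := lift_step_on
    (Q := fun x y => D (d y - f (e x))) eB dgP.
  move=> x; have [y Dy] := H (e x).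
  have [y' jy' Dy'] := homog_preimage N1gr N0gr d_deg DP (f_deg _ _ (dgP x)) Dy.
  by exists y'.
exists h; split=> //; apply: (semilin_mod_ind _ eB) => // c x y.
rewrite h_lin linearP /=.
rewrite scalerBr [_ - _ + (_ - _)]addrACA -opprD opprB [_ - f (c *: x + y) + _]addrC.
by rewrite subrKA -opprB; apply: (gsubN DP).
Qed.

End LiftStep.
End HomogeneousMaps.

(** Dependent choice with types that vary with the index: [Q] is the invariant that allows the next
    term, [S] links consecutive terms. *)
Lemma dependent_choice (T : nat -> Type) (Q : forall i, T i -> Prop)
    (S : forall i, T i -> T i.+1 -> Prop) (x0 : T 0) :
  Q 0 x0 -> (forall i x, Q i x -> exists y, Q i.+1 y /\ S i x y) ->
  exists f : forall i, T i,
    [/\ f 0 = x0, forall i, Q i (f i) & forall i, S i (f i) (f i.+1)].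
Proof.
move=> Q0 step.
pose next i (u : {x : T i | Q i x}) : {x : T i.+1 | Q i.+1 x} :=
  exist _ (sval (cid (step i _ (svalP u)))) (svalP (cid (step i _ (svalP u)))).1.
pose F := fix F i : {x : T i | Q i x} :=
  if i is k.+1 then next k (F k) else exist _ x0 Q0.
exists (fun i => sval (F i)); split=> // i; first exact: svalP.
exact: (svalP (cid (step i _ (svalP (F i))))).2.
Qed.

(** * Chain maps constructed degree by degree *)

Section ChainLift.
Variables (K : fieldType) (C C' : algType K).
Variables (gr : nat -> C -> Prop) (gr' : nat -> C' -> Prop).
Variable r : {rmorphism C -> C'}.
Hypothesis r_deg : forall j c, gr j c -> gr' j (r c).
Hypothesis gr_span : forall c, exists N (f : nat -> C),
  (forall j, gr j (f j)) /\ c = \sum_(j < N) f j.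

Variables (M : nat -> lmodType C) (dM : forall i, {linear M i.+1 -> M i}).
Variable degM : forall i, nat -> M i -> Prop.
Hypothesis Mgr : forall i, is_graded_module gr (@degM i).
Hypothesis dM_deg : forall i j x, degM j x -> degM j (dM i x).
Hypothesis dMM : forall i x, dM i (dM i.+1 x) = 0.
Hypothesis Mfree : forall i, exists (X : choiceType) (e : X -> M i),
  is_basis e /\ forall x, exists j, degM j (e x).

Variables (N : nat -> lmodType C') (dN : forall i, {linear N i.+1 -> N i}).
Variable degN : forall i, nat -> N i -> Prop.
Hypothesis Ngr : forall i, is_graded_module gr' (@degN i).
Hypothesis dN_deg : forall i j x, degN j x -> degN j (dN i x).
Variable D : forall i, N i -> Prop.
Hypothesis DP : forall i, graded_submodule (@degN i) (@D i).

(** [g] marks the degrees in which the target is known to be exact: all of them for a resolution,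
    only the first ones for the minimal complex A^q -> A^p -> A. *)
Variable g : nat -> bool.
Hypothesis g_down : forall i, g i.+1 -> g i.
Hypothesis N_exact : forall i z, g i.+1 -> D (dN i z) ->
  exists y, D (dN i.+1 y - z).

Variable G : forall i, M i.+1 -> N i.
Hypothesis G_lin : forall i c x y,
  D (G (i := i) (c *: x + y) - (r c *: G x + G y)).
Hypothesis G_deg : forall i j (x : M i.+1), degM j x -> degN j (G x).
Hypothesis G_chain : forall i x, g i.+1 -> D (dN i (G x) + G (dM i.+1 x)).

Variable h0 : M 0 -> N 0.
Hypothesis h0_lin : semilin r h0.
Hypothesis h0_deg : forall j x, degM j x -> degN j (h0 x).
Hypothesis h0P : g 0 -> forall x, exists y, D (dN 0 y - (G x + h0 (dM 0 x))).

(* With [G = 0] this extends a chain map modulo D; with [G i] equal to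
   (-1)^(i+1) times a chain map it contracts that map to zero, the homotopy
   being [h] up to signs. *)
Lemma chain_lift_mod : exists h : forall i, M i -> N i,
  [/\ forall i, semilin r (h i),
      forall i j x, degM j x -> degN j (h i x),
      h 0 = h0
    & forall i, g i -> forall x, D (dN i (h i.+1 x) - (G x + h i (dM i x)))].
Proof.
pose Q i (h : M i -> N i) := [/\ semilin r h,
  forall j x, degM j x -> degN j (h x)
  & g i -> forall x, exists y, D (dN i y - (G x + h (dM i x)))].
pose S i (h : M i -> N i) (h' : M i.+1 -> N i.+1) :=
  g i -> forall x, D (dN i (h' x) - (G x + h (dM i x))).
have [||h [hh0 hQ hS]] := @dependent_choice (fun i => M i -> N i) Q S h0.
- by split.
- move=> i h [h_lin h_deg hE]; case gi : (g i); last first.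
    exists (fun=> 0); split; last by move=> gi'; rewrite gi' in gi.
    split=> [c x y|j x _|gi1]; first by rewrite scaler0 addr0.
      exact: (grmod0 (Ngr _)).
    by rewrite (g_down gi1) in gi.
  have [|||h' [h'_lin h'_deg h'E]] := lift_step r_deg gr_span (Mgr i.+1)
      (Mfree i.+1) (Ngr i.+1) (Ngr i) (@dN_deg i) (DP i)
      (f := fun x => G x + h (dM i x)).
  + move=> c x y; rewrite linearP h_lin scalerDr [X in _ - X]addrACA opprD.
    rewrite addrACA subrr addr0; exact: G_lin.
  + move=> j x jx; apply: (homogD (Ngr i)); first exact: G_deg.
    exact/h_deg/dM_deg.
  + by move=> x; apply: hE.
  exists h'; split=> //; split=> // gi1 x.
  (* The next obstruction is a cycle modulo [D]: [G_chain] cancels the term [G (dM x)] left by the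
     equation for h' at [dM x]. *)
  have /(N_exact gi1) [y Dy] : D (dN i (G x + h' (dM i.+1 x))).
    have := gsubD (DP i) (h'E (dM i.+1 x)) (G_chain x gi1).
    by rewrite dMM (semilin0 h_lin) addr0 [X in _ + X]addrC addrA subrK addrC -linearD.
  by exists y.
exists h; split=> // i; first by have [] := hQ i.
by have [] := hQ i.
Qed.

End ChainLift.

(** * Shifted and pointwise gradings *)

Definition shift_grading (M : zmodType) (grM : nat -> M -> Prop) (j : nat)
    (x : M) : Prop :=
  if j is i.+1 then grM i x else x = 0.

Definition shift_by (M : zmodType) (grM : nat -> M -> Prop) (i : nat) :=
  iter i (@shift_grading M) grM.

Definition pointwise_grading (k : nat) (M : Type)
    (grM : nat -> M -> Prop) (j : nat) (x : {ffun 'I_k -> M}) : Prop :=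
  forall a, grM j (x a).

Section GradingConstructions.
Variables (K : fieldType) (C : algType K) (gr : nat -> C -> Prop).
Variables (M : lmodType C) (grM : nat -> M -> Prop).
Hypothesis Mgr : is_graded_module gr grM.

Lemma shift_graded : is_graded_module gr (shift_grading grM).
Proof.
split.
- by case=> [//|j]; apply: (grmod0 Mgr).
- case=> [c x y -> ->|j]; first by rewrite scaler0 addr0.
  exact: (grmodP Mgr).
- move=> x; have [N [f [fgr ->]]] := grmod_span Mgr x.
  exists N.+1, (fun j => if j is i.+1 then f i else 0); split; first by case.
  by rewrite big_ord_recl add0r.
- case=> // N f fgr; rewrite big_ord_recl (fgr 0%N) add0r => f0 [|j] jN.
    exact: (fgr 0%N).
  by apply: (grmod_direct Mgr (f := fun i => f i.+1) _ f0) => // i; apply: (fgr i.+1).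
- move=> i [|j] a x ia; first by move=> ->; rewrite addn0; case: i ia => [|i] _;
    rewrite scaler0 //; apply: (grmod0 Mgr).
  by move=> jx; rewrite addnS; apply: (grmod_scale Mgr).
Qed.

Lemma grmod_span_ev x : exists N (f : nat -> M),
  (forall j, grM j (f j)) /\ forall n, (N <= n)%N -> x = \sum_(j < n) f j.
Proof.
have [N [f [fgr ->]]] := grmod_span Mgr x.
exists N, (fun j => if (j < N)%N then f j else 0).
split; first by move=> j; case: ifP => // _; apply: (grmod0 Mgr).
move=> n Nn; rewrite -(big_mkord predT (fun j => if (j < N)%N then f j else 0)).
rewrite (big_cat_nat _ (n := N)) //= [X in _ = _ + X]big1_seq ?addr0.
  by rewrite big_mkord; apply: eq_bigr => i _; rewrite ltn_ord.
by move=> j; rewrite mem_index_iota /= leqNgt => /andP[/negPf ->].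
Qed.

End GradingConstructions.

Lemma shift_by_graded (K : fieldType) (C : algType K) (gr : nat -> C -> Prop)
    (M : lmodType C) (grM : nat -> M -> Prop) i :
  is_graded_module gr grM -> is_graded_module gr (shift_by grM i).
Proof. by move=> Mgr; elim: i => //= i; apply: shift_graded. Qed.

Lemma pointwise_graded (K : fieldType) (C : algType K) (gr : nat -> C -> Prop)
    (M : lmodType C) (grM : nat -> M -> Prop) k :
  is_graded_module gr grM ->
  is_graded_module gr (@pointwise_grading k M grM : nat -> {ffun 'I_k -> M} -> Prop).
Proof.
move=> Mgr; split.
- by move=> j a; rewrite ffunE; apply: (grmod0 Mgr).
- by move=> j c x y jx jy a; rewrite !ffunE; apply: (grmodP Mgr).
- move=> x; have /choice[N /choice[f fP]] := fun a => grmod_span_ev Mgr (x a).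
  exists (\max_a N a), (fun j => [ffun a => f a j]).
  split; first by move=> j a; rewrite ffunE; have [] := fP a.
  apply/ffunP => a; rewrite sum_ffunE.
  have [_ /(_ _ (leq_bigmax a)) ->] := fP a.
  by apply: eq_bigr => j _; rewrite ffunE.
- move=> N f fgr f0 j jN; apply/ffunP => a; rewrite ffunE.
  apply: (grmod_direct Mgr (f := fun j => f j a)) jN => [i|]; first exact: fgr.
  by move/ffunP/(_ a): f0; rewrite sum_ffunE ffunE.
- by move=> i j a x ia jx b; rewrite ffunE; apply: (grmod_scale Mgr).
Qed.

Section AugMul.
Variables (K : fieldType) (C : algType K) (gr : nat -> C -> Prop).
Local Notation I := (positive_part gr).

Lemma aug_mulD (M : lmodType C) (x y : M) :
  aug_mul I x -> aug_mul I y -> aug_mul I (x + y).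
Proof. by move=> Ix Iy; have := aug_mulP 1 Ix Iy; rewrite !scale1r. Qed.

Lemma aug_mulN (M : lmodType C) (x : M) : aug_mul I x -> aug_mul I (- x).
Proof.
move=> Ix; have := aug_mulP (-1) Ix (aug_mul0 _ _).
by rewrite addr0 scaleN1r scaleNr scale1r.
Qed.

Lemma aug_mulB (M : lmodType C) (x y : M) :
  aug_mul I x -> aug_mul I y -> aug_mul I (x - y).
Proof. by move=> Ix Iy; apply: aug_mulD => //; apply: aug_mulN. Qed.

Lemma semilin_aug_mul (C' : algType K) (gr' : nat -> C' -> Prop)
    (r : {rmorphism C -> C'}) (M : lmodType C) (M' : lmodType C') (f : M -> M') :
  (forall a, I a -> positive_part gr' (r a)) -> semilin r f ->
  forall x, aug_mul I x -> aug_mul (positive_part gr') (f x).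
Proof.
move=> rI f_lin x [s [sI ->]]; exists [seq (r p.1, f p.2) | p <- s]; split.
  by move=> p /mapP[q qs ->]; apply/rI/sI.
rewrite big_map (semilin_sum f_lin); apply: eq_bigr => p _.
exact: (semilinZ f_lin).
Qed.

End AugMul.

Lemma positive_part_morph (K : fieldType) (C C' : algType K)
    (gr : nat -> C -> Prop) (gr' : nat -> C' -> Prop) (r : {rmorphism C -> C'}) :
  (forall j c, gr j c -> gr' j (r c)) ->
  forall a, positive_part gr a -> positive_part gr' (r a).
Proof.
move=> r_deg a [N [f [fgr ->]]]; exists N, (fun j => r (f j)).
by split=> [j|]; [apply/r_deg/fgr | rewrite rmorph_sum].
Qed.

Section EpsLift.
Variables (K : fieldType) (C C' : algType K).
Variables (gr : nat -> C -> Prop) (gr' : nat -> C' -> Prop).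
Variable r : {rmorphism C -> C'}.
Hypothesis r_deg : forall j c, gr j c -> gr' j (r c).
Hypothesis gr_span : forall c, exists N (f : nat -> C),
  (forall j, gr j (f j)) /\ c = \sum_(j < N) f j.
Variables (eC : C -> K) (eC' : C' -> K).
Hypothesis r_eps : forall c, eC' (r c) = eC c.
Hypothesis eC'_alg : forall c, eC' c%:A = c.

Definition eps_linear (D : algType K) (eD : D -> K) (M : lmodType D)
  (eM : M -> K) := forall c x y, eM (c *: x + y) = eD c * eM x + eM y.

Lemma eps_linear0 (D : algType K) (eD : D -> K) (M : lmodType D)
  (eM : M -> K) : eD 1 = 1 -> eps_linear eD eM -> eM 0 = 0.
Proof.
move=> e1 eL; have := eL 1 0 0; rewrite e1 scaler0 addr0 mul1r => E.
by apply: (@addrI _ (eM 0)); rewrite -E addr0.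
Qed.

(** A basis element x is sent to the multiple of u by its augmentation. This preserves degrees
    because u has degree 0 and the augmentation vanishes in positive degrees. *)
Lemma eps_lift (M : lmodType C) (grM : nat -> M -> Prop)
    (N : lmodType C') (grN : nat -> N -> Prop) (eM : M -> K) (eN : N -> K) u :
  is_graded_module gr grM -> is_graded_module gr' grN ->
  (exists (X : choiceType) (e : X -> M),
     is_basis e /\ forall x, exists j, grM j (e x)) ->
  eps_linear eC eM -> eps_linear eC' eN ->
  (forall j x, grM j.+1 x -> eM x = 0) -> grN 0%N u -> eN u = 1 ->
  exists h : M -> N, [/\ semilin r h,
    forall j x, grM j x -> grN j (h x) & forall x, eN (h x) = eM x].
Proof.
move=> Mgr Ngr [X [e [eB e_deg]]] eML eNL eMgr u0 eu.
have [dg dgP] := choice e_deg.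
have e1 : eC' 1 = 1 by rewrite -[X in eC' X]scale1r eC'_alg.
have eC1 : eC 1 = 1 by rewrite -r_eps rmorph1.
have eN0 := eps_linear0 e1 eNL; have eM0 := eps_linear0 eC1 eML.
have [|h [h_lin h_deg hE]] := lift_step_on r_deg gr_span Mgr Ngr
    (Q := fun x y => eN y = eM (e x)) eB dgP.
  move=> x; exists ((eM (e x))%:A *: u).
    case jx : (dg x) (dgP x) => [|j] dx.
      by have := grmodP Ngr (eM (e x)) u0 (grmod0 Ngr 0); rewrite addr0.
    by rewrite (eMgr _ _ dx) !scale0r; apply: (grmod0 Ngr).
  by have := eNL (eM (e x))%:A u 0; rewrite addr0 eN0 eu eC'_alg mulr1 addr0.
exists h; split=> // m; have [l ->] := basis_list eB m.
elim: l => [|p l IH].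
  by rewrite !big_nil (semilin0 h_lin) eN0 eM0.
by rewrite !big_cons h_lin eNL eML r_eps hE IH.
Qed.

End EpsLift.

(** * The homological argument *)

Section FreeFun.
Variables (K : fieldType) (A : algType K) (T : finType).

Definition free_delta (a : T) : {ffun T -> A^o} := [ffun b => (a == b)%:R].

Lemma free_deltaE (x : {ffun T -> A^o}) :
  x = \sum_a (x a : A) *: free_delta a.
Proof.
apply/ffunP => b; rewrite sum_ffunE (bigD1 b) //= !ffunE eqxx big1 ?addr0.
  exact/esym/mulr1.
by move=> a /negPf ab; rewrite !ffunE ab; apply: mulr0.
Qed.

Lemma free_delta_basis : is_basis free_delta.
Proof.
split=> [m|s a us s0 x xs].
  by exists (index_enum _), (fun a => m a); apply: free_deltaE.
move/ffunP/(_ x): s0; rewrite sum_ffunE ffunE (bigD1_seq x) //=.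
rewrite !ffunE eqxx big1 ?addr0 => [|i /negPf ix]; last first.
  by rewrite !ffunE ix; apply: mulr0.
by rewrite [_ *: _]mulr1.
Qed.

Lemma aug_mul_free (I : A -> Prop) (x : {ffun T -> A^o}) :
  (forall a, I (x a)) -> aug_mul I x.
Proof.
move=> xI; exists [seq (x a : A, free_delta a) | a <- index_enum _]; split.
  by move=> p /mapP[a _ ->]; apply: xI.
by rewrite big_map /= [LHS]free_deltaE.
Qed.

End FreeFun.

Section Comparison.
Variables (K : fieldType) (C C' : algType K).
Variables (gr : nat -> C -> Prop) (gr' : nat -> C' -> Prop).
Variable r : {rmorphism C -> C'}.
Hypothesis r_deg : forall j c, gr j c -> gr' j (r c).
Hypothesis gr_span : forall c, exists N (f : nat -> C),
  (forall j, gr j (f j)) /\ c = \sum_(j < N) f j.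

Variables (M : nat -> lmodType C) (dM : forall i, {linear M i.+1 -> M i}).
Variable degM : forall i, nat -> M i -> Prop.
Hypothesis Mgr : forall i, is_graded_module gr (@degM i).
Hypothesis dM_deg : forall i j x, degM j x -> degM j (dM i x).
Hypothesis dMM : forall i x, dM i (dM i.+1 x) = 0.
Hypothesis Mfree : forall i, exists (X : choiceType) (e : X -> M i),
  is_basis e /\ forall x, exists j, degM j (e x).

Variables (N : nat -> lmodType C') (dN : forall i, {linear N i.+1 -> N i}).
Variable degN : forall i, nat -> N i -> Prop.
Hypothesis Ngr : forall i, is_graded_module gr' (@degN i).
Hypothesis dN_deg : forall i j x, degN j x -> degN j (dN i x).
Variable g : nat -> bool.
Hypothesis g_down : forall i, g i.+1 -> g i.
Hypothesis N_exact : forall i x, g i.+1 -> dN i x = 0 ->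
  exists y, dN i.+1 y = x.

Let D0 i := zero_graded_submodule (@Ngr i).

Lemma chain_extend (h0 : M 0 -> N 0) :
  semilin r h0 -> (forall j x, degM j x -> degN j (h0 x)) ->
  (g 0 -> forall x, exists y, dN 0 y = h0 (dM 0 x)) ->
  exists h : forall i, M i -> N i, [/\ forall i, semilin r (h i),
    forall i j x, degM j x -> degN j (h i x), h 0 = h0
    & forall i x, g i -> dN i (h i.+1 x) = h i (dM i x)].
Proof.
move=> h0_lin h0_deg h0P.
have [|||||h [h_lin h_deg hh0 hE]] := chain_lift_mod r_deg gr_span Mgr dM_deg
    dMM Mfree Ngr dN_deg D0 g_down (G := fun i (x : M i.+1) => 0) _ _ _ _
    h0_lin h0_deg.
- move=> i z gi z0; have [|y yE] := @N_exact i z _ z0; first exact: gi.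
  by exists y; rewrite yE subrr.
- by move=> i c x y; rewrite scaler0 addr0 subr0.
- by move=> i j x _; apply: (grmod0 (Ngr i)).
- by move=> i x _; rewrite linear0 addr0.
- by move=> g0 x; have [y yE] := h0P g0 x; exists y; rewrite yE add0r subrr.
exists h; split=> // i x gi; apply/eqP; rewrite -subr_eq0; apply/eqP.
by have := hE i gi x; rewrite add0r.
Qed.

(** The comparison theorem over a change of rings: freeness is used for the source, exactness within
    the range [g] for the target. *)
Lemma comparison (eC : C -> K) (eC' : C' -> K)
    (eM : M 0 -> K) (eN : N 0 -> K) (u : N 0) :
  (forall c, eC' (r c) = eC c) -> (forall c, eC' c%:A = c) ->
  eps_linear eC eM -> eps_linear eC' eN ->
  (forall j x, degM j.+1 x -> eM x = 0) -> degN 0 u -> eN u = 1 ->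
  (forall x, eM (dM 0 x) = 0) -> (forall x, eN x = 0 -> exists y, dN 0 y = x) ->
  exists h : forall i, M i -> N i, [/\ forall i, semilin r (h i),
    forall i j x, degM j x -> degN j (h i x), forall x, eN (h 0 x) = eM x
    & forall i x, g i -> dN i (h i.+1 x) = h i (dM i x)].
Proof.
move=> r_eps eC'_alg eML eNL eM_deg u0 eu eMd N_ex0.
have [h0 [h0_lin h0_deg h0E]] := eps_lift r_deg gr_span r_eps eC'_alg
  (Mgr 0) (Ngr 0) (Mfree 0) eML eNL eM_deg u0 eu.
have [|h [h_lin h_deg hh0 hE]] := chain_extend h0_lin h0_deg.
  by move=> _ x; apply: N_ex0; rewrite h0E eMd.
by exists h; split=> //; rewrite hh0.
Qed.

(** A chain map that lands in boundaries in degree 0 is null-homotopic. The usual homotopy is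
    [(-1)^i h i]; the signs are put on f instead, which makes the recursion an instance of
    [chain_lift_mod]. *)
Lemma contraction (f : forall i, M i -> N i) :
  (forall i x, g i -> dN i x = 0 -> exists y, dN i.+1 y = x) ->
  (forall i, semilin r (f i)) -> (forall i j x, degM j x -> degN j (f i x)) ->
  (forall x, exists y, dN 0 y = f 0 x) ->
  (forall i x, g i -> dN i (f i.+1 x) = f i (dM i x)) ->
  exists h : forall i, M i -> N i.+1, [/\ forall i, semilin r (h i),
    forall i j x, degM j x -> degN j (h i x),
    forall x, dN 0 (h 0 x) = f 0 x
    & forall i, g i -> forall x,
        dN i.+1 (h i.+1 x) = (-1) ^+ i.+1 *: f i.+1 x + h i (dM i x)].
Proof.
move=> N_ex f_lin f_deg f0 f_d.
have [|||h0 [h0_lin h0_deg h0E]] := lift_step r_deg gr_span (Mgr 0) (Mfree 0)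
    (Ngr 1) (Ngr 0) (@dN_deg 0) (D0 0) (f := f 0).
- by move=> c x y; rewrite f_lin subrr.
- exact: f_deg.
- by move=> x; have [y yE] := f0 x; exists y; rewrite yE subrr.
have {}h0E x : dN 0 (h0 x) = f 0 x.
  by apply/eqP; rewrite -subr_eq0; apply/eqP.
have f_dd i x : g i -> dN i (((-1) ^+ i.+1 : C') *: f i.+1 x) =
    ((-1) ^+ i.+1 : C') *: f i (dM i x) by move=> gi; rewrite linearZ /= f_d.
have [|||||h [h_lin h_deg hh0 hE]] := chain_lift_mod r_deg gr_span Mgr dM_deg
    dMM Mfree (N := fun i => N i.+1) (fun i => Ngr i.+1) (fun i => @dN_deg i.+1)
    (fun i => D0 i.+1) g_down
    (G := fun i (x : M i.+1) => ((-1) ^+ i.+1 : C') *: f i.+1 x) _ _ _ _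
    h0_lin h0_deg.
- move=> i z gi z0; have [|y yE] := @N_ex i.+1 z _ z0; first exact: gi.
  by exists y; rewrite yE subrr.
- move=> i c x y; rewrite f_lin scalerDr !scalerA.
  by rewrite -[_ * r c]commr_sign subrr.
- move=> i j x jx; rewrite -signr_odd; case: (odd _).
    by rewrite expr1 scaleN1r; apply: (homogN (Ngr _)); apply: f_deg.
  by rewrite expr0 scale1r; apply: f_deg.
- by move=> i x gi; rewrite f_dd // -scalerDl exprS mulN1r addNr scale0r.
- move=> g0 x.
  have /(N_ex 0 _ g0)[y yE] : dN 0 (((-1) ^+ 1 : C') *: f 1 x + h0 (dM 0 x)) = 0.
    by rewrite linearD f_dd // h0E expr1 scaleN1r addNr.
  by exists y; rewrite yE subrr.
exists h; split=> // [x|i gi x]; first by rewrite hh0.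
by apply/eqP; rewrite -subr_eq0; apply/eqP; apply: hE.
Qed.

End Comparison.

(** * The kernel N of rho and the submodules N M *)

Section KernelIdeal.
Variables (K : fieldType) (A B : algType K) (rho : {rmorphism B -> A}).
Variables (grA : nat -> A -> Prop) (grB : nat -> B -> Prop).
Hypothesis rho_deg : forall j b, grB j b -> grA j (rho b).
Hypothesis Agr : is_graded_module grA (grA : nat -> A^o -> Prop).
Hypothesis grB_span : forall b, exists N (f : nat -> B),
  (forall j, grB j (f j)) /\ b = \sum_(j < N) f j.

(** The submodule N M, N being the kernel of [rho]; congruence modulo it is equality in the A-module
    M / N M. *)
Definition ker_mul (M : lmodType B) : M -> Prop :=
  @aug_mul K B (fun b : B => rho b = 0) M.

Lemma ker_mul0 (M : lmodType B) : ker_mul (0 : M).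
Proof. by exists [::]; rewrite big_nil. Qed.

Lemma ker_mulP (M : lmodType B) b (x y : M) :
  ker_mul x -> ker_mul y -> ker_mul (b *: x + y).
Proof.
move=> [s [sI ->]] [t [tI ->]].
exists ([seq (b * p.1, p.2) | p <- s] ++ t); split=> [p|].
  rewrite mem_cat => /orP[/mapP[q qs ->]|/tI //].
  by rewrite rmorphM (sI q qs) mulr0.
rewrite big_cat big_map scaler_sumr; congr (_ + _); apply: eq_bigr => p _.
by rewrite scalerA.
Qed.

Lemma ker_mulD (M : lmodType B) (x y : M) :
  ker_mul x -> ker_mul y -> ker_mul (x + y).
Proof. by move=> Dx Dy; rewrite -[x]scale1r; apply: ker_mulP. Qed.

Lemma ker_mulI (M : lmodType B) b (x : M) : rho b = 0 -> ker_mul (b *: x).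
Proof.
move=> b0; exists [:: (b, x)]; split; last by rewrite big_seq1.
by move=> p; rewrite inE => /eqP ->.
Qed.

Lemma ker_mul_sum (M : lmodType B) T (s : seq T) (F : T -> M) :
  (forall t, ker_mul (F t)) -> ker_mul (\sum_(t <- s) F t).
Proof.
move=> FP; elim: s => [|t s IH]; first by rewrite big_nil; apply: ker_mul0.
by rewrite big_cons -[F t]scale1r; apply: ker_mulP.
Qed.

Lemma ker_mulN (M : lmodType B) (x : M) : ker_mul x -> ker_mul (- x).
Proof.
by move=> Dx; rewrite -scaleN1r -[_ *: _]addr0; apply/ker_mulP/ker_mul0.
Qed.

Lemma semilin_ker_mul (M : lmodType B) (M' : lmodType A) (f : M -> M') x :
  semilin rho f -> ker_mul x -> f x = 0.
Proof.
move=> f_lin [s [sI ->]]; rewrite (semilin_sum f_lin) big_seq big1 // => p ps.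
by rewrite (semilinZ f_lin) (sI p ps) scale0r.
Qed.

(** As [rho] preserves degrees, N contains the homogeneous components of its elements; splitting
    both factors of each product gives homogeneous terms of N M. *)
Lemma ker_mul_graded (M : lmodType B) (grM : nat -> M -> Prop) :
  is_graded_module grB grM -> graded_submodule grM (@ker_mul M).
Proof.
move=> Mgr; split; [exact: ker_mul0 | exact: ker_mulP |].
move=> N f fgr [s [sI fE]].
have [l [lgr lI lE]] : exists l : seq (nat * (B * M)),
    [/\ {in l, forall p, grM p.1 (p.2.1 *: p.2.2)},
        {in l, forall p, rho p.2.1 = 0}
      & \sum_(p <- s) p.1 *: p.2 = \sum_(p <- l) p.2.1 *: p.2.2].
  elim: s sI {fE} => [|[b x] s IH] sI.
    by exists [::]; split=> //; rewrite !big_nil.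
  have [|l [lgr lI lE]] := IH.
    by move=> p ps; apply: sI; rewrite inE ps orbT.
  have [n1 [u [ugr bE]]] := grB_span b.
  have [n2 [v [vgr xE]]] := grmod_span Mgr x.
  have b0 : rho b = 0 by apply: (sI (b, x)); rewrite mem_head.
  have u0 i : (i < n1)%N -> rho (u i) = 0.
    apply: (grmod_direct Agr (f := fun i => rho (u i))).
      by move=> j; apply: rho_deg.
    by rewrite -rmorph_sum -bE b0.
  exists ([seq (i + j, (u i, v j))%N | i <- iota 0 n1, j <- iota 0 n2] ++ l).
  split.
  - move=> p; rewrite mem_cat => /orP[/allpairsP[[i j] [_ _ ->]]|/lgr//].
    by apply: (grmod_scale Mgr).
  - move=> p; rewrite mem_cat => /orP[/allpairsP[[i j] [/= i1 _ ->]]|/lI//] /=.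
    by apply: u0; rewrite mem_iota in i1.
  rewrite big_cons big_cat -lE; congr (_ + _); rewrite big_allpairs_dep /=.
  rewrite bE scaler_suml -(big_mkord predT (fun i => u i *: x)).
  rewrite /index_iota subn0; apply: eq_bigr => i _.
  rewrite xE scaler_sumr -(big_mkord predT (fun j => u i *: v j)).
  by rewrite /index_iota subn0.
move=> k kN.
pose h (p : nat * (B * M)) := (p.1, p.2.1 *: p.2.2).
(* The list contains the terms of the whole sum and all [- f i] with i different from k. Its total
   is [f k], and its part of degree k consists of terms of N M. *)
have := homog_component Mgr
  (l := map h l ++ [seq (nat_of_ord i, - f i) | i <- [seq i <- enum 'I_N | i != Ordinal kN]])
  _ (fgr k).
rewrite !big_cat !big_map /= => -> //; last 2 first.
- move=> p; rewrite mem_cat => /orP[/mapP[q ql ->]|/mapP[i _ ->]] /=.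
    exact: lgr.
  exact: (homogN Mgr).
- rewrite -lE -fE big_filter big_enum_cond /= (bigD1 (Ordinal kN)) //=.
  by rewrite sumrN addrK.
rewrite [X in _ + X]big1_seq ?addr0.
  rewrite big_seq_cond; elim/big_rec: _ => [|p y /andP[pl _] Dy].
    exact: ker_mul0.
  rewrite -[X in X + y]scale1r; apply: ker_mulP => //.
  by apply: ker_mulI; apply: lI.
by move=> i /andP[/eqP ik]; rewrite mem_filter -val_eqE /= ik eqxx.
Qed.

Variables (T : choiceType) (nn : T -> B).
Hypothesis nn0 : forall t, rho (nn t) = 0.
Hypothesis nn_span : forall b, rho b = 0 ->
  exists l : seq (B * T), b = \sum_(p <- l) nn p.2 * p.1.
Hypothesis nn_free : forall (s : seq T) (b : T -> B), uniq s ->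
  \sum_(t <- s) nn t * b t = 0 -> {in s, forall t, b t = 0}.

Lemma ker_mul_span (M : lmodType B) (z : M) : ker_mul z ->
  exists (s : seq T) (y : T -> M), uniq s /\ z = \sum_(t <- s) nn t *: y t.
Proof.
move=> [s [sI ->]].
have [l ->] : exists l : seq (M * T),
    \sum_(p <- s) p.1 *: p.2 = \sum_(p <- l) nn p.2 *: p.1.
  elim: s sI => [|[b x] s IH] sI; first by exists [::]; rewrite !big_nil.
  have [|l lE] := IH; first by move=> p ps; apply: sI; rewrite inE ps orbT.
  have [|lb bE] := nn_span (b := b); first by apply: (sI (b, x)); rewrite mem_head.
  exists ([seq (p.1 *: x, p.2) | p <- lb] ++ l).
  rewrite big_cons big_cat big_map -lE /= bE scaler_suml; congr (_ + _).
  by apply: eq_bigr => p _; rewrite scalerA.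
exists (undup (map snd l)), (fun t => \sum_(p <- l | p.2 == t) p.1).
split; first exact: undup_uniq.
rewrite sum_fst_snd; apply: eq_bigr => t _; rewrite scaler_sumr.
by apply: eq_bigr => p /eqP ->.
Qed.

(** For M free, N M is the direct sum of the [nn t *: M], each a copy of M: coordinates in the basis
    of M reduce this to the freeness of N as a right B-module. *)
Lemma ker_mul_free (M : lmodType B) (X : choiceType) (e : X -> M) s (y : T -> M) :
  is_basis e -> uniq s -> \sum_(t <- s) nn t *: y t = 0 ->
  {in s, forall t, y t = 0}.
Proof.
move=> eB us s0 t ts.
have /choice[l lE] := fun t => basis_list eB (y t).
pose L := [seq (nn t * p.1, p.2) | t <- s, p <- l t].
have L0 : \sum_(p <- L) p.1 *: e p.2 = 0.
  rewrite -[RHS]s0 /L big_allpairs_dep /=; apply: eq_bigr => t' _.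
  by rewrite lE scaler_sumr; apply: eq_bigr => p _; rewrite scalerA.
rewrite lE sum_fst_snd big1 // => x _.
transitivity ((\sum_(p <- l t | p.2 == x) p.1) *: e x).
  by rewrite scaler_suml; apply: eq_bigr => p /eqP ->.
rewrite (nn_free (b := fun t => \sum_(p <- l t | p.2 == x) p.1) us) ?scale0r //.
rewrite -[RHS](basis_coef0 eB L0 x) /L [RHS]big_mkcond [RHS]big_allpairs_dep /=.
apply: eq_bigr => t' _; rewrite mulr_sumr [LHS]big_mkcond /=.
by apply: eq_bigr.
Qed.

End KernelIdeal.

(** * Maps defined on subquotients *)

Lemma subquot_lift (K : fieldType) (V W : lmodType K) (Z D : Defs.subspace V)
    (h : V -> W) :
  (forall c x y, Z x -> Z y -> h (c *: x + y) = c *: h x + h y) ->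
  (forall x, Z x -> D x -> h x = 0) ->
  exists f : {linear subquot Z D -> W}, forall x, Z x -> f (sq_class Z D x) = h x.
Proof.
move=> h_lin hD.
have class_eq x y : Z x -> Z y -> sq_class Z D x = sq_class Z D y -> h x = h y.
  move=> Zx Zy xy.
  have Zd : Z (- 1 *: y + x) by apply: Defs.subspaceP.
  have : sq_class Z D (- 1 *: y + x) = 0.
    by rewrite sq_classP // xy scaleN1r addNr.
  move/(sq_class_eq0 _ Zd)/(hD _ Zd); rewrite h_lin // scaleN1r addrC => /eqP.
  by rewrite subr_eq0 => /eqP.
have reprP u : exists x, Z x /\ u = sq_class Z D x.
  by have [x Zx uE] := sq_class_surj u; exists x.
have [rp rpP] := choice reprP.
pose f u := h (rp u).
have fE x : Z x -> f (sq_class Z D x) = h x.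
  move=> Zx; have [Zr rE] := rpP (sq_class Z D x).
  by apply: class_eq => //; rewrite -rE.
have f_lin : linear f.
  move=> c u v; have [Zu uE] := rpP u; have [Zv vE] := rpP v.
  by rewrite {1}uE {1}vE -sq_classP // fE ?h_lin //; apply: Defs.subspaceP.
pose fL := GRing.isLinear.Build _ _ _ _ f f_lin.
pose g : {linear subquot Z D -> W} := HB.pack f fL.
by exists g.
Qed.

Lemma subquot_map (K : fieldType) (V V' : lmodType K) (Z D : Defs.subspace V)
    (Z' D' : Defs.subspace V') (h : V -> V') :
  (forall c x y, h (c *: x + y) = c *: h x + h y) ->
  (forall x, Z x -> Z' (h x)) -> (forall x, Z x -> D x -> D' (h x)) ->
  exists f : {linear subquot Z D -> subquot Z' D'},
    forall x, Z x -> f (sq_class Z D x) = sq_class Z' D' (h x).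
Proof.
move=> h_lin hZ hD; apply: (subquot_lift (h := fun x => sq_class Z' D' (h x))).
  by move=> c x y Zx Zy; rewrite h_lin sq_classP //; apply: hZ.
by move=> x Zx Dx; apply/sq_class_eq0; [exact: hZ | exact: hD].
Qed.

Section Subspaces.
Variables (K : fieldType) (V : lmodType K) (D : Defs.subspace V).

Lemma sq_class_eq (Z : Defs.subspace V) x y : Z x -> Z y -> D (x - y) ->
  sq_class Z D x = sq_class Z D y.
Proof.
move=> Zx Zy Dxy; apply/eqP; rewrite -subr_eq0 -scaleN1r addrC -sq_classP //.
apply/eqP/sq_class_eq0; first exact: Defs.subspaceP.
by rewrite scaleN1r addrC.
Qed.
End Subspaces.

Lemma tor_boundaryB (K : fieldType) (C : algType K) (gr : nat -> C -> Prop)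
    (F : graded_resolution gr) i (x y : F i) :
  tor_boundary x -> tor_boundary y -> tor_boundary (x - y).
Proof.
move=> [u [v [Iv ->]]] [u' [v' [Iv' ->]]]; exists (u - u'), (v - v').
by split; [exact: aug_mulB | rewrite linearB opprD addrACA].
Qed.

(** * From homotopies to short exact sequences of Tor *)

Section TorLevel.
Variables (K : fieldType) (A B : algType K).
Variables (inc : {lrmorphism A -> B}) (rho : {rmorphism B -> A}).
Variables (grA : nat -> A -> Prop) (grB : nat -> B -> Prop).
Hypothesis rho_alg : forall c, rho c%:A = c%:A.
Hypothesis inc_deg : forall j a, grA j a -> grB j (inc a).
Hypothesis rho_deg : forall j b, grB j b -> grA j (rho b).
Variables (FA : graded_resolution grA) (FB : graded_resolution grB).
Local Notation IA := (positive_part grA).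
Local Notation IB := (positive_part grB).
Let inB : {rmorphism A -> B} := inc.

Let inc_alg (c : K) : inc c%:A = c%:A.
Proof. by rewrite linearZ rmorph1. Qed.

Let incI a : IA a -> IB (inc a).
Proof. exact: (@positive_part_morph _ _ _ _ _ inB). Qed.

Let rhoI b : IB b -> IA (rho b).
Proof. exact: positive_part_morph. Qed.

Variable phi : resolution_lift inc FA FB.
Unset Implicit Arguments.
Variables (beta : forall i, FB i -> FA i).
Variables (gamma : forall i, FB i.+1 -> FA i.+3) (delta : forall i, FA i.+3 -> FB i.+1).
Hypothesis beta_lin : forall i, semilin rho (beta i).
Hypothesis beta_deg : forall i j x, gres_deg j x -> gres_deg j (beta i x).
Hypothesis beta_d : forall i x,
  res_d FA i (beta i.+1 x) = beta i (res_d FB i x).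
Hypothesis gamma_lin : forall i, semilin rho (gamma i).
Hypothesis gamma_deg : forall i j x, gres_deg j x -> gres_deg j.+1 (gamma i x).
Hypothesis gamma_d0 : forall x, aug_mul IA (res_d FA 2 (gamma 0 x)).
Hypothesis gamma_d : forall i x,
  res_d FA i.+3 (gamma i.+1 x) = gamma i (res_d FB i.+1 x).
Hypothesis delta_lin : forall i, semilin inB (delta i).
Hypothesis delta_deg : forall i j x, gres_deg j x ->
  shift_grading (@gres_deg _ _ _ FB i.+1) j (delta i x).
Hypothesis delta_d0 : forall x, aug_mul IB (res_d FB 0 (delta 0 x)).
Hypothesis delta_d : forall i x,
  aug_mul IB (res_d FB i.+1 (delta i.+1 x) - delta i (res_d FA i.+3 x)).
Hypothesis beta_phi : forall i x, aug_mul IA (res_d FA i x) ->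
  exists y z, aug_mul IA z /\ beta i.+1 (phi i.+1 x) - x = res_d FA i.+1 y + z.
Hypothesis gamma_delta : forall i x, aug_mul IA (res_d FA i.+2 x) ->
  exists y z, aug_mul IA z /\ gamma i (delta i x) - x = res_d FA i.+3 y + z.
Hypothesis phi_delta : forall i x, aug_mul IB (res_d FB i x) ->
  exists y z, aug_mul IB z /\
    x = phi i.+1 (beta i.+1 x) + delta i (gamma i x) + res_d FB i.+1 y + z.

Let phi_lin i : semilin inB (phi i).
Proof. by move=> c x y; rewrite linearP. Qed.
Set Implicit Arguments.

Let phi_aug i x : aug_mul IA x -> aug_mul IB (phi i x).
Proof. exact: (semilin_aug_mul (r := inB) incI (phi_lin i)). Qed.
Let beta_aug i x : aug_mul IB x -> aug_mul IA (beta i x).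
Proof. exact: (semilin_aug_mul rhoI (beta_lin i)). Qed.
Let gamma_aug i x : aug_mul IB x -> aug_mul IA (gamma i x).
Proof. exact: (semilin_aug_mul rhoI (gamma_lin i)). Qed.
Let delta_aug i x : aug_mul IA x -> aug_mul IB (delta i x).
Proof. exact: (semilin_aug_mul (r := inB) incI (delta_lin i)). Qed.

Let delta_cycle i x : aug_mul IA (res_d FA i.+2 x) ->
  aug_mul IB (res_d FB i (delta i x)).
Proof.
case: i x => [|i] x dx; first exact: delta_d0.
rewrite -[res_d _ _ _](subrK (delta i (res_d FA i.+3 x))).
by apply: aug_mulD; [exact: delta_d | exact: delta_aug].
Qed.

Let gamma_cycle i x : aug_mul IB (res_d FB i x) ->
  aug_mul IA (res_d FA i.+2 (gamma i x)).
Proof. by case: i x => [|i] x dx //; rewrite gamma_d; apply: gamma_aug. Qed.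

(** On homology [phi] and [gamma] give the sequence, [beta] is a left inverse of the former and
    [delta] a right inverse of the latter. Exactness in the middle is [phi beta + delta gamma = 1]
    together with [gamma phi = 0]. *)
Lemma tor_short_exact i j : exists (f : {linear Tor FA i.+1 j -> Tor FB i.+1 j})
    (g : {linear Tor FB i.+1 j -> Tor FA i.+3 j.+1}),
  tor_induced phi f /\ short_exact f g.
Proof.
have [|||f fE] := @subquot_map K (Defs.restrict (FA i.+1)) (Defs.restrict (FB i.+1))
    (tor_cycles FA i.+1 j) (tor_boundaries FA i.+1)
    (tor_cycles FB i.+1 j) (tor_boundaries FB i.+1) (phi i.+1).
- by move=> c x y; have := phi_lin i.+1 c%:A x y; rewrite /inB /= inc_alg.
- move=> x [jx /= dx]; split; first exact: rlift_deg.
  by rewrite /= rlift_d; apply: phi_aug.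
- move=> x _ [y [z [Iz ->]]]; exists (phi i.+2 y), (phi i.+1 z).
  by split; [exact: phi_aug | rewrite (semilinD (phi_lin i.+1)) rlift_d].
have [|||g gE] := @subquot_map K (Defs.restrict (FB i.+1)) (Defs.restrict (FA i.+3))
    (tor_cycles FB i.+1 j) (tor_boundaries FB i.+1)
    (tor_cycles FA i.+3 j.+1) (tor_boundaries FA i.+3) (gamma i).
- by move=> c x y; have := gamma_lin i c%:A x y; rewrite rho_alg.
- move=> x [jx /= dx]; split; first exact: gamma_deg.
  exact: gamma_cycle.
- move=> x _ [y [z [Iz ->]]]; exists (gamma i.+1 y), (gamma i z).
  by split; [exact: gamma_aug | rewrite (semilinD (gamma_lin i)) gamma_d].
exists f, g; split=> //.
have delta_bound x : tor_boundary x -> tor_boundary (delta i x).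
  move=> [y [z [Iz ->]]].
  exists (delta i.+1 y), (delta i z - (res_d FB i.+1 (delta i.+1 y) -
    delta i (res_d FA i.+3 y))); split.
    by apply: aug_mulB; [exact: delta_aug | exact: delta_d].
  rewrite (semilinD (delta_lin i)) [delta i z - _]addrC opprB addrA.
  by rewrite [X in _ = X + _]addrC subrK.
have gamma_bound x : tor_boundary x -> tor_boundary (gamma i x).
  move=> [y [z [Iz ->]]]; exists (gamma i.+1 y), (gamma i z).
  by split; [exact: gamma_aug | rewrite (semilinD (gamma_lin i)) gamma_d].
have phi_bound x : tor_boundary x -> tor_boundary (phi i.+1 x).
  move=> [y [z [Iz ->]]]; exists (phi i.+2 y), (phi i.+1 z).
  by split; [exact: phi_aug | rewrite (semilinD (phi_lin i.+1)) rlift_d].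
have beta_bound x : tor_boundary x -> tor_boundary (beta i.+1 x).
  move=> [y [z [Iz ->]]]; exists (beta i.+2 y), (beta i.+1 z).
  by split; [exact: beta_aug | rewrite (semilinD (beta_lin i.+1)) beta_d].
(* Composing [phi beta + delta gamma = 1] with [phi] and using [beta phi = 1] gives
   [delta gamma phi = 0]; applying [gamma] and using [gamma delta = 1] gives [gamma phi = 0]. *)
have phi_gamma x : aug_mul IA (res_d FA i x) -> tor_boundary (gamma i (phi i.+1 x)).
  move=> dx; have dpx : aug_mul IB (res_d FB i (phi i.+1 x)).
    by rewrite rlift_d; apply: phi_aug.
  have [y [z [Iz yE]]] := beta_phi i x dx.
  have [y' [z' [Iz' y'E]]] := phi_delta i _ dpx.
  have b1 : tor_boundary (phi i.+1 (beta i.+1 (phi i.+1 x) - x)).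
    by apply: phi_bound; exists y, z.
  have b2 : tor_boundary (delta i (gamma i (phi i.+1 x))).
    have -> : delta i (gamma i (phi i.+1 x)) =
        (- res_d FB i.+1 y' - z') - phi i.+1 (beta i.+1 (phi i.+1 x) - x).
      have E (a c p q : FB i.+1) : c = (- p - q) - (a - (a + c + p + q)).
        rewrite opprB -opprD addrC addrAC -[a + c + p + q]addrA addrK.
        by rewrite addrC addKr.
      by rewrite (semilinB (phi_lin i.+1)) [X in _ - (_ - X)]y'E -E.
    apply: tor_boundaryB => //; exists (- y'), (- z').
    by rewrite linearN; split=> //; apply: aug_mulN.
  have [y'' [z'' [Iz'' y''E]]] := gamma_delta i _ (gamma_cycle dpx).
  have -> : gamma i (phi i.+1 x) =
     gamma i (delta i (gamma i (phi i.+1 x))) - (res_d FA i.+3 y'' + z'').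
    by rewrite -y''E opprB addrC subrK.
  by apply: tor_boundaryB; [exact: gamma_bound | exists y'', z''].
split.
- have f0 u : f u = 0 -> u = 0.
    have [x [jx /= dx] ->] := sq_class_surj u; rewrite fE; last by split.
    move/sq_class_eq0 => /(_ _)[|y [z [Iz pE]]].
      split; first exact: rlift_deg.
      by rewrite /= rlift_d; apply: phi_aug.
    apply/sq_class_eq0; first by split.
    have [y' [z' [Iz' y'E]]] := beta_phi i x dx.
    rewrite (_ : x = beta i.+1 (phi i.+1 x) - (res_d FA i.+1 y' + z')).
      by apply: tor_boundaryB; [apply: beta_bound; exists y, z | exists y', z'].
    by rewrite -y'E opprB addrC subrK.
  move=> u v uv; apply/eqP; rewrite -subr_eq0; apply/eqP/f0.
  by rewrite linearB /= uv subrr.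
- move=> v; split.
    have [x [jx /= dx] ->] := sq_class_surj v; rewrite gE; last by split.
    move/sq_class_eq0 => /(_ _)[|y [z [Iz pE]]].
      by split; [exact: gamma_deg | exact: gamma_cycle].
    have Zb : tor_cycles FA i.+1 j (beta i.+1 x).
      by split; [exact: beta_deg | rewrite /= beta_d; apply: beta_aug].
    exists (tor_class j (beta i.+1 x)); rewrite fE //; apply/esym/sq_class_eq.
    - by split.
    - split; first by apply/rlift_deg/beta_deg.
      by rewrite /= rlift_d beta_d; apply/phi_aug/beta_aug.
    have [y' [z' [Iz' y'E]]] := phi_delta i x dx.
    have -> : x - phi i.+1 (beta i.+1 x) =
        delta i (gamma i x) - (res_d FB i.+1 (- y') - z').
      rewrite [X in X - _]y'E linearN -opprD opprK -[_ + _ + z']addrA addrAC.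
      by rewrite [phi _ _ + _]addrC addrK.
    apply: tor_boundaryB; first by apply: delta_bound; exists y, z.
    by exists (- y'), (- z'); split=> //; apply: aug_mulN.
  move=> [u <-]; have [x [jx /= dx] ->] := sq_class_surj u.
  rewrite fE; last by split.
  have Zp : tor_cycles FB i.+1 j (phi i.+1 x).
    by split; [exact: rlift_deg | rewrite /= rlift_d; apply: phi_aug].
  rewrite gE //; apply/sq_class_eq0; last exact: phi_gamma.
  by case: Zp => jp dp; split; [exact: gamma_deg | exact: gamma_cycle].
move=> w; have [t [jt /= dt] ->] := sq_class_surj w.
have Zd : tor_cycles FB i.+1 j (delta i t).
  by split; [exact: (delta_deg _ _ _ jt) | exact: delta_cycle].
exists (tor_class j (delta i t)); rewrite gE //; apply: sq_class_eq.
- by case: Zd => jd dd; split; [exact: gamma_deg | exact: gamma_cycle].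
- by split.
by have [y [z [Iz yE]]] := gamma_delta i t dt; exists y, z.
Qed.

(** [delta] lowers the internal degree by one and so kills degree 0, while [gamma delta] is the
    identity on homology. *)
Lemma tor_degree0 i (u : Tor FA i.+3 0) : u = 0.
Proof.
have [x [jx /= dx] ->] := sq_class_surj u; apply/sq_class_eq0; first by split.
have [y [z [Iz yE]]] := gamma_delta i x dx.
exists (- y), (- z); rewrite linearN -opprD -yE; split; first exact: aug_mulN.
by rewrite (delta_deg _ _ _ jx : _ = 0) (semilin0 (gamma_lin i)) sub0r opprK.
Qed.

End TorLevel.

Section ResolutionFacts.
Variables (K : fieldType) (C : algType K) (gr : nat -> C -> Prop).
Variable (eC : C -> K).
Hypothesis eC_pos : forall c, positive_part gr (c - (eC c)%:A).
Variable F : graded_resolution gr.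

Lemma res_eps_linear : eps_linear eC (@res_eps _ _ _ F).
Proof.
move=> c x y; have [eL eI] := res_eps_hom F.
have eL' a u v : res_eps (a%:A *: u + v) = a * res_eps u + res_eps v := eL a u v.
have -> : c *: x + y = (eC c)%:A *: x + ((c - (eC c)%:A) *: x + y).
  by rewrite addrA -scalerDl [_%:A + _]addrC subrK.
rewrite eL'; have := eL' 1 ((c - (eC c)%:A) *: x) y.
by rewrite !scale1r mul1r => ->; rewrite (eI _ _ (eC_pos c)) add0r.
Qed.

Lemma res_dd i x : res_d F i (res_d F i.+1 x) = 0.
Proof. by apply/(res_exact (r := F)); exists x. Qed.

Lemma res_eps_d x : res_eps (res_d F 0 x) = 0.
Proof. by apply/res_exact0; exists x. Qed.

Lemma res_unit : eC 1 = 1 -> exists2 u : F 0, gres_deg 0 u & res_eps u = 1.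
Proof.
move=> e1; have eL := res_eps_linear.
have e0 := eps_linear0 e1 eL.
have eD (x y : F 0) : res_eps (x + y) = res_eps x + res_eps y.
  by have := eL 1 x y; rewrite scale1r e1 mul1r.
have [x x1] := res_eps_surj F 1.
have [N [f [N0 fgr xE]]] := grmod_span_ge (gres_graded F 0) 1 x.
exists (f 0%N) => //; case: N N0 xE => // N _.
rewrite big_ord_recl => xE; rewrite -x1 xE eD.
rewrite (big_morph _ eD e0) big1 ?addr0 // => i _.
exact: (gres_eps (fgr _)).
Qed.

End ResolutionFacts.

(** * Chain maps and homotopies between FA and FB *)

Section Homological.
Variables (K : fieldType) (A B : algType K).
Variables (inc : {lrmorphism A -> B}) (rho : {rmorphism B -> A}).
Variables (grA : nat -> A -> Prop) (grB : nat -> B -> Prop).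
Hypothesis rhoK : forall a, rho (inc a) = a.
Hypothesis inc_deg : forall j a, grA j a -> grB j (inc a).
Hypothesis rho_deg : forall j b, grB j b -> grA j (rho b).
Hypothesis Agr : is_graded_module grA (grA : nat -> A^o -> Prop).
Hypothesis grA_1 : grA 0%N 1.
Hypothesis grA_span : forall a, exists N (f : nat -> A),
  (forall j, grA j (f j)) /\ a = \sum_(j < N) f j.
Hypothesis grBD : forall j b b', grB j b -> grB j b' -> grB j (b + b').
Hypothesis grB_span : forall b, exists N (f : nat -> B),
  (forall j, grB j (f j)) /\ b = \sum_(j < N) f j.
Variables (epsA : A -> K) (epsB : B -> K).
Hypothesis eps_inc : forall a, epsB (inc a) = epsA a.
Hypothesis eps_rho : forall b, epsA (rho b) = epsB b.
Hypothesis epsA_alg : forall c, epsA c%:A = c.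
Hypothesis epsB_alg : forall c, epsB c%:A = c.
Hypothesis epsA_pos : forall a, positive_part grA (a - (epsA a)%:A).
Hypothesis epsB_pos : forall b, positive_part grB (b - (epsB b)%:A).
Hypothesis epsA_lin : forall c a b, epsA (c *: a + b) = c * epsA a + epsA b.
Hypothesis epsA_mul : forall a b, epsA (a * b) = epsA a * epsA b.
Hypothesis epsA_aug : forall a, positive_part grA a -> epsA a = 0.
Variables (FA : graded_resolution grA) (FB : graded_resolution grB).

(* The minimal complex A^q -> A^p -> A that begins a resolution of K. *)
Variable kk : nat -> nat.
Local Notation KK i := {ffun 'I_(kk i) -> A^o}.
Variable dK : forall i, {linear KK i.+1 -> KK i}.
Definition degK i : nat -> KK i -> Prop :=
  pointwise_grading (shift_by (grA : nat -> A^o -> Prop) i).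
Hypothesis dK_deg : forall i j x, degK j x -> degK j (dK i x).
Hypothesis dKK : forall i x, dK i (dK i.+1 x) = 0.
Variable epsK : KK 0 -> K.
Hypothesis epsK_lin : eps_linear epsA (M := KK 0) epsK.
Hypothesis epsK_deg : forall j x, degK j.+1 x -> epsK x = 0.
Variable uK : KK 0.
Hypothesis uK_deg : degK 0 uK.
Hypothesis epsK_u : epsK uK = 1.
Hypothesis K_exact0 : forall x, epsK x = 0 <-> exists y, dK 0 y = x.
Hypothesis K_exact1 : forall x, dK 0 x = 0 -> exists y, dK 1 y = x.
Hypothesis K_min0 : forall x, epsK x = 0 -> forall a, epsA (x a) = 0.
Hypothesis K_min1 : forall x, dK 0 x = 0 -> forall a, epsA (x a) = 0.
Hypothesis K_min2 : forall x, dK 1 x = 0 -> forall a, epsA (x a) = 0.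

(** On N the product rule reads sigma (n b) = eps (b) sigma (n), so [sigma] factors through N / N
    B_+. The hypotheses below make this quotient isomorphic to S = Ker (dK 1), with the [nn t]
    giving a basis. *)
Variable sigma : B -> KK 2.
Hypothesis sigmaD : forall b b', sigma (b + b') = sigma b + sigma b'.
Hypothesis sigmaM : forall b b',
  sigma (b * b') = rho b *: sigma b' + (epsB b')%:A *: sigma b.
Hypothesis sigma_inc : forall a, sigma (inc a) = 0.
Hypothesis sigma_deg : forall j b, grB j b -> degK j.+1 (sigma b).
Hypothesis sigma_d : forall b, dK 1 (sigma b) = 0.
Hypothesis sigma_onto : forall j t, degK j.+1 t -> dK 1 t = 0 ->
  exists2 b, grB j b & sigma b = t.

Variables (T : choiceType) (nn : T -> B).
Hypothesis nn0 : forall t, rho (nn t) = 0.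
Hypothesis nn_span : forall b, rho b = 0 ->
  exists l : seq (B * T), b = \sum_(p <- l) nn p.2 * p.1.
Hypothesis nn_free : forall (s : seq T) (b : T -> B), uniq s ->
  \sum_(t <- s) nn t * b t = 0 -> {in s, forall t, b t = 0}.
Hypothesis nn_indep : forall (s : seq T) (c : T -> K), uniq s ->
  \sum_(t <- s) (c t)%:A *: sigma (nn t) = 0 -> {in s, forall t, c t = 0}.

Let inB : {rmorphism A -> B} := inc.
Let piB : {rmorphism B -> B} := inB \o rho.

Let epsA1 : epsA 1 = 1. Proof. by rewrite -[X in epsA X]scale1r epsA_alg. Qed.
Let epsB1 : epsB 1 = 1. Proof. by rewrite -[X in epsB X]scale1r epsB_alg. Qed.

Let FAgr := gres_graded FA.
Let FBgr := gres_graded FB.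
Let FAfree := gres_free FA.
Let FBfree := gres_free FB.
Let epsFA := res_eps_linear epsA_pos (F := FA).
Let epsFB := res_eps_linear epsB_pos (F := FB).
Let dFA := @gres_d _ _ _ FA.
Let dFB := @gres_d _ _ _ FB.

Lemma degK_graded i : is_graded_module grA (@degK i).
Proof. exact/pointwise_graded/shift_by_graded. Qed.

Lemma rho_alg c : rho c%:A = c%:A.
Proof. by rewrite -[RHS]rhoK linearZ rmorph1. Qed.

Lemma degK_delta i a : degK i (free_delta A a : KK i).
Proof.
move=> b; rewrite ffunE.
have : forall x : A^o, grA 0%N x -> shift_by (grA : nat -> A^o -> Prop) i i x.
  by elim: i {a b} => // i IH x /IH.
by apply; case: (a == b) => //; apply: (grmod0 Agr).
Qed.

Lemma KK_basis i : exists (X : choiceType) (e : X -> KK i),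
  is_basis e /\ forall a, exists j, degK j (e a).
Proof.
exists 'I_(kk i), (@free_delta K A _); split=> [|a]; first exact: free_delta_basis.
by exists i; apply: degK_delta.
Qed.

(* E_i: on FB / N FB the homology vanishes in degrees at least 2, and in
   degree 1 it is detected by the map [st] below. *)
Lemma ker_exact i (z : FB i.+2) : ker_mul rho (res_d FB i.+1 z) ->
  exists y, ker_mul rho (res_d FB i.+2 y - z).
Proof.
move/(ker_mul_span nn_span) => [s [y [us zE]]].
have [X [e [eB _]]] := FBfree i.
(* Uniqueness of the coefficients in N FB turns d d z = 0 into the vanishing of d on each
   coefficient. *)
have y0 : {in s, forall t, res_d FB i (y t) = 0}.
  apply: (ker_mul_free nn_free eB us).
  rewrite -[RHS](res_dd z) zE linear_sum.
  by apply: eq_bigr => t _; rewrite linearZ.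
have : forall t, exists w, t \in s -> res_d FB i.+1 w = y t.
  move=> t; case ts: (t \in s); last by exists 0.
  by have /(res_exact (r := FB))[w wE] := y0 t ts; exists w.
move/choice => [w wE].
(* The coefficients of d z are boundaries [d (w t)], so z becomes a cycle of FB after an element of
   N FB is subtracted. *)
have : res_d FB i.+1 (z - \sum_(t <- s) nn t *: w t) = 0.
  rewrite linearB linear_sum zE big_seq [X in _ - X]big_seq -sumrB big1 // => t ts.
  by rewrite linearZ /= wE // subrr.
move/(res_exact (r := FB)) => [v vE]; exists v.
rewrite vE addrAC subrr add0r; apply: ker_mulN.
by apply: ker_mul_sum => t; apply: ker_mulI.
Qed.

Section Derivation.
Variable st : FB 0 -> KK 2.
Hypothesis stD : forall x y, st (x + y) = st x + st y.
Hypothesis stM : forall b y,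
  st (b *: y) = rho b *: st y + (res_eps y)%:A *: sigma b.

Lemma st_sum I (s : seq I) (F : I -> FB 0) :
  st (\sum_(i <- s) F i) = \sum_(i <- s) st (F i).
Proof.
apply: (big_morph st stD); apply: (@addrI _ (st 0)).
by rewrite -stD !addr0.
Qed.

(** In degree 0 of FB a coefficient is a boundary only if its augmentation vanishes. Since
    [rho (nn t)] is 0, [st (d z)] is the sum of the [sigma (nn t)] weighted by these augmentations,
    and [nn_indep] applies. *)
Lemma ker_exact1 (z : FB 1) : ker_mul rho (res_d FB 0 z) ->
  st (res_d FB 0 z) = 0 -> exists y, ker_mul rho (res_d FB 1 y - z).
Proof.
move/(ker_mul_span nn_span) => [s [y [us zE]]] st0.
have y0 : {in s, forall t, res_eps (y t) = 0}.
  apply: (nn_indep us); rewrite -[RHS]st0 zE st_sum.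
  by apply: eq_bigr => t _; rewrite stM nn0 scale0r add0r.
have : forall t, exists w, t \in s -> res_d FB 0 w = y t.
  move=> t; case ts: (t \in s); last by exists 0.
  by have /res_exact0[w wE] := y0 t ts; exists w.
move/choice => [w wE].
have : res_d FB 0 (z - \sum_(t <- s) nn t *: w t) = 0.
  rewrite linearB linear_sum zE big_seq [X in _ - X]big_seq -sumrB big1 // => t ts.
  by rewrite linearZ /= wE // subrr.
move/(res_exact (r := FB)) => [v vE]; exists v.
rewrite vE addrAC subrr add0r; apply: ker_mulN.
by apply: ker_mul_sum => t; apply: ker_mulI.
Qed.

(** The derivation term of [st] carries [res_eps], which vanishes on boundaries. *)
Lemma st_d_lin : semilin rho (fun x : FB 1 => st (res_d FB 0 x)).
Proof.
by move=> c x y; rewrite linearP stD stM res_eps_d !scale0r addr0.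
Qed.

End Derivation.

(** [sigma] is transported to FB 0 along a basis, weighted by the augmentations of the basis
    elements. As sigma 1 = 0, the result vanishes on that basis, a normalisation that starts the
    homotopy of [phi_delta_homotopy]. *)
Lemma exists_st (X : choiceType) (e : X -> FB 0) : is_basis e ->
  (forall x, exists j, gres_deg j (e x)) ->
  exists st : FB 0 -> KK 2, [/\ forall x y, st (x + y) = st x + st y,
    forall b y, st (b *: y) = rho b *: st y + (res_eps y)%:A *: sigma b,
    forall x, st (e x) = 0, forall y, dK 1 (st y) = 0
    & forall j y, gres_deg j y -> degK j.+1 (st y)].
Proof.
move=> eB e_deg; have [dg dgP] := choice e_deg.
have [|st stE] := free_extend eB
    (v := fun x c => (res_eps (e x))%:A *: sigma c : KK 2).
  by move=> x c c'; rewrite sigmaD scalerDr.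
have stD x y : st (x + y) = st x + st y.
  have [lx ->] := basis_list eB x; have [ly ->] := basis_list eB y.
  by rewrite -big_cat !stE big_cat.
exists st; split=> //.
- move=> b y; have [l ->] := basis_list eB y.
  rewrite scaler_sumr.
  have -> : \sum_(p <- l) b *: (p.1 *: e p.2) =
      \sum_(p <- [seq (b * p.1, p.2) | p <- l]) p.1 *: e p.2.
    by rewrite big_map; apply: eq_bigr => p _; rewrite scalerA.
  rewrite !stE big_map /= scaler_sumr.
  have -> : res_eps (\sum_(p <- l) p.1 *: e p.2) =
      \sum_(p <- l) epsB p.1 * res_eps (e p.2).
    elim: l => [|p l IH]; first by rewrite !big_nil (eps_linear0 epsB1 epsFB).
    by rewrite !big_cons epsFB IH.
  rewrite scaler_suml scaler_suml -big_split; apply: eq_bigr => p _ /=.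
  rewrite sigmaM scalerDr !scalerA; congr (_ *: _ + _ *: _).
    by rewrite -scalerAl mul1r -scalerAr mulr1.
  by rewrite -scalerAl mul1r scalerA mulrC.
- move=> x; have := stE [:: (1, x)]; rewrite !big_seq1 scale1r => ->.
  by rewrite -(rmorph1 inc) sigma_inc scaler0.
- move=> y; have [l ->] := basis_list eB y; rewrite stE linear_sum big1 // => p _.
  by rewrite linearZ /= sigma_d scaler0.
move=> j y jy.
have [l [-> lgr ldg]] := homog_expand grB_span (FBgr 0) eB dgP jy.
have -> : \sum_(p <- l) p.2.1 *: e p.2.2 =
    \sum_(p <- map snd l) p.1 *: e p.2 by rewrite big_map.
rewrite stE big_map big_seq; apply: (homog_sum (degK_graded 2)) => p pl.
have := ldg p pl; case dx : (dg p.2.2) (dgP p.2.2) => [|d] ed.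
  rewrite addn0 => <-.
  have := grmodP (degK_graded 2) (res_eps (e p.2.2)) (sigma_deg (lgr p pl))
    (grmod0 (degK_graded 2) _).
  by rewrite addr0.
by move=> _; rewrite (gres_eps ed) scale0r scale0r; apply: (grmod0 (degK_graded 2)).
Qed.

Lemma exists_phi : exists phi : forall i, FA i -> FB i,
  [/\ forall i, semilin inB (phi i),
      forall i j x, gres_deg j x -> gres_deg j (phi i x),
      forall x, res_eps (phi 0 x) = res_eps x
    & forall i x, res_d FB i (phi i.+1 x) = phi i (res_d FA i x)].
Proof.
have [u u0 u1] := res_unit epsB_pos FB epsB1.
have [|||h [h_lin h_deg h_eps h_d]] := comparison inc_deg grA_span FAgr dFA
    (@res_dd _ _ _ FA) FAfree FBgr dFB (g := xpredT) _ _ eps_inc epsB_alg epsFA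
    epsFB (@gres_eps _ _ _ FA) u0 u1 (@res_eps_d _ _ _ FA) _ => //.
- by move=> i x _ /(res_exact (r := FB)).
- by move=> x /res_exact0.
by exists h; split=> // i x; apply: h_d.
Qed.

Lemma exists_beta : exists beta : forall i, FB i -> FA i,
  [/\ forall i, semilin rho (beta i),
      forall i j x, gres_deg j x -> gres_deg j (beta i x),
      forall x, res_eps (beta 0 x) = res_eps x
    & forall i x, res_d FA i (beta i.+1 x) = beta i (res_d FB i x)].
Proof.
have [u u0 u1] := res_unit epsA_pos FA epsA1.
have [|||h [h_lin h_deg h_eps h_d]] := comparison rho_deg grB_span FBgr dFB
    (@res_dd _ _ _ FB) FBfree FAgr dFA (g := xpredT) _ _ eps_rho epsA_alg epsFB
    epsFA (@gres_eps _ _ _ FB) u0 u1 (@res_eps_d _ _ _ FB) _ => //.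
- by move=> i x _ /(res_exact (r := FA)).
- by move=> x /res_exact0.
by exists h; split=> // i x; apply: h_d.
Qed.

Let epsK_d x : epsK (dK 0 x) = 0.
Proof. by apply/K_exact0; exists x. Qed.

Lemma exists_theta : exists theta : forall i, KK i -> FA i,
  [/\ forall i, semilin idfun (theta i : KK i -> FA i),
      forall i j x, degK j x -> gres_deg j (theta i x),
      forall x, res_eps (theta 0 x) = epsK x
    & forall i x, res_d FA i (theta i.+1 x) = theta i (dK i x)].
Proof.
have [u u0 u1] := res_unit epsA_pos FA epsA1.
have [||h [h_lin h_deg h_eps h_d]] := @comparison K A A grA grA idfun (fun _ _ h => h)
    grA_span (fun i => KK i) dK degK degK_graded dK_deg dKK KK_basis
    FA (res_d FA) (@gres_deg _ _ _ FA) FAgr dFA xpredT (fun _ _ => isT) _ epsA epsA epsK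
    (@res_eps _ _ _ FA) u (fun=> erefl) epsA_alg
    epsK_lin epsFA epsK_deg u0 u1 epsK_d _ => //.
- by move=> i x _ /(res_exact (r := FA)).
- by move=> x /res_exact0.
by exists h; split=> // i x; apply: h_d.
Qed.

(** The minimal complex is exact only at its first places, so commutation with the differentials
    stops at [i < 2]; the components [psi 0], [psi 1] and [psi 2] are thereby controlled. *)
Lemma exists_psi : exists psi : forall i, FA i -> KK i,
  [/\ forall i, semilin idfun (psi i : FA i -> KK i),
      forall i j x, gres_deg j x -> degK j (psi i x),
      forall x, epsK (psi 0 x) = res_eps x
    & forall i x, (i < 2)%N -> dK i (psi i.+1 x) = psi i (res_d FA i x)].
Proof.
have [|||h [h_lin h_deg h_eps h_d]] := @comparison K A A grA grA idfun (fun _ _ h => h)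
    grA_span FA (res_d FA) (@gres_deg _ _ _ FA) FAgr dFA (@res_dd _ _ _ FA) FAfree
    (fun i => KK i) dK degK degK_graded dK_deg (fun i => i < 2)%N _ _ epsA epsA
    (@res_eps _ _ _ FA) epsK uK (fun=> erefl) epsA_alg
    epsFA epsK_lin (@gres_eps _ _ _ FA) uK_deg epsK_u (@res_eps_d _ _ _ FA) _ => //.
- by move=> i i2; apply: ltn_trans i2.
- by case=> // x _; apply: K_exact1.
- by move=> x /K_exact0.
by exists h; split=> // i x; apply: h_d.
Qed.

Lemma degree0_eq0 (a : A) : grA 0%N a -> epsA a = 0 -> a = 0.
Proof.
move=> a0 ea; have := epsA_pos a; rewrite ea scale0r subr0 => -[N [f [fgr aE]]].
pose g j := if j is i.+1 then - f i else a.
apply: (grmod_direct Agr (N := N.+1) (f := g : nat -> A^o) _ _ (j := 0%N)) => //.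
  by case=> [//|j] /=; apply: (homogN Agr).
by rewrite big_ord_recl /= sumrN -aE subrr.
Qed.

Lemma KK_degree_eq0 i (x : KK i) : degK i x -> (forall a, epsA (x a) = 0) -> x = 0.
Proof.
move=> ix ex; apply/ffunP => a; rewrite ffunE; apply: degree0_eq0 (ex a).
have : forall y : A^o, shift_by (grA : nat -> A^o -> Prop) i i y -> grA 0%N y.
  by elim: i {x ix ex a} => // i IH x /IH.
by apply; apply: ix.
Qed.

Lemma KK_aug i (x : KK i) : (forall a, epsA (x a) = 0) ->
  aug_mul (positive_part grA) x.
Proof.
move=> x0; apply: aug_mul_free => a.
by have := epsA_pos (x a); rewrite x0 scale0r subr0.
Qed.

Section Maps.
Unset Implicit Arguments.
Variables (theta : forall i, KK i -> FA i) (psi : forall i, FA i -> KK i).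
Hypothesis theta_lin : forall i, semilin idfun (theta i : KK i -> FA i).
Hypothesis theta_deg : forall i j x, degK j x -> gres_deg j (theta i x).
Hypothesis theta_eps : forall x, res_eps (theta 0 x) = epsK x.
Hypothesis theta_d : forall i x,
  res_d FA i (theta i.+1 x) = theta i (dK i x).
Hypothesis psi_lin : forall i, semilin idfun (psi i : FA i -> KK i).
Hypothesis psi_deg : forall i j x, gres_deg j x -> degK j (psi i x).
Hypothesis psi_eps : forall x, epsK (psi 0 x) = res_eps x.
Hypothesis psi_d : forall i x, (i < 2)%N ->
  dK i (psi i.+1 x) = psi i (res_d FA i x).
Set Implicit Arguments.

(** Minimality upgrades a homotopy to an equality. On a basis element the difference is by induction
    a cycle, so its coefficients lie in the augmentation ideal; being homogeneous of the degree of
    the generators, it has coefficients of degree 0 and vanishes. *)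
Lemma psi_theta i x : (i < 3)%N -> psi i (theta i x) = x.
Proof.
move=> i3.
suff H : forall a : 'I_(kk i), psi i (theta i (free_delta A a)) = free_delta A a.
  rewrite [in LHS](free_deltaE x) (semilin_sum (theta_lin i)).
  rewrite (semilin_sum (psi_lin i)) [RHS]free_deltaE; apply: eq_bigr => a _.
  by rewrite (semilinZ (theta_lin i)) (semilinZ (psi_lin i)) H.
have E (a : 'I_(kk i)) : degK i (psi i (theta i (free_delta A a)) - free_delta A a).
  by apply: (homogB (degK_graded i)); [apply/psi_deg/theta_deg|]; apply: degK_delta.
move=> a; apply/eqP; rewrite -subr_eq0; apply/eqP; apply: KK_degree_eq0 => // {x}.
have eB x y : epsK (x - y) = epsK x - epsK y.
  have := epsK_lin (-1) y x; rewrite scaleN1r addrC => ->.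
  by rewrite -(rmorph1 rho) -rmorphN eps_rho -scaleN1r epsB_alg mulN1r addrC.
have main i' : (i' < 3)%N -> forall a : 'I_(kk i'),
    forall b, epsA ((psi i' (theta i' (free_delta A a)) - free_delta A a) b) = 0.
  elim: i' {i i3 a E} => [|i IH] i3 a.
    by apply: K_min0; rewrite eB psi_eps theta_eps subrr.
  have d0 : dK i (psi i.+1 (theta i.+1 (free_delta A a)) - free_delta A a) = 0.
    rewrite linearB psi_d // theta_d.
    have {IH} H (c : 'I_(kk i)) : psi i (theta i (free_delta A c)) = free_delta A c.
      apply/eqP; rewrite -subr_eq0; apply/eqP; apply: KK_degree_eq0.
        by apply: (homogB (degK_graded i)); [apply/psi_deg/theta_deg|]; apply: degK_delta.
      by apply: IH; apply: ltnW.
    rewrite [X in theta i X]free_deltaE (semilin_sum (theta_lin i)).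
    rewrite (semilin_sum (psi_lin i)) [X in _ - X]free_deltaE -sumrB big1 // => c _.
    by rewrite (semilinZ (theta_lin i)) (semilinZ (psi_lin i)) H subrr.
  by case: i a i3 d0 {IH} => [|[|//]] a _; [apply: K_min1 | apply: K_min2].
exact: main.
Qed.

Lemma theta_psi_homotopy : exists h : forall i, FA i -> FA i.+1,
  [/\ forall i, semilin idfun (h i : FA i -> FA i.+1),
      forall i j x, gres_deg j x -> gres_deg j (h i x)
    & forall i x, (i < 2)%N -> res_d FA i.+1 (h i.+1 x) =
        (-1) ^+ i.+1 *: (theta i.+1 (psi i.+1 x) - x) + h i (res_d FA i x)].
Proof.
have [|||||h [h_lin h_deg _ hE]] := @contraction K A A grA grA idfun
    (fun _ _ h => h) grA_span FA (res_d FA) (@gres_deg _ _ _ FA) FAgr dFA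
    (@res_dd _ _ _ FA) FAfree FA (res_d FA) (@gres_deg _ _ _ FA) FAgr dFA
    (fun i => i < 2)%N (fun i => @ltn_trans i.+1 i 2 (ltnSn i))
    (fun i x => theta i (psi i x) - x).
- by move=> i x _ /(res_exact (r := FA)).
- move=> i c x y; rewrite psi_lin theta_lin scalerBr opprD.
  by rewrite [LHS]addrACA.
- move=> i j x jx; apply: (homogB (FAgr i)) => //.
  exact/theta_deg/psi_deg.
- move=> x; apply/res_exact0; rewrite addrC -scaleN1r epsFA theta_eps psi_eps.
  by rewrite -(rmorph1 rho) -rmorphN eps_rho -scaleN1r epsB_alg mulN1r addNr.
- by move=> i x i2; rewrite linearB theta_d psi_d.
by exists h; split=> // i x i2; apply: hE.
Qed.

Let epsA0 : epsA 0 = 0.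
Proof. by rewrite -[X in epsA X](scale0r 1) epsA_alg. Qed.

Let epsAD a b : epsA (a + b) = epsA a + epsA b.
Proof. by have := epsA_lin 1 a b; rewrite scale1r mul1r. Qed.

Let KK_aug_eps i (x : KK i) : aug_mul (positive_part grA) x ->
  forall a, epsA (x a) = 0.
Proof.
move=> [s [sI ->]] a; elim: s sI => [|p s IH] sI.
  by rewrite big_nil ffunE epsA0.
rewrite big_cons !ffunE epsAD IH ?addr0; last first.
  by move=> q qs; apply: sI; rewrite inE qs orbT.
rewrite (_ : epsA _ = epsA p.1 * epsA (p.2 a)); last exact: epsA_mul.
rewrite epsA_aug ?mul0r //.
by apply: sI; rewrite mem_head.
Qed.

Let eps_shift i j (y : A^o) : (i < j)%N ->
  shift_by (grA : nat -> A^o -> Prop) i j y -> epsA y = 0.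
Proof.
elim: i j => [|i IH] [|j] //=; last exact: IH.
move=> _ jy; apply: epsA_aug; exists j.+1, (fun k => if k == j then y else 0).
split; first by move=> k; case: eqP => [->//|_]; apply: (grmod0 Agr).
rewrite (bigD1 ord_max) //= eqxx big1 ?addr0 // => k /negPf.
by rewrite -val_eqE /= => ->.
Qed.

(** [psi] followed by the augmentation embeds Tor into a space of dimension [kk i.+1]: minimality
    kills boundaries, and the homotopy from [theta psi] to the identity gives injectivity. *)
Lemma tor_small i : (i < 2)%N -> graded_fin_dim (Tor FA i.+1).
Proof.
move=> i2; have [h [h_lin _ hE]] := theta_psi_homotopy.
have kmin (x : KK i.+1) : dK i x = 0 -> forall a, epsA (x a) = 0.
  by case: i i2 x {h h_lin hE} => [|[|//]] _ x; [exact: K_min1 | exact: K_min2].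
pose E (x : FA i.+1) : {ffun 'I_(kk i.+1) -> K^o} :=
  [ffun a => epsA (psi i.+1 x a)].
have inj j : exists f : {linear Tor FA i.+1 j -> {ffun 'I_(kk i.+1) -> K^o}},
    injective f /\ forall x, tor_cycles FA i.+1 j x -> f (tor_class j x) = E x.
  have [||f fE] := @subquot_lift K (Defs.restrict (FA i.+1))
      {ffun 'I_(kk i.+1) -> K^o} (tor_cycles FA i.+1 j)
      (tor_boundaries FA i.+1) E.
  - move=> c x y _ _; apply/ffunP => a; rewrite !ffunE.
    have := psi_lin i.+1 c%:A x y => /ffunP/(_ a); rewrite !ffunE => ->.
    rewrite epsAD; congr (_ + _).
    transitivity (epsA c%:A * epsA (psi i.+1 x a)); first exact: epsA_mul.
    by rewrite epsA_alg.
  - move=> x _ [y [z [Iz ->]]]; apply/ffunP => a; rewrite !ffunE.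
    rewrite (semilinD (psi_lin i.+1)) ffunE epsAD.
    rewrite (kmin (psi i.+1 (res_d FA i.+1 y))).
      rewrite add0r; apply: KK_aug_eps.
      exact: (semilin_aug_mul (r := idfun) (fun _ Ia => Ia) (psi_lin i.+1)).
    by rewrite psi_d // res_dd (semilin0 (psi_lin i)).
  exists f; split=> // u v uv; apply/eqP; rewrite -subr_eq0; apply/eqP.
  have : f (u - v) = 0 by rewrite linearB /= uv subrr.
  have [x [jx /= dx] ->] := sq_class_surj (u - v); rewrite fE // => Ex.
  apply/sq_class_eq0; first by split.
  have Ix : aug_mul (positive_part grA) (theta i.+1 (psi i.+1 x)).
    apply: (semilin_aug_mul (r := idfun) (fun _ Ia => Ia) (theta_lin i.+1)) => //.
    by apply: KK_aug => a; have /ffunP/(_ a) := Ex; rewrite !ffunE.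
  have sg k (t : FA k) : aug_mul (positive_part grA) t ->
      aug_mul (positive_part grA) (((-1) ^+ i.+1 : A) *: t).
    rewrite -signr_odd => It; case: odd; last by rewrite expr0 scale1r.
    by rewrite expr1 scaleN1r; apply: aug_mulN.
  exists (- ((-1) ^+ i.+1 *: h i.+1 x)),
    (theta i.+1 (psi i.+1 x) + (-1) ^+ i.+1 *: h i (res_d FA i x)); split.
    apply: aug_mulD => //; apply: sg.
    exact: (semilin_aug_mul (r := idfun) (fun _ Ia => Ia) (h_lin i)).
  have ss : ((-1) ^+ i.+1 : A) * (-1) ^+ i.+1 = 1 by rewrite -expr2 sqrr_sign.
  rewrite linearN linearZ /= hE // scalerDr scalerA ss scale1r opprD opprB.
  by rewrite addrACA addNr addr0 subrK.
split=> [j|]; first by have [f [f_inj _]] := inj j; apply: fin_dim_inj f_inj (fin_dim_ffun _ _).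
(* [KK i.+1] is generated in degree i + 1, so from degree i + 2 on all coefficients have positive
   degree. *)
exists i.+2 => j ij w; have [f [f_inj fE]] := inj j; apply: f_inj.
have [x [jx /= dx] ->] := sq_class_surj w; rewrite linear0 fE //.
apply/ffunP => a; rewrite !ffunE; apply: (@eps_shift i.+1 j) => //.
exact: psi_deg.
Qed.

Section Gamma.
Variable st : FB 0 -> KK 2.
Hypothesis stD : forall x y, st (x + y) = st x + st y.
Hypothesis stM : forall b y,
  st (b *: y) = rho b *: st y + (res_eps y)%:A *: sigma b.
Hypothesis st_cycle : forall y, dK 1 (st y) = 0.
Hypothesis st_deg : forall j y, gres_deg j y -> degK j.+1 (st y).

Let st0 : st 0 = 0.
Proof. by apply: (@addrI _ (st 0)); rewrite -stD !addr0. Qed.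

Let shB i := shift_graded (FBgr i).

Let shB_free i : exists (X : choiceType) (e : X -> FB i),
  is_basis e /\ forall x, exists j, shift_grading (@gres_deg _ _ _ FB i) j (e x).
Proof.
have [X [e [eB eP]]] := FBfree i; exists X, e; split=> // x.
by have [j jx] := eP x; exists j.+1.
Qed.

Let shB_d i j (x : FB i.+1) : shift_grading (@gres_deg _ _ _ FB i.+1) j x ->
  shift_grading (@gres_deg _ _ _ FB i) j (res_d FB i x).
Proof. by case: j => [->|j]; [exact: linear0 | exact: dFB]. Qed.

(** [st d] takes values in S, which [theta 2] carries into the boundaries of FA 2; lifting through
    FA 3, FA 4, ... yields a chain map for the connecting homomorphism. FB is regraded by one so
    that all maps preserve degrees. *)
Lemma exists_gamma : exists gamma : forall i, FB i.+1 -> FA i.+3,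
  [/\ forall i, semilin rho (gamma i),
      forall i j x, gres_deg j x -> gres_deg j.+1 (gamma i x),
      forall x, res_d FA 2 (gamma 0 x) = theta 2 (st (res_d FB 0 x))
    & forall i x, res_d FA i.+3 (gamma i.+1 x) = gamma i (res_d FB i.+1 x)].
Proof.
have s_lin := st_d_lin stD stM.
have [|||g0 [g0_lin g0_deg g0E]] := lift_step rho_deg grB_span (shB 1) (shB_free 1)
    (FAgr 3) (FAgr 2) (@dFA 2) (zero_graded_submodule (FAgr 2))
    (f := fun x => theta 2 (st (res_d FB 0 x))).
- by move=> c x y; rewrite s_lin theta_lin subrr.
- case=> [x ->|j x jx]; last by apply: theta_deg; apply: st_deg; apply: dFB.
  by rewrite linear0 st0 (semilin0 (theta_lin 2)); apply: (grmod0 (FAgr 2)).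
- move=> x; have : res_d FA 1 (theta 2 (st (res_d FB 0 x))) = 0.
    by rewrite theta_d st_cycle (semilin0 (theta_lin 1)).
  by move/(res_exact (r := FA)) => [y yE]; exists y; rewrite yE subrr.
have {}g0E x : res_d FA 2 (g0 x) = theta 2 (st (res_d FB 0 x)).
  by apply/eqP; rewrite -subr_eq0; apply/eqP.
have [||h [h_lin h_deg hh0 hE]] := @chain_extend K B A grB grA rho rho_deg grB_span
    (fun i => FB i.+1) (fun i => res_d FB i.+1)
    (fun i => shift_grading (@gres_deg _ _ _ FB i.+1)) (fun i => shB i.+1)
    (fun i => @shB_d i.+1) (fun i => @res_dd _ _ _ FB i.+1)
    (fun i => shB_free i.+1)
    (fun i => FA i.+3) (fun i => res_d FA i.+3) (fun i => @gres_deg _ _ _ FA i.+3)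
    (fun i => FAgr i.+3) (fun i => @dFA i.+3) xpredT (fun _ _ => isT) _ g0 g0_lin g0_deg.
- by move=> i x _ /(res_exact (r := FA)).
- move=> _ x; apply/(res_exact (r := FA)).
  by rewrite g0E res_dd st0 (semilin0 (theta_lin 2)).
exists h; split=> [//|i j x jx|x|i x].
- exact: (h_deg i j.+1).
- by rewrite hh0 g0E.
exact: hE.
Qed.

(** The element [psi 2 (d x)] of S is [sigma] of some element of N, and this element times u, of
    augmentation 1, is a boundary in FB. In higher degrees the lifting is done modulo N FB, where
    [ker_exact1] and [ker_exact] supply exactness. *)
Lemma exists_delta : exists delta : forall i, FA i.+3 -> FB i.+1,
  [/\ forall i, semilin inB (delta i),
      forall i j x, gres_deg j x -> shift_grading (@gres_deg _ _ _ FB i.+1) j (delta i x),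
      forall x, ker_mul rho (res_d FB 0 (delta 0 x)),
      forall x, st (res_d FB 0 (delta 0 x)) = psi 2 (res_d FA 2 x)
    & forall i x, ker_mul rho (res_d FB i.+1 (delta i.+1 x) - delta i (res_d FA i.+3 x))].
Proof.
have [X [e [eB e_deg]]] := FAfree 3; have [dg dgP] := choice e_deg.
have [u u0 u1] := res_unit epsB_pos FB epsB1.
have epsB0 : epsB 0 = 0 by rewrite -[X in epsB X](scale0r 1) epsB_alg.
have [|d0 [d0_lin d0_deg d0E]] := lift_step_on inc_deg grA_span (FAgr 3) (shB 1)
    (r := inB) (Q := fun x y => ker_mul rho (res_d FB 0 y) /\
      st (res_d FB 0 y) = psi 2 (res_d FA 2 (e x))) eB dgP.
  move=> x; set t := psi 2 _.
  have t0 : dK 1 t = 0 by rewrite psi_d // res_dd (semilin0 (psi_lin 1)).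
  have : degK (dg x) t by apply/psi_deg/dFA/dgP.
  (* [sigma] raises degrees by one, so a generator of degree j + 1 goes to degree j. In degree 0 the
     target t is 0, since the generators of [KK 2] have degree 2. *)
  case: (dg x) => [|j] jt.
    exists 0 => //; rewrite linear0 st0; split; first exact: ker_mul0.
    by apply/ffunP => a; rewrite ffunE (jt a).
  have [b jb bE] := sigma_onto jt t0.
  (* Subtracting the part in A moves b into N and leaves [sigma] unchanged; then [b' *: u] has
     augmentation 0. *)
  pose b' := b + inc (- rho b).
  have b'0 : rho b' = 0 by rewrite rmorphD rhoK subrr.
  have sb' : sigma b' = t by rewrite sigmaD sigma_inc addr0.
  have b'u : res_eps (b' *: u) = 0.
    have := epsFB b' u 0; rewrite addr0 => ->.
    rewrite (eps_linear0 epsB1 epsFB) addr0 -eps_rho b'0.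
    by rewrite -[X in epsA X](scale0r 1) epsA_alg mul0r.
  have [v vE] : exists v, res_d FB 0 v = b' *: u by apply/res_exact0.
  have jb'u : gres_deg j (b' *: u).
    rewrite -[j]addn0; apply: (grmod_scale (FBgr 0)) => //.
    have -> : b' = 1%:A * b + inc (- rho b) by rewrite scale1r mul1r.
    have : grB j (inc (- rho b)) by apply/inc_deg/(homogN Agr)/rho_deg.
    rewrite scale1r mul1r; exact: grBD.
  have [|v' jv' v'E] := homog_preimage (FBgr 1) (FBgr 0) (@dFB 0)
      (zero_graded_submodule (FBgr 0)) jb'u (y := v); first by rewrite vE subrr.
  exists v' => //; move/eqP: v'E; rewrite subr_eq0 => /eqP ->; split.
    exact: ker_mulI.
  by rewrite stM b'0 scale0r add0r u1 !scale1r.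
have d0P x : ker_mul rho (res_d FB 0 (d0 x)) /\
    st (res_d FB 0 (d0 x)) = psi 2 (res_d FA 2 x).
  have [l ->] := basis_list eB x; elim: l => [|p l [IH1 IH2]].
    rewrite !big_nil (semilin0 d0_lin) !linear0 st0 (semilin0 (psi_lin 2)).
    by split=> //; apply: ker_mul0.
  have [H1 H2] := d0E p.2.
  rewrite !big_cons d0_lin !linearP; split; first exact: ker_mulP.
  rewrite stD stM res_eps_d scale0r scale0r addr0 psi_lin rhoK H2.
  by rewrite IH2.
have [|||||h [h_lin h_deg hh0 hE]] := @chain_lift_mod K A B grA grB inB
    inc_deg grA_span
    (fun i => FA i.+3) (fun i => res_d FA i.+3) (fun i => @gres_deg _ _ _ FA i.+3)
    (fun i => FAgr i.+3) (fun i => @dFA i.+3) (fun i => @res_dd _ _ _ FA i.+3)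
    (fun i => FAfree i.+3)
    (fun i => FB i.+1) (fun i => res_d FB i.+1)
    (fun i => shift_grading (@gres_deg _ _ _ FB i.+1)) (fun i => shB i.+1)
    (fun i => @shB_d i.+1) (fun i => @ker_mul K A B rho (FB i.+1))
    (fun i => ker_mul_graded rho_deg Agr grB_span (shB i.+1))
    xpredT (fun _ _ => isT) _ (fun i (x : FA i.+4) => 0) _ _ _ d0 d0_lin d0_deg _.
- by move=> i z _; apply: ker_exact.
- by move=> i c x y; rewrite scaler0 addr0 subr0; apply: ker_mul0.
- by move=> i j x _; apply: (grmod0 (shB i.+1)).
- by move=> i x _; rewrite linear0 addr0; apply: ker_mul0.
- move=> _ x; rewrite add0r; have [H1 H2] := d0P (res_d FA 3 x).
  by apply: (ker_exact1 stD stM); rewrite ?H2 ?res_dd ?(semilin0 (psi_lin 2)).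
exists h; split=> // [x|x|i x].
- by rewrite hh0; have [] := d0P x.
- by rewrite hh0; have [] := d0P x.
by have := hE i isT x; rewrite add0r.
Qed.

Section Homotopies.
Unset Implicit Arguments.
Variables (gamma : forall i, FB i.+1 -> FA i.+3) (delta : forall i, FA i.+3 -> FB i.+1).
Hypothesis gamma_lin : forall i, semilin rho (gamma i).
Hypothesis gamma_deg : forall i j x, gres_deg j x -> gres_deg j.+1 (gamma i x).
Hypothesis gamma_d0 : forall x,
  res_d FA 2 (gamma 0 x) = theta 2 (st (res_d FB 0 x)).
Hypothesis gamma_d : forall i x,
  res_d FA i.+3 (gamma i.+1 x) = gamma i (res_d FB i.+1 x).
Hypothesis delta_lin : forall i, semilin inB (delta i).
Hypothesis delta_deg : forall i j x, gres_deg j x ->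
  shift_grading (@gres_deg _ _ _ FB i.+1) j (delta i x).
Hypothesis delta_d0 : forall x, ker_mul rho (res_d FB 0 (delta 0 x)).
Hypothesis delta_st : forall x,
  st (res_d FB 0 (delta 0 x)) = psi 2 (res_d FA 2 x).
Hypothesis delta_d : forall i x,
  ker_mul rho (res_d FB i.+1 (delta i.+1 x) - delta i (res_d FA i.+3 x)).
Set Implicit Arguments.

Local Notation IA := (positive_part grA).
Local Notation IB := (positive_part grB).

Let id_lin_aug i k (f : FA i -> FA k) : semilin idfun f ->
  forall x, aug_mul IA x -> aug_mul IA (f x).
Proof. by move=> f_lin; apply: (semilin_aug_mul (r := idfun)). Qed.

Let aug_sign i k (x : FA i) : aug_mul IA x -> aug_mul IA (((-1) ^+ k : A) *: x).
Proof.
rewrite -signr_odd => Ix; case: odd; last by rewrite expr0 scale1r.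
by rewrite expr1 scaleN1r; apply: aug_mulN.
Qed.

(** In the lowest degree d (gamma delta x) is [theta psi (d x)], which equals d x only up to the
    homotopy h. Subtracting [h 2 (d x)] makes the difference a cycle; when d x lies in the
    augmentation submodule, so does this correction. *)
Lemma gamma_delta_homotopy i (x : FA i.+3) : aug_mul IA (res_d FA i.+2 x) ->
  exists y z, aug_mul IA z /\ gamma i (delta i x) - x = res_d FA i.+3 y + z.
Proof.
have [h [h_lin h_deg hE]] := theta_psi_homotopy.
pose f i : FA i.+3 -> FA i.+3 := if i is k.+1
  then fun x => gamma k.+1 (delta k.+1 x) - x
  else fun x => gamma 0 (delta 0 x) - x - h 2 (res_d FA 2 x).
have gd_lin k : semilin idfun (fun x => gamma k (delta k x) - x).
  move=> c u v; rewrite delta_lin gamma_lin /= rhoK scalerBr opprD.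
  by rewrite [LHS]addrACA.
have gd_d k u : gamma k (res_d FB k.+1 (delta k.+1 u)) =
    gamma k (delta k (res_d FA k.+3 u)).
  apply/eqP; rewrite -subr_eq0 -(semilinB (gamma_lin k)); apply/eqP.
  by apply: (semilin_ker_mul (gamma_lin k)).
have [|||||k [k_lin _ k0 kE]] := @contraction K A A grA grA idfun
    (fun _ _ h => h) grA_span (fun i => FA i.+3) (fun i => res_d FA i.+3)
    (fun i => @gres_deg _ _ _ FA i.+3) (fun i => FAgr i.+3) (fun i => @dFA i.+3)
    (fun i => @res_dd _ _ _ FA i.+3) (fun i => FAfree i.+3)
    (fun i => FA i.+3) (fun i => res_d FA i.+3)
    (fun i => @gres_deg _ _ _ FA i.+3) (fun i => FAgr i.+3) (fun i => @dFA i.+3)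
    xpredT (fun _ _ => isT) f.
- by move=> k u _ /(res_exact (r := FA)).
- case=> [|k] c u v /=; last exact: gd_lin.
  by rewrite gd_lin linearP h_lin opprD addrACA [in RHS]scalerBr.
- have gd_deg k j u : gres_deg j u -> gres_deg j (gamma k (delta k u) - u).
    move=> ju; apply: (homogB (FAgr _)) => //.
    have := delta_deg _ _ _ ju; case: j {ju} => [|j]; last exact: gamma_deg.
    by move=> ->; rewrite (semilin0 (gamma_lin k)); apply: (grmod0 (FAgr _)).
  case=> [|k] j u ju /=; last exact: gd_deg.
  by apply: (homogB (FAgr _)); [exact: gd_deg | apply/h_deg/dFA].
- move=> u /=; apply/(res_exact (r := FA)).
  rewrite !linearB gamma_d0 delta_st hE // expr2 mulN1r opprK scale1r res_dd.
  by rewrite (semilin0 (h_lin 1)) addr0 subrr.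
- move=> [|k] u _ /=; rewrite linearB gamma_d gd_d //.
  by rewrite res_dd (semilin0 (h_lin 2)) subr0.
case: i x => [|i] x dx.
  exists (k 0 x), (h 2 (res_d FA 2 x)); split; first exact: id_lin_aug.
  by rewrite k0 /= subrK.
exists ((-1) ^+ i.+1 *: k i.+1 x), (- ((-1) ^+ i.+1 *: k i (res_d FA i.+3 x))).
split; first by apply/aug_mulN/aug_sign/id_lin_aug.
rewrite linearZ /= kE // scalerDr addrK scalerA -exprD -signr_odd oddD addbb.
by rewrite scale1r.
Qed.

Unset Implicit Arguments.
Variables (phi : forall i, FA i -> FB i) (beta : forall i, FB i -> FA i).
Hypothesis phi_lin : forall i, semilin inB (phi i).
Hypothesis phi_deg : forall i j x, gres_deg j x -> gres_deg j (phi i x).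
Hypothesis phi_eps : forall x, res_eps (phi 0 x) = res_eps x.
Hypothesis phi_d : forall i x,
  res_d FB i (phi i.+1 x) = phi i (res_d FA i x).
Hypothesis beta_lin : forall i, semilin rho (beta i).
Hypothesis beta_deg : forall i j x, gres_deg j x -> gres_deg j (beta i x).
Hypothesis beta_eps : forall x, res_eps (beta 0 x) = res_eps x.
Hypothesis beta_d : forall i x,
  res_d FA i (beta i.+1 x) = beta i (res_d FB i x).
Variables (X : choiceType) (e : X -> FB 0).
Hypothesis eB : is_basis e.
Hypothesis e_deg : forall x, exists j, gres_deg j (e x).
Hypothesis st_e : forall x, st (e x) = 0.
Set Implicit Arguments.

Let epsFA_B (x y : FA 0) : res_eps (x - y) = res_eps x - res_eps y.
Proof.
rewrite addrC -scaleN1r epsFA -(rmorph1 rho) -rmorphN eps_rho.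
by rewrite -scaleN1r epsB_alg mulN1r addrC.
Qed.

Let epsFB_B (x y : FB 0) : res_eps (x - y) = res_eps x - res_eps y.
Proof. by rewrite addrC -scaleN1r epsFB -scaleN1r epsB_alg mulN1r addrC. Qed.

Lemma beta_phi_homotopy i (x : FA i.+1) : aug_mul IA (res_d FA i x) ->
  exists y z, aug_mul IA z /\ beta i.+1 (phi i.+1 x) - x = res_d FA i.+1 y + z.
Proof.
have [|||||k [k_lin _ k0 kE]] := @contraction K A A grA grA idfun
    (fun _ _ h => h) grA_span FA (res_d FA) (@gres_deg _ _ _ FA) FAgr dFA
    (@res_dd _ _ _ FA) FAfree FA (res_d FA) (@gres_deg _ _ _ FA) FAgr dFA
    xpredT (fun _ _ => isT) (fun i x => beta i (phi i x) - x).
- by move=> j u _ /(res_exact (r := FA)).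
- move=> j c u v; rewrite phi_lin beta_lin /= rhoK scalerBr opprD.
  by rewrite [LHS]addrACA.
- by move=> j d u ju; apply: (homogB (FAgr j)) => //; apply/beta_deg/phi_deg.
- by move=> u; apply/res_exact0; rewrite epsFA_B beta_eps phi_eps subrr.
- by move=> j u _; rewrite linearB beta_d phi_d.
move=> dx.
exists ((-1) ^+ i.+1 *: k i.+1 x), (- ((-1) ^+ i.+1 *: k i (res_d FA i x))).
split; first by apply/aug_mulN/aug_sign/id_lin_aug.
rewrite linearZ /= kE // scalerDr addrK scalerA -exprD -signr_odd oddD addbb.
by rewrite scale1r.
Qed.

Lemma ker_mul_aug (M : lmodType B) (x : M) : ker_mul rho x -> aug_mul IB x.
Proof.
move=> [s [sI ->]]; exists s; split=> // p /sI p0.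
have := epsB_pos p.1; rewrite -eps_rho p0.
by rewrite -[X in epsA X](scale0r 1) epsA_alg scale0r subr0.
Qed.

(** [F] is semilinear over inc o rho and the identity over B. Since b - inc (rho b) lies in N, the
    two kinds of linearity agree modulo N FB, which is why only a homotopy modulo N FB is sought. *)
Let F i (x : FB i.+1) := phi i.+1 (beta i.+1 x) + delta i (gamma i x).
Let rest i (x : FB i.+1) := x - F x.

Let F_lin i : semilin piB (@F i).
Proof.
move=> c x y; rewrite /F beta_lin phi_lin gamma_lin delta_lin scalerDr.
by rewrite [LHS]addrACA.
Qed.

Let rho_piB c : rho (c - piB c) = 0.
Proof. by rewrite rmorphB /= rhoK subrr. Qed.

Let rest_lin i c (x y : FB i.+1) :
  rest (c *: x + y) - (piB c *: rest x + rest y) = (c - piB c) *: x.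
Proof.
rewrite /rest F_lin scalerBr [X in _ - X]addrACA -opprD opprB addrA subrK.
by rewrite opprD addrACA subrr addr0 -scalerBl.
Qed.

Let F_deg i j (x : FB i.+1) : gres_deg j x -> gres_deg j (F x).
Proof.
move=> jx; apply: (homogD (FBgr _)); first exact/phi_deg/beta_deg.
exact: (delta_deg _ j.+1 _ (gamma_deg _ _ _ jx)).
Qed.

Let F_d i (x : FB i.+2) : ker_mul rho (res_d FB i.+1 (F x) - F (res_d FB i.+1 x)).
Proof.
rewrite /F linearD phi_d beta_d opprD addrACA subrr add0r -gamma_d.
exact: delta_d.
Qed.

(** In degree 0 only [phi 0 (beta 0 _)] is compared with the identity, by h'. In degree 1 the
    obstruction is detected by [st]: the defect of h' contributes [- st (d x)], while
    [delta 0 (gamma 0 x)] contributes [psi 2 (theta 2 (st (d x)))], which is [st (d x)] by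
    [psi_theta]. Above that, FB / N FB is exact. *)
Lemma phi_delta_homotopy i (x : FB i.+1) : aug_mul IB (res_d FB i x) ->
  exists y z, aug_mul IB z /\
    x = phi i.+1 (beta i.+1 x) + delta i (gamma i x) + res_d FB i.+1 y + z.
Proof.
have piB_deg j b : grB j b -> grB j (piB b) by move=> jb; apply/inc_deg/rho_deg.
have [dg dgP] := choice e_deg.
have [|h' [h'_lin h'_deg h'E]] := lift_step_on piB_deg grB_span (FBgr 0) (FBgr 1)
    (Q := fun x y => res_d FB 0 y = e x - phi 0 (beta 0 (e x))) eB dgP.
  move=> u.
  have [|y yE] := (res_exact0 (e u - phi 0 (beta 0 (e u)))).1.
    by rewrite epsFB_B phi_eps beta_eps subrr.
  have [||y' jy' y'E] := homog_preimage (FBgr 1) (FBgr 0) (@dFB 0)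
      (zero_graded_submodule (FBgr 0)) (j := dg u) (z := e u - phi 0 (beta 0 (e u)))
      (y := y).
  - by apply: (homogB (FBgr 0)) => //; apply/phi_deg/beta_deg.
  - by rewrite yE subrr.
  by exists y' => //; apply/eqP; rewrite -subr_eq0; apply/eqP.
(* h' solves its equation on the basis only and is semilinear over inc o rho. The defect [W] lies in
   N FB, and [st (W u)] is [- st u] because [st] vanishes on the basis and [sigma] on the image of
   [inc]. *)
pose W u := res_d FB 0 (h' u) - (u - phi 0 (beta 0 u)).
have WP u : ker_mul rho (W u) /\ st (W u) + st u = 0.
  have [l ->] := basis_list eB u; elim: l => [|p l [IH1 IH2]].
    rewrite /W !big_nil (semilin0 h'_lin) (semilin0 (beta_lin 0)).
    by rewrite (semilin0 (phi_lin 0)) linear0 !subrr st0 addr0; split=> //; apply: ker_mul0.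
  rewrite !big_cons; set v := \sum_(_ <- _) _ in IH1 IH2 *.
  have WE : W (p.1 *: e p.2 + v) = (piB p.1 - p.1) *: e p.2 + W v.
    rewrite /W h'_lin linearP /= h'E beta_lin phi_lin.
    rewrite [X in _ - X](_ : _ = p.1 *: e p.2 - piB p.1 *: phi 0 (beta 0 (e p.2))
        + (v - phi 0 (beta 0 v))); last by rewrite opprD addrACA.
    rewrite opprD addrACA; congr (_ + _).
    by rewrite scalerBr opprB addrA subrK scalerBl.
  rewrite {}WE; move: (W v) IH1 IH2 => w IH1 IH2; split.
    apply: ker_mulD => //; apply: ker_mulI.
    by rewrite -opprB rmorphN rho_piB oppr0.
  rewrite !stD !stM !st_e !scaler0 !add0r addrACA IH2 addr0 -scalerDr -sigmaD.
  by rewrite subrK sigma_inc scaler0.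
have restE u : res_d FB 0 (- rest u + h' (res_d FB 0 u)) =
    W (res_d FB 0 u) + res_d FB 0 (delta 0 (gamma 0 u)).
  rewrite linearD linearN /rest (linearB (res_d FB 0)) /F (linearD (res_d FB 0)).
  rewrite phi_d beta_d /W.
  by rewrite !opprB [LHS]addrC [_ + _ - _]addrAC addrA.
have [|||h0 [h0_lin h0_deg h0E]] := lift_step piB_deg grB_span (FBgr 1) (FBfree 1)
    (FBgr 2) (FBgr 1) (@dFB 1) (ker_mul_graded rho_deg Agr grB_span (FBgr 1))
    (f := fun u => - rest u + h' (res_d FB 0 u)).
- move=> c u v; rewrite (linearP (res_d FB 0)) h'_lin; move: (rest_lin c u v).
  move: (rest (_ *: _ + _)) (rest u) (rest v) => r1 r2 r3 rE.
  rewrite scalerDr [X in _ - X]addrACA opprD addrACA subrr addr0 scalerN.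
  by rewrite -[X in _ - X]opprD opprK addrC -opprB rE; apply/ker_mulN/ker_mulI.
- move=> j u ju; apply: (homogD (FBgr 1)); last exact/h'_deg/dFB.
  by apply: (homogN (FBgr 1)); apply: (homogB (FBgr 1)) => //; apply: F_deg.
- move=> u; apply: (ker_exact1 stD stM); rewrite restE.
    by apply: ker_mulD => //; have [] := WP (res_d FB 0 u).
  rewrite stD delta_st gamma_d0 psi_theta //.
  by have [] := WP (res_d FB 0 u).
pose G i (u : FB i.+2) := ((-1) ^+ i : B) *: rest u.
have DN k (u : FB k) j : ker_mul rho u -> ker_mul rho (((-1) ^+ j : B) *: u).
  by move=> Du; rewrite -[_ *: _]addr0; apply: ker_mulP => //; apply: ker_mul0.
have rest_d k (u : FB k.+2) : ker_mul rho (res_d FB k.+1 (rest u) - rest (res_d FB k.+1 u)).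
  rewrite linearB opprB addrC addrA subrK -opprB; apply: ker_mulN.
  exact: F_d.
have [|||||h [h_lin h_deg hh0 hE]] := @chain_lift_mod K B B grB grB piB
    piB_deg grB_span
    (fun i => FB i.+1) (fun i => res_d FB i.+1) (fun i => @gres_deg _ _ _ FB i.+1)
    (fun i => FBgr i.+1) (fun i => @dFB i.+1) (fun i => @res_dd _ _ _ FB i.+1)
    (fun i => FBfree i.+1)
    (fun i => FB i.+2) (fun i => res_d FB i.+2)
    (fun i => @gres_deg _ _ _ FB i.+2) (fun i => FBgr i.+2)
    (fun i => @dFB i.+2) (fun i => @ker_mul K A B rho (FB i.+2))
    (fun i => ker_mul_graded rho_deg Agr grB_span (FBgr i.+2))
    xpredT (fun _ _ => isT) _ G _ _ _ h0 h0_lin h0_deg _.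
- by move=> k z _; apply: ker_exact.
- move=> k c u v; rewrite /G.
  rewrite [X in _ - (X + _)]scalerA [piB c * _]commr_sign -scalerA -scalerDr -scalerBr.
  by rewrite rest_lin; apply/DN/ker_mulI.
- move=> k j u ju; rewrite /G -signr_odd; have jr : gres_deg j (rest u).
    by apply: (homogB (FBgr _)) => //; apply: F_deg.
  by case: odd; rewrite ?expr1 ?expr0 ?scale1r // scaleN1r; apply: (homogN (FBgr _)).
- move=> k u _; rewrite /G linearZ /= exprS mulN1r scaleNr addrC -scalerBr.
  by rewrite -opprB scalerN; apply/ker_mulN/DN.
- move=> _ u; apply: ker_exact; rewrite /G expr0 scale1r linearD.
  have := ker_mulD (rest_d _ u) (h0E (res_d FB 1 u)).
  rewrite res_dd (semilin0 h'_lin) addr0 opprK.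
  move: (rest u) (rest _) => r1 r2; by rewrite addrACA addNr addr0.
have pi_aug k l (f : FB k -> FB l) : semilin piB f ->
    forall u, aug_mul IB u -> aug_mul IB (f u).
  move=> f_lin; apply: (semilin_aug_mul (r := piB)) => //.
  exact: positive_part_morph.
have signB k l (u : FB k) : aug_mul IB u -> aug_mul IB (((-1) ^+ l : B) *: u).
  rewrite -signr_odd => Iu; case: odd; last by rewrite expr0 scale1r.
  by rewrite expr1 scaleN1r; apply: aug_mulN.
case: i x => [|i] x dx.
  (* If d x lies in the augmentation submodule, so does h' (d x); the defect of h0 lies there too,
     being in N FB. *)
  exists (- h0 x), (h' (res_d FB 0 x) +
    (res_d FB 1 (h0 x) - (- rest x + h' (res_d FB 0 x)))); split.
    by apply: aug_mulD; [apply: pi_aug | apply: ker_mul_aug].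
  have E (a b c : FB 1) : - b + (a + (b - (- c + a))) = c.
    by rewrite opprD opprK addrCA addKr addrC subrK.
  by rewrite linearN -/(F x) -addrA E /rest addrC subrK.
exists ((-1) ^+ i *: h i.+1 x), (- ((-1) ^+ i *: (h i (res_d FB i.+1 x) +
    (res_d FB i.+2 (h i.+1 x) - (G i x + h i (res_d FB i.+1 x)))))); split.
  apply/aug_mulN/signB; apply: aug_mulD; last exact/ker_mul_aug/hE.
  exact: pi_aug.
have E (a b c : FB i.+2) : b - (a + (b - (c + a))) = c.
  by rewrite [- (c + a)]opprD [b + (- c - a)]addrA [a + _]addrC subrK opprB addrC subrK.
rewrite linearZ -/(F x) -addrA -scalerBr E /G scalerA -exprD -signr_odd oddD addbb.
by rewrite scale1r /rest addrC subrK.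
Qed.

End Homotopies.

End Gamma.

End Maps.

Lemma pack_lift (phi : forall i, FA i -> FB i) :
  (forall i, semilin inB (phi i)) ->
  (forall i j x, gres_deg j x -> gres_deg j (phi i x)) ->
  (forall x, res_eps (phi 0 x) = res_eps x) ->
  (forall i x, res_d FB i (phi i.+1 x) = phi i (res_d FA i x)) ->
  exists phi' : resolution_lift inc FA FB, forall i x, phi' i x = phi i x.
Proof.
move=> phi_lin phi_deg phi_eps phi_d.
have f_lin i : linear_for (inc \; *:%R) (phi i) by move=> c x y; apply: phi_lin.
pose fL i := GRing.isLinear.Build _ _ _ _ (phi i) (@f_lin i).
pose f i : {linear FA i -> FB i | inc \; *:%R} := HB.pack (phi i) (fL i).
by exists (@ResolutionLift _ _ _ _ _ _ FA FB f phi_d phi_eps phi_deg).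
Qed.

Theorem tor_extension : (exists phi : resolution_lift inc FA FB,
    forall i j : nat, (1 <= i)%N ->
    exists (f : {linear Tor FA i j -> Tor FB i j})
           (g : {linear Tor FB i j -> Tor FA i.+2 j.+1}),
      tor_induced phi f /\ short_exact f g) /\
  (forall i, graded_fin_dim (Tor FB i.+1) <->
     graded_fin_dim (Tor FA i.+1) /\ graded_fin_dim (Tor FA i.+3)) /\
  (forall i, (i < 2)%N -> graded_fin_dim (Tor FA i.+1)).
Proof.
have [phi0 [phi0_lin phi0_deg phi0_eps phi0_d]] := exists_phi.
have [phi phiE] := pack_lift phi0_lin phi0_deg phi0_eps phi0_d.
have [beta [beta_lin beta_deg beta_eps beta_d]] := exists_beta.
have [theta [theta_lin theta_deg theta_eps theta_d]] := exists_theta.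
have [psi [psi_lin psi_deg psi_eps psi_d]] := exists_psi.
have [X [e [eB e_deg]]] := FBfree 0.
have [st [stD stM st_e st_cycle st_deg]] := exists_st eB e_deg.
have [gamma [gamma_lin gamma_deg gamma_d0 gamma_d]] :=
  exists_gamma theta_lin theta_deg theta_d stD stM st_cycle st_deg.
have [delta [delta_lin delta_deg delta_d0 delta_st delta_d]] :=
  exists_delta psi_lin psi_deg psi_d stD stM.
have phi_lin i : semilin inB (phi i) by move=> c x y; rewrite linearP.
have phi_eps x : res_eps (phi 0 x) = res_eps x by exact: rlift_eps.
have gamma_aug x : aug_mul (positive_part grA) (res_d FA 2 (gamma 0 x)).
  rewrite gamma_d0; apply: (semilin_aug_mul (r := idfun) (fun _ Ia => Ia) (theta_lin 2)).
  by apply: KK_aug; apply: K_min2.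
have gd := gamma_delta_homotopy theta_lin theta_deg theta_eps theta_d psi_lin
  psi_deg psi_eps psi_d gamma_lin gamma_deg gamma_d0 gamma_d delta_lin delta_deg
  delta_st delta_d.
have bp := beta_phi_homotopy phi_lin (@rlift_deg _ _ _ _ _ _ _ _ phi) phi_eps
  (@rlift_d _ _ _ _ _ _ _ _ phi) beta_lin beta_deg beta_eps beta_d.
have pd := phi_delta_homotopy theta_lin theta_deg theta_eps theta_d psi_lin
  psi_deg psi_eps psi_d stD stM gamma_lin gamma_deg gamma_d0 gamma_d delta_lin
  delta_deg delta_d0 delta_st delta_d phi_lin (@rlift_deg _ _ _ _ _ _ _ _ phi)
  phi_eps (@rlift_d _ _ _ _ _ _ _ _ phi) beta_lin beta_deg beta_eps beta_d eB
  e_deg st_e.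
have ses i j := tor_short_exact rho_alg inc_deg rho_deg beta_lin beta_deg beta_d
  gamma_lin gamma_deg gamma_aug gamma_d delta_lin delta_deg
  (fun x => ker_mul_aug (delta_d0 x)) (fun i x => ker_mul_aug (delta_d i x))
  bp gd pd i j.
have deg0 := tor_degree0 gamma_lin delta_deg gd.
split; [|split].
- by exists phi => -[//|i] j _; apply: ses.
- move=> i; apply: graded_fin_dim_extension (deg0 i) _ => j.
  by have [f [g [_ fg]]] := ses i j; exists f, g.
exact: (tor_small theta_lin theta_deg theta_eps theta_d psi_lin psi_deg psi_eps psi_d).
Qed.

End Homological.

(** * Local algebras with m^3 = 0 *)

(* A basis 1, e_i (i < p), e_a (a < q) of R such that the e_a form a basis of
   m^2; [mu a i j] is the coefficient of e_a in e_i * e_j. *)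
Record cube_zero_basis (K : fieldType) (R : algType K) (m : R -> Prop) (p q : nat)
    (e : 'I_p + 'I_q -> R) (eps : R -> K) (co : 'I_p + 'I_q -> R -> K)
    (mu : 'I_q -> 'I_p -> 'I_p -> K) : Prop := {
  cz_eps_lin : forall c x y, eps (c *: x + y) = c * eps x + eps y;
  cz_eps1 : eps 1 = 1;
  cz_m : forall x, m x <-> eps x = 0;
  cz_co_lin : forall a c x y, co a (c *: x + y) = c * co a x + co a y;
  cz_eps_e : forall a, eps (e a) = 0;
  cz_co_e : forall a b, co a (e b) = (a == b)%:R;
  cz_expand : forall x, x = (eps x)%:A + \sum_a co a x *: e a;
  cz_mulll : forall i j, e (inl i) * e (inl j) = \sum_a mu a i j *: e (inr a);
  cz_mull0 : forall a b, e (inr a) * e b = 0;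
  cz_mulr0 : forall a b, e b * e (inr a) = 0;
  cz_indep : forall c : 'I_q -> K,
    (forall i j, \sum_a c a * mu a i j = 0) -> forall a, c a = 0 }.

(** A basis of m^2 is extended to one of m. Independence of the structure constants expresses that
    m^2 is spanned by products. *)
Lemma cube_zero_basis_exists (K : fieldType) (R : algType K) (m : R -> Prop)
    (s : seq R) (eps : R -> K) :
  (forall x, lspan s x) ->
  (forall c x y, eps (c *: x + y) = c * eps x + eps y) ->
  (forall x y, eps (x * y) = eps x * eps y) ->
  eps 1 = 1 -> (forall x, m x <-> eps x = 0) ->
  (forall x y z, m x -> m y -> m z -> x * y * z = 0) ->
  exists p q (e : 'I_p + 'I_q -> R) co mu, cube_zero_basis m e eps co mu.
Proof.
move=> sP epsL epsM eps1 mE m3.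
have eps0 : eps 0 = 0.
  have := epsL 1 0 0; rewrite scaler0 addr0 mul1r => E.
  by apply: (@addrI _ (eps 0)); rewrite -E addr0.
have epsZ c x : eps (c *: x) = c * eps x.
  by have := epsL c x 0; rewrite !addr0 eps0 addr0.
have epsD x y : eps (x + y) = eps x + eps y.
  by have := epsL 1 x y; rewrite scale1r mul1r.
pose m2 x := exists l : seq (R * R),
  (forall u, u \in l -> m u.1 /\ m u.2) /\ x = \sum_(u <- l) u.1 * u.2.
have m2m x : m2 x -> m x.
  move=> [l [lm ->]]; apply/mE; elim: l lm => [|u l IH] lm; first by rewrite big_nil.
  rewrite big_cons epsD IH ?addr0 => [|v vl]; last by apply: lm; rewrite inE vl orbT.
  by have [/mE u1 _] := lm u (mem_head _ _); rewrite epsM u1 mul0r.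
have m2m0 x y : m2 x -> m y -> x * y = 0.
  move=> [l [lm ->]] my; rewrite mulr_suml big_seq big1 // => u /lm[m1 m2'].
  exact: m3.
have mm20 x y : m x -> m2 y -> x * y = 0.
  move=> mx [l [lm ->]]; rewrite mulr_sumr big_seq big1 // => u /lm[m1 m2'].
  by rewrite mulrA; apply: m3.
have m2P x y : m x -> m y -> m2 (x * y).
  move=> mx my; exists [:: (x, y)]; split; last by rewrite big_seq1.
  by move=> u; rewrite inE => /eqP ->.
have [|||l2 [l2m l2F l2S]] := @basis_extension _ _ s m2 [::].
- by move=> x _; apply: sP.
- by [].
- by move=> c _ i.
have [|||l1 [l1m lF lS]] := @basis_extension _ _ s m l2.
- by move=> x _; apply: sP.
- by move=> x /l2m /m2m.
- exact: l2F.
rewrite /= in l2F l2S.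
pose p := size l1; pose q := size l2.
pose e (a : 'I_p + 'I_q) : R := match a with inl i => l1`_i | inr i => l2`_i end.
have sumE (c : 'I_p + 'I_q -> K) :
    \sum_a c a *: e a = \sum_(i < p) c (inl i) *: l1`_i + \sum_(i < q) c (inr i) *: l2`_i.
  by rewrite big_sumType.
have eF (c : 'I_p + 'I_q -> K) : \sum_a c a *: e a = 0 -> forall a, c a = 0.
  move=> c0.
  (* [basis_extension] lists the basis of m^2 first, whereas the index type has the complement on
     the left; d translates between the two orders. *)
  pose d k := if (k < q)%N then (if insub k is Some j then c (inr j) else 0)
    else (if insub (k - q)%N is Some i then c (inl i) else 0).
  have dr (j : 'I_q) : d j = c (inr j) by rewrite /d ltn_ord valK.
  have dl (i : 'I_p) : d (q + i)%N = c (inl i).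
    by rewrite /d ifN ?addKn ?valK // -leqNgt leq_addr.
  have /lF d0 : \sum_(i < size (l2 ++ l1)) d i *: (l2 ++ l1)`_i = 0.
    rewrite -[RHS]c0 sumE size_cat big_split_ord addrC /=; congr (_ + _).
      by apply: eq_bigr => i _; rewrite nth_cat ltn_ord dr.
    by apply: eq_bigr => i _; rewrite nth_cat ltnNge leq_addr /= addKn dl.
  case=> [i|j]; rewrite -?dl -?dr; apply: d0; rewrite size_cat.
    by rewrite ltn_add2l.
  exact: leq_trans (ltn_ord j) (leq_addr _ _).
have eS x : m x -> exists c : 'I_p + 'I_q -> K, x = \sum_a c a *: e a.
  move/lS => [c ->].
  exists (fun a : 'I_p + 'I_q => match a with
    inl i => c (q + nat_of_ord i)%N | inr i => c (nat_of_ord i) end).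
  rewrite sumE size_cat big_split_ord addrC /=; congr (_ + _).
    by apply: eq_bigr => i _; rewrite nth_cat ltn_ord.
  by apply: eq_bigr => i _; rewrite nth_cat ltnNge leq_addr /= addKn.
have me a : m (e a) by case: a => i; [apply: l1m | apply/m2m/l2m]; apply: mem_nth.
have m2e a : m2 (e (inr a)) by apply/l2m/mem_nth.
have xm x : m (x - (eps x)%:A).
  by apply/mE; rewrite addrC -scaleNr epsL eps1 mulr1 addNr.
have /choice[co coE] := fun x => eS _ (xm x).
have coU x c : x = (eps x)%:A + \sum_a c a *: e a -> forall a, co x a = c a.
  move=> xE a; apply/eqP; rewrite -subr_eq0; apply/eqP.
  apply: (eF (fun a => co x a - c a)).
  under eq_bigr do rewrite scalerBl; rewrite sumrB -coE {1}xE.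
  by rewrite [_%:A + _]addrC addrK subrr.
have xE x : x = (eps x)%:A + \sum_a co x a *: e a by rewrite -coE addrC subrK.
have m2S x : m2 x -> exists c : 'I_q -> K, x = \sum_a c a *: e (inr a).
  by move/l2S => [c ->]; exists (fun a => c a).
have /choice[mu0 mu0E] : forall ij : 'I_p * 'I_p, exists c : 'I_q -> K,
    e (inl ij.1) * e (inl ij.2) = \sum_a c a *: e (inr a).
  by move=> ij; apply/m2S/m2P.
clearbody e.
have co_lin a c x y : co (c *: x + y) a = c * co x a + co y a.
  apply: (coU (c *: x + y) (fun a => c * co x a + co y a)) => {a}.
  rewrite {1}(xE x) {1}(xE y) epsL scalerDl scalerDr -!scalerA addrACA; congr (_ + _).
  rewrite scaler_sumr -big_split; apply: eq_bigr => a _ /=.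
  by rewrite scalerDl scalerA.
have co_e a b : co (e b) a = (a == b)%:R.
  apply: (coU (e b) (fun a => (a == b)%:R)); rewrite ((mE _).1 (me b)) scale0r add0r.
  rewrite (bigD1 b) //= eqxx scale1r big1 ?addr0 // => c /negPf ->.
  by rewrite scale0r.
exists p, q, e, (fun a x => co x a), (fun a i j => mu0 (i, j) a); split=> //.
- by move=> a; apply/mE.
- by move=> i j; rewrite [LHS](mu0E (i, j)).
- by move=> a b; apply: m2m0.
- by move=> a b; apply: mm20.
move=> c c0 a.
(* The linear form with coordinates c on m^2. It kills the products e_i e_j, hence all of m^2, and
   its value at the basis vector e_a is c a. *)
pose F x := \sum_b c b * co x (inr b).
have FD t x y : F (t *: x + y) = t * F x + F y.
  rewrite /F mulr_sumr -big_split; apply: eq_bigr => b _ /=.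
  by rewrite co_lin mulrDr mulrCA.
have F0 : F 0 = 0.
  have := FD 1 0 0; rewrite scaler0 addr0 mul1r => E.
  by apply: (@addrI _ (F 0)); rewrite -E addr0.
have FZ t x : F (t *: x) = t * F x by have := FD t x 0; rewrite !addr0 F0 addr0.
have FS I (r : seq I) (g : I -> R) : F (\sum_(i <- r) g i) = \sum_(i <- r) F (g i).
  apply: (big_morph F) => // x y.
  by have := FD 1 x y; rewrite scale1r mul1r.
have Fa : F (e (inr a)) = c a.
  rewrite /F (bigD1 a) //= co_e eqxx mulr1 big1 ?addr0 // => b ba.
  by rewrite co_e (inj_eq (@inr_inj _ _)) (negPf ba) mulr0.
have Fm x y : m x -> m y -> F (x * y) = 0.
  move=> /eS[cx ->] /eS[cy ->]; rewrite mulr_suml FS big1 // => u _.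
  rewrite mulr_sumr FS big1 // => v _; rewrite -scalerAl -scalerAr !FZ.
  suff -> : F (e u * e v) = 0 by rewrite !mulr0.
  case: u => [i|u]; last by rewrite m2m0.
  case: v => [j|v]; last by rewrite mm20.
  rewrite [e _ * _](mu0E (i, j)) FS -[RHS](c0 i j); apply: eq_bigr => b _.
  rewrite FZ mulrC; congr (_ * _).
  rewrite /F (bigD1 b) //= co_e eqxx mulr1 big1 ?addr0 // => b' bb.
  by rewrite co_e (inj_eq (@inr_inj _ _)) (negPf bb) mulr0.
rewrite -Fa; have [l [lm ->]] := m2e a; rewrite FS big_seq big1 // => u /lm[m1 m2'].
exact: Fm.
Qed.

(** * The augmentation of a quotient of the exterior algebra *)

Section ExteriorQuotientFacts.
Variables (K : fieldType) (n : nat) (G : ext K n -> Prop).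
Hypothesis G_deg : forall g, G g -> exists2 d, (2 <= d)%N & ext_homog d g.
Variables (R : algType K) (pi : {lrmorphism ext K n -> R}).
Hypothesis R_def : is_quotient_by pi G.

Lemma ext_mul_set0 (a b : ext K n) : (a * b) set0 = a set0 * b set0.
Proof.
rewrite ffunE (bigD1 set0) //= [X in _ + X]big1 ?addr0 => [|S /negPf S0]; last first.
  by rewrite big_pred0 // => T; rewrite setU_eq0 S0 andbF.
rewrite (bigD1 set0) /=; last by rewrite disjoints_subset sub0set setU0 eqxx.
rewrite big1 ?addr0 => [|T]; last by rewrite set0U => /andP[/andP[_ ->]].
by rewrite /inversions big_set0 mul1r.
Qed.

Lemma ext_set0_P (c : K) (a b : ext K n) :
  (c *: a + b) set0 = c * a set0 + b set0.
Proof. by rewrite !ffunE. Qed.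

(** The elements without constant term form an ideal that contains the generators, their degree
    being positive; hence the augmentation descends to R. *)
Lemma pi_eq0_set0 a : pi a = 0 -> a set0 = 0.
Proof.
move/(R_def.2 a).1 => ga; apply: (ga (fun a => a set0 = 0)); last first.
  move=> g Gg; have [d d2 gd] := G_deg Gg; apply: gd.
  by rewrite cards0; case: d d2.
split=> [|x y x0 y0|x y y0|x y x0]; rewrite ?ext_mul_set0 ?ffunE //.
- by rewrite x0 y0 addr0.
- by rewrite y0 mulr0.
- by rewrite x0 mul0r.
Qed.

Lemma exterior_quotient_eps : exists eps : R -> K,
  [/\ forall c x y, eps (c *: x + y) = c * eps x + eps y,
      forall x y, eps (x * y) = eps x * eps y, eps 1 = 1
    & forall x, augmentation_ideal pi x <-> eps x = 0].
Proof.
have [s sE] := choice R_def.1.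
have wd a x : pi a = x -> s x set0 = a set0.
  move=> ax; apply/eqP; rewrite -subr_eq0; apply/eqP.
  have := @pi_eq0_set0 (s x - a); rewrite linearB /= sE ax subrr => /(_ erefl).
  by rewrite !ffunE.
exists (fun x => s x set0); split.
- move=> c x y; have /wd -> : pi (c *: s x + s y) = c *: x + y.
    by rewrite linearP /= !sE.
  exact: ext_set0_P.
- move=> x y; have /wd -> : pi (s x * s y) = x * y by rewrite rmorphM /= !sE.
  exact: ext_mul_set0.
- by rewrite (wd 1) ?rmorph1 // ffunE eqxx.
move=> x; split=> [[a a0 ax]|x0]; first by rewrite (wd a).
by exists (s x).
Qed.

Lemma exterior_quotient_span : exists s : seq R, forall x, lspan s x.
Proof.
pose d (U : {set 'I_n}) : ext K n := [ffun T : {set 'I_n} => (U == T)%:R].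
exists [seq pi (d U) | U <- index_enum {set 'I_n}] => x; have [a <-] := R_def.1 x.
have {1}-> : a = \sum_(U : {set 'I_n}) a U *: d U.
  apply/ffunP => T; rewrite sum_ffunE (bigD1 T) //= !ffunE eqxx big1 ?addr0.
    by rewrite /GRing.scale /= mulr1.
  by move=> U /negPf ST; rewrite !ffunE /GRing.scale /= ST mulr0.
rewrite linear_sum; under eq_bigr do rewrite linearZ.
exact: (lspan_sum _ a (fun U => pi (d U))).
Qed.

End ExteriorQuotientFacts.

(** * The cobar construction *)

Section Cobar.
Variables (K : fieldType) (p q : nat) (mu : 'I_q -> 'I_p -> 'I_p -> K).
Local Notation L := ('I_p + 'I_q)%type.

(** The coefficient of e_a in the product of two basis vectors of m; the zero branches encode m^3 =
    0. *)
Definition letter_mul (a : 'I_q) (x y : L) : K :=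
  match x, y with inl i, inl j => mu a i j | _, _ => 0 end.

(* Cochains are functions on words; only words of one given length matter. *)
Fixpoint cobar (V : lmodType K) (U : seq L -> V) (w : seq L) : V :=
  match w with
  | x :: ((y :: w') as t) =>
      \sum_a letter_mul a x y *: U (inr a :: w') - cobar (fun s => U (x :: s)) t
  | _ => 0
  end.

Lemma cobar_cons (V : lmodType K) (U : seq L -> V) x y w :
  cobar U (x :: y :: w) =
  \sum_a letter_mul a x y *: U (inr a :: w) - cobar (fun s => U (x :: s)) (y :: w).
Proof. by []. Qed.

Lemma cobar_small (V : lmodType K) (U : seq L -> V) w : (size w <= 1)%N ->
  cobar U w = 0.
Proof. by case: w => [|x []]. Qed.

Lemma cobar_ext (V : lmodType K) (U U' : seq L -> V) w :
  (forall s, (size s).+1 = size w -> U s = U' s) -> cobar U w = cobar U' w.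
Proof.
elim: w U U' => [//|x [//|y w] IH] U U' UU'; rewrite !cobar_cons; congr (_ - _).
  by apply: eq_bigr => a _; rewrite UU'.
by apply: IH => s sw; rewrite UU' //= sw.
Qed.

Lemma cobar_map (V V' : lmodType K) (g : V -> V') (U : seq L -> V) w :
  (forall x y, g (x + y) = g x + g y) -> (forall c x, g (c *: x) = c *: g x) ->
  cobar (fun s => g (U s)) w = g (cobar U w).
Proof.
move=> gD gZ; have g0 : g 0 = 0 by rewrite -(scale0r 0) gZ scale0r.
have gN x : g (- x) = - g x by rewrite -scaleN1r gZ scaleN1r.
elim: w U => [|x [|y w] IH] U; [by rewrite /= g0..|].
rewrite !cobar_cons IH gD gN; congr (_ - _); rewrite (big_morph g gD g0).
by apply: eq_bigr => a _; rewrite gZ.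
Qed.

Lemma cobarP (V : lmodType K) c (U U' : seq L -> V) w :
  cobar (fun s => c *: U s + U' s) w = c *: cobar U w + cobar U' w.
Proof.
elim: w U U' => [|x [|y w] IH] U U'; rewrite ?cobar_cons; [by rewrite scaler0 addr0..|].
rewrite IH opprD scalerBr [RHS]addrACA; congr (_ + _).
rewrite scaler_sumr -big_split; apply: eq_bigr => a _ /=.
by rewrite scalerDr !scalerA mulrC.
Qed.

Lemma cobar0 (V : lmodType K) (U : seq L -> V) w :
  (forall s, (size s).+1 = size w -> U s = 0) -> cobar U w = 0.
Proof.
elim: w U => [//|x [//|y w] IH] U U0; rewrite cobar_cons IH ?subr0.
  by rewrite big1 // => a _; rewrite U0 ?scaler0.
by move=> s sw; rewrite U0 //= sw.
Qed.

Lemma cobarZ (V : lmodType K) c (U : seq L -> V) w :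
  cobar (fun s => c *: U s) w = c *: cobar U w.
Proof.
have := cobarP c U (fun=> 0) w; rewrite [X in _ + X]cobar0 // addr0 => <-.
by apply: cobar_ext => s _; rewrite addr0.
Qed.

Lemma cobarD (V : lmodType K) (U U' : seq L -> V) w :
  cobar (fun s => U s + U' s) w = cobar U w + cobar U' w.
Proof.
rewrite -[X in X + _]scale1r -cobarP; apply: cobar_ext => s _.
by rewrite scale1r.
Qed.

Lemma cobar_sum (V : lmodType K) I (r : seq I) (U : I -> seq L -> V) w :
  cobar (fun s => \sum_(i <- r) U i s) w = \sum_(i <- r) cobar (U i) w.
Proof.
elim: r => [|i r IH].
  by rewrite big_nil; apply: cobar0 => s _; rewrite big_nil.
rewrite big_cons -IH -cobarD; apply: cobar_ext => s _; exact: big_cons.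
Qed.

Lemma cobarN (V : lmodType K) (U : seq L -> V) w :
  cobar (fun s => - U s) w = - cobar U w.
Proof.
by rewrite -scaleN1r -cobarZ; apply: cobar_ext => s _; rewrite scaleN1r.
Qed.

(** The inner function is the leading term of [cobar], read as a cochain in the letters after x.
    Merging y with its successor gives a letter from W, whose product with x is zero, so only the
    terms that leave y alone survive. *)
Lemma cobar_tail0 (V : lmodType K) (U : 'I_q -> seq L -> V) x y w :
  cobar (fun s => if s is z :: s' then
      \sum_a letter_mul a x z *: U a s' else 0) (y :: w) =
  - \sum_a letter_mul a x y *: cobar (U a) w.
Proof.
case: w => [|z w].
  by rewrite /= big1 ?oppr0 // => a _; rewrite scaler0.
rewrite cobar_cons big1 ?add0r => [|a _].
  congr (- _); rewrite (cobar_sum _ (fun a s => letter_mul a x y *: U a s)).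
  by apply: eq_bigr => a _; rewrite cobarZ.
rewrite big1 ?scaler0 // => b _.
by rewrite (_ : letter_mul b x (inr a) = 0) ?scale0r //; case: (x).
Qed.

(** Merges at disjoint places cancel in pairs, and two overlapping merges multiply three letters,
    which gives zero. *)
Lemma cobarK (V : lmodType K) (U : seq L -> V) w : cobar (cobar U) w = 0.
Proof.
elim: w U => [//|x [//|y w] IH] U; rewrite cobar_cons.
have -> : cobar (fun s => cobar U (x :: s)) (y :: w) =
    - \sum_a letter_mul a x y *: cobar (fun s => U (inr a :: s)) w.
  rewrite -cobar_tail0 -[RHS]subr0 -[X in _ - X](IH (fun s => U (x :: s))).
  rewrite -cobarN -cobarD; apply: cobar_ext => -[|z s] _ //=.
  by rewrite subrr.
rewrite opprK -big_split big1 // => a _.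
rewrite [LHS](_ : _ = letter_mul a x y *:
  (cobar U (inr a :: w) + cobar (fun s => U (inr a :: s)) w)); last by rewrite scalerDr.
case: w {IH} => [|z w]; first by rewrite /= addr0 scaler0.
rewrite cobar_cons big1 ?add0r ?addNr ?scaler0 // => b _.
by rewrite scale0r.
Qed.

Definition conv (V : lmodType K) i (U : seq L -> V) (v : seq L -> K^o) (w : seq L) : V :=
  v (drop i w) *: U (take i w).

(** The Leibniz rule: two adjacent letters either both belong to the first i + 1 letters or both
    come after the first i. *)
Lemma cobar_conv (V : lmodType K) i (U : seq L -> V) (v : seq L -> K^o) w :
  cobar (conv i U v) w = v (drop i.+1 w) *: cobar U (take i.+1 w) +
    (-1) ^+ i *: (cobar v (drop i w) *: U (take i w)).
Proof.
elim: i U w => [|i IH] U w.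
  rewrite [cobar U (take 1 w)]cobar_small ?scaler0 ?add0r ?expr0 ?scale1r ?drop0 ?take0; last first.
    by case: w => [|x []].
  rewrite -(cobar_map (g := fun x : K^o => x *: U [::])).
  - by apply: cobar_ext => s _; rewrite /conv drop0 take0.
  - by move=> x y; rewrite scalerDl.
  by move=> c x; rewrite scalerA.
case: w => [|x [|y w]].
- by rewrite /= scaler0 scale0r scaler0 addr0.
- by rewrite /= !scaler0 scale0r scaler0 addr0.
have cE : cobar (fun s => conv i.+1 U v (x :: s)) (y :: w) =
  cobar (conv i (fun s => U (x :: s)) v) (y :: w) by [].
rewrite cobar_cons cE IH /= scalerBr opprD addrA.
rewrite exprS mulN1r scaleNr; congr (_ + _); congr (_ - _).
rewrite scaler_sumr; apply: eq_bigr => a _.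
by rewrite /conv /= !scalerA mulrC.
Qed.

(** The recursion of [cobar] peels off the first letter, but the structure of B is obtained by
    removing the last one. *)
Lemma cobar_rcons (V : lmodType K) (U : seq L -> V) w x y :
  cobar U (rcons (rcons w x) y) = cobar (fun s => U (rcons s y)) (rcons w x) +
    (-1) ^+ size w *: \sum_a letter_mul a x y *: U (rcons w (inr a)).
Proof.
elim: w U => [|z w IH] U; first by rewrite /= subr0 add0r scale1r.
rewrite !rcons_cons.
have -> : cobar U (z :: rcons (rcons w x) y) =
    (if w is z' :: w' then \sum_a letter_mul a z z' *: U (inr a :: rcons (rcons w' x) y)
     else \sum_a letter_mul a z x *: U [:: inr a; y])
    - cobar (fun s => U (z :: s)) (rcons (rcons w x) y) by case: w {IH}.
have -> : cobar (fun s => U (rcons s y)) (z :: rcons w x) =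
    (if w is z' :: w' then \sum_a letter_mul a z z' *: U (inr a :: rcons (rcons w' x) y)
     else \sum_a letter_mul a z x *: U [:: inr a; y])
    - cobar (fun s => U (z :: rcons s y)) (rcons w x) by case: w {IH}.
by rewrite IH opprD addrA /= exprS mulN1r scaleNr.
Qed.

Definition weight (w : seq L) := count (fun x : L => if x is inr _ then true else false) w.

Definition restr (V : lmodType K) (Q : nat -> bool) (U : seq L -> V) (w : seq L) : V :=
  if Q (weight w) then U w else 0.

(** A merge turns two letters of V into one of W, so the value at a word of weight n involves only
    words of weight n + 1. *)
Lemma cobar_restr (V : lmodType K) Q (U : seq L -> V) w :
  cobar (restr Q U) w = restr (fun n => Q n.+1) (cobar U) w.
Proof.
elim: w Q U => [|x [|y w] IH] Q U.
- by rewrite /restr if_same.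
- by rewrite /restr /= if_same.
rewrite cobar_cons.
have -> : cobar (fun s => restr Q U (x :: s)) (y :: w) =
    cobar (restr (fun n => Q ((if x is inr _ then true else false) + n)%N)
      (fun s => U (x :: s))) (y :: w).
  by apply: cobar_ext => s _; rewrite /restr; case: (x).
rewrite IH /restr cobar_cons addnS.
have wE (a : 'I_q) : letter_mul a x y != 0 -> weight (inr a :: w) = (weight [:: x, y & w]).+1.
  case: (x) => [i|i]; last by rewrite eqxx.
  by case: (y) => [j|j]; [move=> _ | rewrite eqxx].
have <- : weight [:: x, y & w] =
    ((if x is inr _ then true else false) + weight (y :: w))%N by case: (x).
set b := Q (weight [:: x, y & w]).+1.
have -> : \sum_a letter_mul a x y *: (if Q (weight (inr a :: w)) then U (inr a :: w) else 0) =
    if b then \sum_a letter_mul a x y *: U (inr a :: w) else 0.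
  rewrite (_ : (if b then _ else _) = \sum_a (if b then letter_mul a x y *: U (inr a :: w) else 0)).
    apply: eq_bigr => a _; have [->|/wE ->] := eqVneq (letter_mul a x y) 0.
      by rewrite !scale0r if_same.
    by rewrite -/b; case: ifP => // _; rewrite scaler0.
  by case: b => //; rewrite big1.
by case: b; rewrite ?subr0.
Qed.

End Cobar.

Arguments cobar : simpl never.

(** * The bar resolution *)

Lemma tuple_sum_cons (T : finType) (V : nmodType) i (G : seq T -> V) :
  \sum_(w : i.+1.-tuple T) G w = \sum_x \sum_(v : i.-tuple T) G (x :: v).
Proof.
rewrite pair_big /=.
rewrite (reindex (fun xv : T * i.-tuple T => cons_tuple xv.1 xv.2)) //=.
exists (fun w : i.+1.-tuple T => (thead w, behead_tuple w)).
  by move=> [x v] _ /=; congr pair; apply: val_inj.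
by move=> w _; rewrite [RHS]tuple_eta; apply: val_inj.
Qed.

Lemma tuple_sum_nil (T : finType) (V : nmodType) (G : seq T -> V) :
  \sum_(w : 0.-tuple T) G w = G [::].
Proof.
rewrite (bigD1 [tuple]) //= big1 ?addr0 // => w.
by rewrite (tuple0 w) => /eqP.
Qed.

Lemma tuple_sum_cat (T : finType) (V : nmodType) i j (G : seq T -> V) :
  \sum_(w : (i + j).-tuple T) G w =
  \sum_(v : i.-tuple T) \sum_(v' : j.-tuple T) G (v ++ v').
Proof.
elim: i G => [|i IH] G.
  by rewrite (tuple_sum_nil (fun v => \sum_(v' : j.-tuple T) G (v ++ v'))).
rewrite (tuple_sum_cons (i + j)).
rewrite (tuple_sum_cons _ (fun v => \sum_(v' : j.-tuple T) G (v ++ v'))).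
by apply: eq_bigr => x _; apply: (IH (fun s => G (x :: s))).
Qed.

Lemma tuple_sum_delta (T : finType) (V : nmodType) i (G : seq T -> V) (s : seq T) :
  size s = i -> \sum_(w : i.-tuple T) (if s == w then G w else 0) = G s.
Proof.
move=> si; have /eqP si' := si; rewrite (bigD1 (Tuple si')) //= eqxx big1 ?addr0 //.
move=> w; rewrite -val_eqE /= => /negPf; by rewrite eq_sym => ->.
Qed.

Section Bar.
Variables (K : fieldType) (R : algType K) (m : R -> Prop) (p q : nat).
Local Notation L := ('I_p + 'I_q)%type.
Variables (e : L -> R) (eps : R -> K) (co : L -> R -> K).
Variable mu : 'I_q -> 'I_p -> 'I_p -> K.
Hypothesis CZ : cube_zero_basis m e eps co mu.
Local Notation cob := (cobar mu).

Lemma cz_mul x y : e x * e y = \sum_a letter_mul mu a x y *: e (inr a).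
Proof.
case: x y => [i|a] y; last first.
  by rewrite (cz_mull0 CZ) big1 // => b _; rewrite scale0r.
case: y => [j|a]; first exact: (cz_mulll CZ).
by rewrite (cz_mulr0 CZ) big1 // => b _; rewrite scale0r.
Qed.

Lemma cz_epsD x y : eps (x + y) = eps x + eps y.
Proof. by have := cz_eps_lin CZ 1 x y; rewrite scale1r mul1r. Qed.

Lemma cz_eps0 : eps 0 = 0.
Proof. by apply: (@addrI _ (eps 0)); rewrite -cz_epsD !addr0. Qed.

Lemma cz_epsZ c x : eps (c *: x) = c * eps x.
Proof. by have := cz_eps_lin CZ c x 0; rewrite !addr0 cz_eps0 addr0. Qed.

Lemma cz_epsN x : eps (- x) = - eps x.
Proof. by rewrite -scaleN1r cz_epsZ mulN1r. Qed.

Lemma cz_eps_alg c : eps c%:A = c.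
Proof. by rewrite cz_epsZ (cz_eps1 CZ) mulr1. Qed.

Lemma cz_eps_sum I (r : seq I) (F : I -> R) :
  eps (\sum_(i <- r) F i) = \sum_(i <- r) eps (F i).
Proof. by apply: (big_morph eps); [exact: cz_epsD | exact: cz_eps0]. Qed.

Lemma cz_epsM x y : eps (x * y) = eps x * eps y.
Proof.
have ee a b : eps (e a * e b) = 0.
  rewrite cz_mul cz_eps_sum big1 // => c _.
  by rewrite cz_epsZ (cz_eps_e CZ) mulr0.
rewrite {1}(cz_expand CZ x) mulrDl cz_epsD -scalerAl mul1r cz_epsZ.
rewrite mulr_suml cz_eps_sum big1 ?addr0 // => a _.
rewrite {1}(cz_expand CZ y) mulrDr cz_epsD -scalerAl cz_epsZ -scalerAr mulr1.
rewrite cz_epsZ (cz_eps_e CZ) !mulr0 add0r mulr_sumr cz_eps_sum big1 // => b _.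
by rewrite -scalerAl -scalerAr !cz_epsZ ee !mulr0.
Qed.

Lemma cz_coD a x y : co a (x + y) = co a x + co a y.
Proof. by have := cz_co_lin CZ a 1 x y; rewrite scale1r mul1r. Qed.

Lemma cz_co0 a : co a 0 = 0.
Proof. by apply: (@addrI _ (co a 0)); rewrite -cz_coD !addr0. Qed.

Lemma cz_coZ a c x : co a (c *: x) = c * co a x.
Proof. by have := cz_co_lin CZ a c x 0; rewrite !addr0 cz_co0 addr0. Qed.

Lemma cz_co_sum a I (r : seq I) (F : I -> R) :
  co a (\sum_(i <- r) F i) = \sum_(i <- r) co a (F i).
Proof. by apply: (big_morph (co a)); [exact: cz_coD | exact: cz_co0]. Qed.

Definition bar i : lmodType R := {ffun i.-tuple L -> R^o}.

Definition coef i (f : bar i) (s : seq L) : R :=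
  if insub s is Some t then f t else 0.

Lemma coef_tuple i (f : bar i) (t : i.-tuple L) : coef f t = f t.
Proof. by rewrite /coef valK. Qed.

Lemma coefP i c (f f' : bar i) s : coef (c *: f + f') s = c * coef f s + coef f' s.
Proof. by rewrite /coef; case: insub => [t|]; rewrite ?ffunE // mulr0 addr0. Qed.

Definition word_delta (w s : seq L) : K^o := (s == w)%:R.

(** The normalised bar differential in coordinates. Its second sum is the transpose of [cobar],
    which lets signs and d d = 0 be inherited from there. *)
Definition bar_d_fun i (f : bar i.+1) : bar i := [ffun t : i.-tuple L =>
  \sum_x coef f (x :: t) * e x -
  \sum_(w : i.+1.-tuple L) cob (word_delta t) w *: coef f w].

Lemma bar_d_linear i : linear (@bar_d_fun i).
Proof.
move=> c f f'; apply/ffunP => t; rewrite !ffunE.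
rewrite [c *: _ in RHS]mulrBr addrACA -opprD; congr (_ - _).
  rewrite mulr_sumr -big_split; apply: eq_bigr => x _ /=.
  by rewrite coefP mulrDl mulrA.
rewrite mulr_sumr -big_split; apply: eq_bigr => w _ /=.
by rewrite coefP scalerDr -scalerAr.
Qed.

HB.instance Definition _ i := GRing.isLinear.Build R (bar i.+1) (bar i) _
  (@bar_d_fun i) (@bar_d_linear i).
Definition bar_d i : {linear bar i.+1 -> bar i} := @bar_d_fun i.

Definition pairing i (U : seq L -> R) (f : bar i) : R :=
  \sum_(w : i.-tuple L) coef f w * U w.

Definition codiff (U : seq L -> R) (w : seq L) : R :=
  if w is x :: s then e x * U s - cob U w else 0.

Lemma pairing_d i U (f : bar i.+1) : pairing U (bar_d i f) = pairing (codiff U) f.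
Proof.
rewrite /pairing.
under eq_bigr do rewrite coef_tuple ffunE mulrBl; rewrite sumrB.
rewrite (tuple_sum_cons _ (fun w => coef f w * codiff U w)).
under [RHS]eq_bigr do under eq_bigr do rewrite mulrBr mulrA.
under [RHS]eq_bigr do rewrite sumrB; rewrite sumrB; congr (_ - _).
  by rewrite exchange_big; apply: eq_bigr => t _; rewrite mulr_suml.
rewrite -(tuple_sum_cons _ (fun w => coef f w * cob U w)).
under eq_bigr do rewrite mulr_suml; rewrite exchange_big; apply: eq_bigr => w _ /=.
rewrite -[in RHS](_ : \sum_(t : i.-tuple L) cob (word_delta t) w *: U t = cob U w).
  by rewrite mulr_sumr; apply: eq_bigr => t _; rewrite -scalerAl scalerAr.
transitivity (cob (fun s => \sum_(t : i.-tuple L) word_delta t s *: U t) w).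
  rewrite cobar_sum; apply: eq_bigr => t _.
  rewrite -(cobar_map mu (g := fun x : K^o => x *: U t)) //.
    by move=> x y; rewrite scalerDl.
  by move=> c x; rewrite scalerA.
apply: cobar_ext => s; rewrite size_tuple => -[si].
rewrite -[RHS](tuple_sum_delta _ si); apply: eq_bigr => t _.
by rewrite /word_delta; case: eqP => _; rewrite ?scale1r ?scale0r.
Qed.

Lemma bar_coefE i (f : bar i) (t : i.-tuple L) :
  f t = pairing (fun s => (word_delta t s : K)%:A) f.
Proof.
rewrite -coef_tuple /pairing (bigD1 t) //= /word_delta eqxx scale1r mulr1 big1 ?addr0 // => w.
by rewrite -val_eqE /= => /negPf ->; rewrite scale0r mulr0.
Qed.

(** The product of the first two letters cancels against their merge, by [cz_mul]; the remaining
    terms are those of [cobarK]. *)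
Lemma codiffK U w : codiff (codiff U) w = 0.
Proof.
case: w => [//|x [|y w]]; first by rewrite /= mulr0 subr0.
have -> : codiff (codiff U) [:: x, y & w] =
  e x * (e y * U w - cob U (y :: w)) - cob (codiff U) [:: x, y & w] by [].
rewrite cobar_cons mulrBr mulrA cz_mul.
have -> : cob (fun s => codiff U (x :: s)) (y :: w) =
    e x * cob U (y :: w) - cob (fun s => cob U (x :: s)) (y :: w).
  rewrite -(cobar_map mu (g := fun r : R => e x * r)); first by
    rewrite -cobarN -cobarD; apply: cobar_ext.
    by move=> r r'; rewrite mulrDr.
  by move=> c r; rewrite scalerAr.
have -> : \sum_a letter_mul mu a x y *: codiff U (inr a :: w) =
    (\sum_a letter_mul mu a x y *: e (inr a)) * U w -
    \sum_a letter_mul mu a x y *: cob U (inr a :: w).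
  by rewrite mulr_suml -sumrB; apply: eq_bigr => a _; rewrite scalerBr scalerAl.
have := cobarK mu U [:: x, y & w]; rewrite cobar_cons.
move/eqP; rewrite subr_eq0 => /eqP ->.
move: (cob (fun=> _) _) (_ * U w) (e x * cob _ _) => c a b.
by rewrite [X in _ - X](_ : _ = a - b) ?subrr // opprB addrA subrK.
Qed.

Lemma bar_dd i (f : bar i.+2) : bar_d i (bar_d i.+1 f) = 0.
Proof.
apply/ffunP => t; rewrite bar_coefE !pairing_d ffunE /pairing big1 // => w _.
by rewrite codiffK mulr0.
Qed.

Definition bar_eps (f : bar 0) : K := eps (coef f [::]).

Lemma bar_eps_lin : eps_linear eps bar_eps.
Proof. by move=> c f f'; rewrite /bar_eps coefP cz_epsD cz_epsM. Qed.

Lemma bar_eps_d f : bar_eps (bar_d 0 f) = 0.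
Proof.
rewrite /bar_eps (coef_tuple _ [tuple]) ffunE cz_epsD cz_eps_sum big1 => [|x _].
  rewrite add0r cz_epsN cz_eps_sum big1 ?oppr0 // => w _.
  by rewrite cobar_small ?scale0r ?cz_eps0 // size_tuple.
by rewrite cz_epsM (cz_eps_e CZ) mulr0.
Qed.

(** The usual contraction r [w] -> [r | w], with r expanded in the basis of m and its scalar part
    dropped; it is only K-linear. *)
Definition bar_s i (f : bar i) : bar i.+1 :=
  [ffun w : i.+1.-tuple L => (co (thead w) (coef f (behead w)))%:A].

Lemma coef_bar_s i (f : bar i) x (v : i.-tuple L) :
  coef (bar_s f) (x :: v) = (co x (coef f v))%:A.
Proof. by rewrite (coef_tuple _ (cons_tuple x v)) ffunE. Qed.

Lemma bar_d_s i (f : bar i) (t : i.-tuple L) :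
  bar_d i (bar_s f) t = coef f t - (eps (coef f t))%:A -
    (\sum_x \sum_(v : i.-tuple L) cob (word_delta t) (x :: v) * co x (coef f v))%:A.
Proof.
rewrite ffunE; congr (_ - _).
  have -> : coef f t - (eps (coef f t))%:A = \sum_x co x (coef f t) *: e x.
    by apply/eqP; rewrite subr_eq addrC; apply/eqP; apply: (cz_expand CZ).
  by apply: eq_bigr => x _; rewrite coef_bar_s -scalerAl mul1r.
rewrite (tuple_sum_cons _ (fun w => cob (word_delta t) w *: coef (bar_s f) w)).
rewrite scaler_suml; apply: eq_bigr => x _; rewrite scaler_suml.
by apply: eq_bigr => v _; rewrite coef_bar_s scalerA.
Qed.

Lemma cz_co_mul z r y : co z (r * e y) = eps r * (z == y)%:R +
  \sum_x \sum_a letter_mul mu a x y * (z == inr a)%:R * co x r.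
Proof.
rewrite {1}(cz_expand CZ r) mulrDl cz_coD -scalerAl mul1r cz_coZ (cz_co_e CZ).
congr (_ + _); rewrite mulr_suml cz_co_sum; apply: eq_bigr => x _.
rewrite -scalerAl cz_coZ cz_mul cz_co_sum mulr_sumr; apply: eq_bigr => a _.
by rewrite cz_coZ (cz_co_e CZ) mulrC.
Qed.

(** Compared at a word z :: t'. The formula [cz_co_mul] splits a coordinate of a product into a
    scalar part, which restores the [eps] term missing in [bar_d_s], and a merge part, which cancels
    the cobar terms. *)
Lemma bar_homotopy i (f : bar i.+1) : bar_d i.+1 (bar_s f) + bar_s (bar_d i f) = f.
Proof.
apply/ffunP => t.
have -> : t = cons_tuple (thead t) (behead_tuple t).
  by rewrite {1}(tuple_eta t); apply: val_inj.
move: (thead t) (behead_tuple t) => z t' {t}.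
rewrite ffunE bar_d_s.
have -> : bar_s (bar_d i f) (cons_tuple z t') = (co z (coef (bar_d i f) t'))%:A.
  by rewrite -coef_tuple; apply: coef_bar_s.
rewrite -[RHS]coef_tuple; set r := coef f _.
suff -> : co z (coef (bar_d i f) t') = eps r +
    \sum_x \sum_(v : i.+1.-tuple L)
      cob (word_delta (cons_tuple z t')) (x :: v) * co x (coef f v).
  by rewrite scalerDl [X in _ + X]addrC addrA subrK subrK.
rewrite coef_tuple ffunE cz_coD -scaleN1r cz_coZ mulN1r !cz_co_sum.
under eq_bigr do rewrite cz_co_mul; rewrite big_split /=.
rewrite (bigD1 z) //= eqxx mulr1 big1 => [|y /negPf yz]; last first.
  by rewrite eq_sym yz mulr0.
rewrite addr0 -/r -addrA; congr (_ + _).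
have delta_cons y s : word_delta (cons_tuple z t') (y :: s) =
    (y == z)%:R * word_delta t' s.
  by rewrite /word_delta /= eqseq_cons; case: eqP; rewrite ?mul1r ?mul0r.
have E x y (v : i.-tuple L) : cob (word_delta (cons_tuple z t')) [:: x, y & v] =
    (\sum_a letter_mul mu a x y * (z == inr a)%:R) * word_delta t' v -
    (x == z)%:R * cob (word_delta t') (y :: v).
  rewrite cobar_cons; congr (_ - _).
    rewrite mulr_suml; apply: eq_bigr => a _.
    rewrite delta_cons eq_sym.
    exact: (mulrA (letter_mul mu a x y) (z == inr a)%:R (word_delta t' v : K)).
  apply: etrans _ (cobarZ mu (x == z)%:R (word_delta t') (y :: v)).
  by apply: cobar_ext => s _; apply: delta_cons.
under [RHS]eq_bigr do rewrite (tuple_sum_cons _ (fun v =>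
  cob (word_delta (cons_tuple z t')) (_ :: v) * co _ (coef f v))).
under [RHS]eq_bigr do under eq_bigr do under eq_bigr do rewrite E mulrBl.
under [RHS]eq_bigr do under eq_bigr do rewrite sumrB.
under [RHS]eq_bigr do rewrite sumrB.
rewrite sumrB; congr (_ - _).
  rewrite exchange_big; apply: eq_bigr => x _; apply: eq_bigr => y _ /=.
  transitivity (\sum_(v : i.-tuple L) (if t' == v :> seq L then
     (\sum_a letter_mul mu a x y * (z == inr a)%:R) * co x (coef f (y :: v)) else 0)).
    rewrite (tuple_sum_delta (fun v => (\sum_a letter_mul mu a x y * (z == inr a)%:R) *
      co x (coef f (y :: v)))) ?size_tuple //.
    by rewrite mulr_suml.
  apply: eq_bigr => v _; rewrite /word_delta eq_sym.
  by case: eqP => _; rewrite ?mulr1 // mulr0 mul0r.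
rewrite (tuple_sum_cons _ (fun w => co z (cob (word_delta t') w *: coef f w))).
rewrite [RHS](bigD1 z) //= eqxx [X in _ = _ + X]big1 ?addr0 => [|x /negPf xz].
  by apply: eq_bigr => y _; apply: eq_bigr => v _; rewrite cz_coZ mul1r.
by rewrite big1 // => y _; rewrite big1 // => v _; rewrite xz !mul0r.
Qed.

Lemma bar_exact i (f : bar i.+1) : bar_d i f = 0 -> exists g, bar_d i.+1 g = f.
Proof.
move=> f0; exists (bar_s f); rewrite -[RHS]bar_homotopy f0.
suff -> : bar_s (0 : bar i) = 0 by rewrite addr0.
apply/ffunP => w; rewrite !ffunE.
by rewrite (_ : coef 0 _ = 0) ?cz_co0 ?scale0r // /coef; case: insub => // t; rewrite ffunE.
Qed.

Lemma bar_exact0 (f : bar 0) : bar_eps f = 0 -> exists g, bar_d 0 g = f.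
Proof.
move=> f0; exists (bar_s f); apply/ffunP => t.
rewrite bar_d_s (tuple0 t) -[RHS]coef_tuple /= [eps _]f0 scale0r subr0.
rewrite big1 ?scale0r ?subr0 // => x _; rewrite big1 // => v _.
by rewrite cobar_small ?mul0r //= size_tuple.
Qed.

End Bar.

(* Everything in degree 0: it makes the graded lifting lemmas available over
   the ungraded algebra R. *)
Definition trivial_grading (M : zmodType) (j : nat) (x : M) : Prop :=
  if j is 0 then True else x = 0.

Lemma trivial_graded (K : fieldType) (R : algType K) (M : lmodType R) :
  is_graded_module (@trivial_grading R) (@trivial_grading M).
Proof.
split.
- by case.
- by case=> //= j c x y -> ->; rewrite scaler0 addr0.
- move=> x; exists 1%N, (fun j => if j is 0 then x else 0); split; first by case.
  by rewrite big_ord1.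
- move=> N f fgr; case: N => // N; rewrite big_ord_recl big1 ?addr0 => [f0|i _].
    by case=> [//|j] _; apply: (fgr j.+1).
  exact: (fgr _.+1).
by case=> [|i] [|j] a x //= => [_ ->|->|->]; rewrite ?scaler0 ?scale0r.
Qed.

(** * Ext as the cohomology of the cobar complex *)

Section ExtCochains.
Variables (K : fieldType) (R : algType K) (m : R -> Prop) (p q : nat).
Local Notation L := ('I_p + 'I_q)%type.
Variables (e : L -> R) (eps : R -> K) (co : L -> R -> K).
Variable mu : 'I_q -> 'I_p -> 'I_p -> K.
Hypothesis CZ : cube_zero_basis m e eps co mu.
Local Notation cob := (cobar mu).
Local Notation bar := (bar R p q).
Local Notation bar_d := (bar_d e mu).
Local Notation bar_eps := (@bar_eps K R p q eps).

Definition eval_cochain i (u : seq L -> K^o) (f : bar i) : K :=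
  \sum_(w : i.-tuple L) u w * eps (coef f w).

Lemma eval_cochainE i u (f : bar i) :
  eval_cochain u f = eps (pairing (fun s => (u s : K)%:A) f).
Proof.
rewrite /pairing (cz_eps_sum CZ); apply: eq_bigr => w _.
by rewrite (cz_epsM CZ) (cz_eps_alg CZ) mulrC.
Qed.

Lemma eval_cochain_lin i u : eps_linear eps (eval_cochain u : bar i -> K).
Proof.
move=> c f f'; rewrite /eval_cochain mulr_sumr -big_split; apply: eq_bigr => w _ /=.
by rewrite coefP (cz_epsD CZ) (cz_epsM CZ) mulrDr mulrCA.
Qed.

Lemma eval_cochain_d i u (f : bar i.+1) :
  eval_cochain u (bar_d i f) = - eval_cochain (cob u) f.
Proof.
rewrite eval_cochainE pairing_d /pairing (cz_eps_sum CZ) /eval_cochain -sumrN.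
apply: eq_bigr => w _; rewrite (cz_epsM CZ).
case/tupleP: w => x s; rewrite /codiff /= (cz_epsD CZ) (cz_epsM CZ).
rewrite (cz_eps_e CZ) mul0r add0r (cz_epsN CZ) mulrN mulrC; congr (- (_ * _)).
transitivity (eps (cob u (x :: s) : K)%:A); last exact: (cz_eps_alg CZ).
congr eps; apply: (@cobar_map K p q mu K^o R (fun x : K => x%:A) u).
  by move=> c d; rewrite scalerDl.
by move=> c d; rewrite scalerA.
Qed.

Lemma eval_cochain_ext i u v (f : bar i) : (forall w, size w = i -> u w = v w) ->
  eval_cochain u f = eval_cochain v f.
Proof. by move=> uv; apply: eq_bigr => w _; rewrite uv // size_tuple. Qed.

Lemma eval_cochain0 i u (f : bar i) : (forall w, size w = i -> u w = 0) ->
  eval_cochain u f = 0.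
Proof. by move=> u0; apply: big1 => w _; rewrite u0 ?mul0r // size_tuple. Qed.

Lemma eval_cochainP i c u v (f : bar i) :
  eval_cochain (fun s => c *: u s + v s) f = c * eval_cochain u f + eval_cochain v f.
Proof.
rewrite /eval_cochain mulr_sumr -big_split; apply: eq_bigr => w _ /=.
by rewrite mulrDl mulrA.
Qed.

Definition word i (s : seq L) : bar i := [ffun t : i.-tuple L => (s == t)%:R].

Lemma eval_cochain_word i u s : size s = i -> eval_cochain u (word i s) = u s.
Proof.
move=> si; rewrite /eval_cochain -(tuple_sum_delta u si).
apply: eq_bigr => t _; rewrite coef_tuple ffunE.
by case: eqP => _; rewrite ?(cz_eps1 CZ) ?(cz_eps0 CZ) ?mulr1 ?mulr0.
Qed.

Lemma hom_eps_linear (M : lmodType R) (phi : M -> K) :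
  hom_to_ground m phi <-> eps_linear eps phi.
Proof.
split=> [[pL pI] c x y|pL].
  have pL' (a : K) u v : phi (a%:A *: u + v) = a * phi u + phi v := pL a u v.
  have -> : c *: x + y = (eps c)%:A *: x + ((c - (eps c)%:A) *: x + y).
    by rewrite addrA -scalerDl [_%:A + _]addrC subrK.
  rewrite pL'; have := pL' 1 ((c - (eps c)%:A) *: x) y.
  rewrite !scale1r mul1r => ->; rewrite pI ?add0r //.
  by apply/(cz_m CZ); rewrite (cz_epsD CZ) (cz_epsN CZ) (cz_eps_alg CZ) subrr.
have p0 := eps_linear0 (cz_eps1 CZ) pL.
split=> [c x y|a x /(cz_m CZ) a0].
  by rewrite pL (cz_eps_alg CZ).
by have := pL a x 0; rewrite !addr0 a0 mul0r p0 addr0.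
Qed.

Lemma eps_linear_sum (M : lmodType R) (phi : M -> K) I (r : seq I)
    (c : I -> R) (x : I -> M) : eps_linear eps phi ->
  phi (\sum_(i <- r) c i *: x i) = \sum_(i <- r) eps (c i) * phi (x i).
Proof.
move=> pL; have p0 := eps_linear0 (cz_eps1 CZ) pL.
by elim: r => [|i r IH]; rewrite ?big_nil // !big_cons pL IH.
Qed.

Lemma bar_hom i (phi : bar i -> K) : eps_linear eps phi ->
  forall f, phi f = eval_cochain (fun s => phi (word i s)) f.
Proof.
move=> pL f; rewrite [in LHS](free_deltaE f) eps_linear_sum //.
by apply: eq_bigr => t _; rewrite coef_tuple mulrC.
Qed.

Lemma eps_linear_semilin (M M' : lmodType R) (phi : M' -> K) (f : M -> M') :
  eps_linear eps phi -> semilin idfun f -> eps_linear eps (fun x => phi (f x)).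
Proof. by move=> pL f_lin c x y; rewrite f_lin pL. Qed.

Lemma eps_linear_add (M : lmodType R) (phi : M -> K) x y :
  eps_linear eps phi -> phi (x + y) = phi x + phi y.
Proof. by move=> pL; have := pL 1 x y; rewrite scale1r (cz_eps1 CZ) mul1r. Qed.

Lemma eps_linear_scale (M : lmodType R) (phi : M -> K) c x :
  eps_linear eps phi -> phi (c *: x) = eps c * phi x.
Proof.
move=> pL; have := pL c x 0; rewrite !addr0 => ->.
by rewrite (eps_linear0 (cz_eps1 CZ) pL) addr0.
Qed.

(** Evaluates v on the last j letters. For a cocycle v this commutes with the differentials, so it
    is an explicit lift of v on the bar resolution, as the Yoneda product requires. *)
Definition slant i j (v : seq L -> K^o) (f : bar (i + j)) : bar i :=
  [ffun t : i.-tuple L => \sum_(w : j.-tuple L) v w *: coef f (t ++ w)].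

Lemma slant_lin i j v : semilin idfun (@slant i j v).
Proof.
move=> c f f'; apply/ffunP => t; rewrite !ffunE.
rewrite [c *: _ in RHS]mulr_sumr -big_split; apply: eq_bigr => w _ /=.
by rewrite coefP scalerDr -scalerAr.
Qed.

Lemma pairing_slant i j U v (f : bar (i + j)) :
  pairing U (slant v f) = pairing (conv i U v) f.
Proof.
rewrite /pairing (tuple_sum_cat i j (fun s => coef f s * conv i U v s)).
apply: eq_bigr => t _; rewrite coef_tuple ffunE mulr_suml; apply: eq_bigr => w _.
rewrite /conv take_size_cat ?drop_size_cat ?size_tuple //.
by rewrite -scalerAl scalerAr.
Qed.

Lemma eval_slant i j u v (f : bar (i + j)) :
  eval_cochain u (slant v f) = eval_cochain (conv i u v) f.
Proof.
rewrite !eval_cochainE pairing_slant; congr eps; apply: eq_bigr => w _.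
by rewrite /conv scalerA.
Qed.

Definition is_cochain_cycle j (u : seq L -> K^o) :=
  forall w, size w = j.+1 -> cob u w = 0.

Lemma slant_d i j v (f : bar (i.+1 + j)) : is_cochain_cycle j v ->
  bar_d i (slant v f) = slant v (bar_d (i + j) f).
Proof.
move=> v0; apply/ffunP => t; rewrite !bar_coefE pairing_d !pairing_slant pairing_d.
rewrite /pairing; apply: eq_bigr => w _; congr (_ * _).
have sw : size w = (i.+1 + j)%N by rewrite size_tuple.
case: (tval w) sw => [//|x s] /= [si].
rewrite cobar_conv v0 ?scale0r ?scaler0 ?addr0 /=; last first.
  by rewrite size_drop /= si subSn ?leq_addr // addKn.
by rewrite /conv /= scalerBr scalerAr.
Qed.

Lemma conv_cycle i j u v : is_cochain_cycle i u -> is_cochain_cycle j v ->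
  is_cochain_cycle (i + j) (conv i u v).
Proof.
move=> u0 v0 w sw; rewrite cobar_conv u0 ?v0 ?scaler0 ?scale0r ?scaler0 ?addr0 //.
  by rewrite size_drop sw subSn ?leq_addr // addKn.
by rewrite size_takel // sw ltnS leq_addr.
Qed.

Variable P : resolution m.

Let id_deg : forall j (c : R), trivial_grading j c -> trivial_grading j (idfun c).
Proof. by []. Qed.

Let R_span : forall c : R, exists N (f : nat -> R),
  (forall j, trivial_grading j (f j)) /\ c = \sum_(j < N) f j.
Proof. exact: (grmod_span (trivial_graded (R^o : lmodType R))). Qed.

Let P_free i : exists (X : choiceType) (b : X -> P i),
  is_basis b /\ forall x, exists j, trivial_grading j (b x).
Proof.
have [X [b bB]] := res_free P i; exists X, b; split=> // x.
by exists 0%N.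
Qed.

Let bar_free i : exists (X : choiceType) (b : X -> bar i),
  is_basis b /\ forall x, exists j, trivial_grading j (b x).
Proof.
exists (i.-tuple L), (@free_delta K R _); split=> [|x]; last by exists 0%N.
exact: free_delta_basis.
Qed.

Let d_deg (M M' : lmodType R) (f : M -> M') : semilin idfun f ->
  forall j x, trivial_grading j x -> trivial_grading j (f x).
Proof. by move=> f_lin [|j] x //= ->; rewrite (semilin0 (r := idfun) f_lin). Qed.

Let bar_dL i : semilin idfun (bar_d i).
Proof. exact: linear_semilin. Qed.

Let res_dL i : semilin idfun (res_d P i).
Proof. exact: linear_semilin. Qed.

Let resE : eps_linear eps (@res_eps _ _ _ P).
Proof. exact/hom_eps_linear/res_eps_hom. Qed.

Let barE : eps_linear eps bar_eps.
Proof. exact: (bar_eps_lin CZ). Qed.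

Let bar_unit : bar_eps (word 0 [::]) = 1.
Proof. by rewrite /bar_eps (coef_tuple _ [tuple]) ffunE (cz_eps1 CZ). Qed.

Let res_ddP i x : res_d P i (res_d P i.+1 x) = 0.
Proof. by apply/(res_exact (r := P)); exists x. Qed.

Let bar_ddP i x : bar_d i (bar_d i.+1 x) = 0.
Proof. exact: (bar_dd CZ). Qed.

Lemma exists_bar_to_res : exists c : forall i, bar i -> P i,
  [/\ forall i, semilin idfun (c i), forall x, res_eps (c 0 x) = bar_eps x
    & forall i x, res_d P i (c i.+1 x) = c i (bar_d i x)].
Proof.
have [u u1] := res_eps_surj P 1.
have [||h [h_lin _ h_eps h_d]] := @comparison K R R _ _ idfun id_deg R_span
    bar bar_d _ (fun i => trivial_graded (bar i))
    (fun i => d_deg (@bar_dL i)) bar_ddP bar_free P (res_d P) _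
    (fun i => trivial_graded (P i)) (fun i => d_deg (@res_dL i)) xpredT
    (fun _ _ => isT) _ eps eps bar_eps (@res_eps _ _ _ P) u (fun=> erefl)
    (cz_eps_alg CZ) barE resE _ I u1 (bar_eps_d CZ) (fun x => (res_exact0 x).1).
- by move=> i x _ /(res_exact (r := P)).
- by move=> j x ->; apply: (eps_linear0 (cz_eps1 CZ) barE).
by exists h; split=> // i x; apply: h_d.
Qed.

Lemma exists_res_to_bar : exists c : forall i, P i -> bar i,
  [/\ forall i, semilin idfun (c i), forall x, bar_eps (c 0 x) = res_eps x
    & forall i x, bar_d i (c i.+1 x) = c i (res_d P i x)].
Proof.
have [||h [h_lin _ h_eps h_d]] := @comparison K R R _ _ idfun id_deg R_span
    P (res_d P) _ (fun i => trivial_graded (P i))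
    (fun i => d_deg (@res_dL i)) res_ddP P_free bar bar_d _
    (fun i => trivial_graded (bar i)) (fun i => d_deg (@bar_dL i)) xpredT
    (fun _ _ => isT) _ eps eps (@res_eps _ _ _ P) bar_eps (word 0 [::]) (fun=> erefl)
    (cz_eps_alg CZ) resE barE _ I bar_unit (fun x => (res_exact0 _).2 (ex_intro _ x erefl))
    (fun x => bar_exact0 CZ (f := x)).
- by move=> i x _; apply: (bar_exact CZ).
- by move=> j x ->; apply: (eps_linear0 (cz_eps1 CZ) resE).
by exists h; split=> // i x; apply: h_d.
Qed.

Unset Implicit Arguments.
Variables (c : forall i, bar i -> P i) (c' : forall i, P i -> bar i).
Hypothesis c_lin : forall i, semilin idfun (c i).
Hypothesis c'_lin : forall i, semilin idfun (c' i).
Hypothesis c_eps : forall x, res_eps (c 0 x) = bar_eps x.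
Hypothesis c'_eps : forall x, bar_eps (c' 0 x) = res_eps x.
Hypothesis c_d : forall i x, res_d P i (c i.+1 x) = c i (bar_d i x).
Hypothesis c'_d : forall i x, bar_d i (c' i.+1 x) = c' i (res_d P i x).
Set Implicit Arguments.

Let epsB (M : lmodType R) (phi : M -> K) x y : eps_linear eps phi ->
  phi (x - y) = phi x - phi y.
Proof.
move=> pL; rewrite (eps_linear_add _ _ pL) -[- y]scaleN1r (eps_linear_scale _ _ pL).
by rewrite (cz_epsN CZ) (cz_eps1 CZ) mulN1r.
Qed.

Lemma bar_homotopy_res : exists h : forall i, bar i -> bar i.+1,
  [/\ forall i, semilin idfun (h i),
      forall x, bar_d 0 (h 0 x) = c' 0 (c 0 x) - x
    & forall i x, bar_d i.+1 (h i.+1 x) =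
        (-1) ^+ i.+1 *: (c' i.+1 (c i.+1 x) - x) + h i (bar_d i x)].
Proof.
have [|||||h [h_lin _ h0 h_d]] := @contraction K R R _ _ idfun id_deg R_span
    bar bar_d _ (fun i => trivial_graded (bar i))
    (fun i => d_deg (@bar_dL i)) bar_ddP bar_free bar bar_d _
    (fun i => trivial_graded (bar i)) (fun i => d_deg (@bar_dL i)) xpredT
    (fun _ _ => isT) (fun i x => c' i (c i x) - x).
- by move=> i x _; apply: (bar_exact CZ).
- move=> i a x y; rewrite c_lin c'_lin scalerBr opprD.
  by rewrite [LHS]addrACA.
- move=> i [|j] x //= ->.
  by rewrite (semilin0 (r := idfun) (c_lin i)) (semilin0 (r := idfun) (c'_lin i)) subrr.
- by move=> x; apply: (bar_exact0 CZ); rewrite (epsB _ _ barE) c'_eps c_eps subrr.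
- by move=> i x _; rewrite /= (linearB (bar_d i)) c'_d c_d.
by exists h; split=> // i x; apply: h_d.
Qed.

Lemma res_homotopy_bar : exists h : forall i, P i -> P i.+1,
  [/\ forall i, semilin idfun (h i),
      forall x, res_d P 0 (h 0 x) = c 0 (c' 0 x) - x
    & forall i x, res_d P i.+1 (h i.+1 x) =
        (-1) ^+ i.+1 *: (c i.+1 (c' i.+1 x) - x) + h i (res_d P i x)].
Proof.
have [|||||h [h_lin _ h0 h_d]] := @contraction K R R _ _ idfun id_deg R_span
    P (res_d P) _ (fun i => trivial_graded (P i))
    (fun i => d_deg (@res_dL i)) res_ddP P_free P (res_d P) _
    (fun i => trivial_graded (P i)) (fun i => d_deg (@res_dL i)) xpredT
    (fun _ _ => isT) (fun i x => c i (c' i x) - x).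
- by move=> i x _ /(res_exact (r := P)).
- move=> i a x y; rewrite c'_lin c_lin scalerBr opprD.
  by rewrite [LHS]addrACA.
- move=> i [|j] x //= ->.
  by rewrite (semilin0 (r := idfun) (c'_lin i)) (semilin0 (r := idfun) (c_lin i)) subrr.
- by move=> x; apply/res_exact0; rewrite (epsB _ _ resE) c_eps c'_eps subrr.
- by move=> i x _; rewrite /= (linearB (res_d P i)) c_d c'_d.
by exists h; split=> // i x; apply: h_d.
Qed.

Definition cochain_hom j (u : seq L -> K^o) : P j -> K^o :=
  fun x => eval_cochain u (c' j x).

Lemma cochain_hom_lin j u : eps_linear eps (cochain_hom u : P j -> K).
Proof. exact: (eps_linear_semilin (eval_cochain_lin u) (c'_lin j)). Qed.

Lemma cochain_hom_cocycle j u : is_cochain_cycle j u ->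
  is_cocycle (cochain_hom u : P j -> K^o).
Proof.
move=> u0; split; first exact/hom_eps_linear/cochain_hom_lin.
move=> x; rewrite /cochain_hom -c'_d eval_cochain_d.
by rewrite eval_cochain0 ?oppr0.
Qed.

Definition cochain_class j (u : seq L -> K^o) : Ext P j := ext_class (@cochain_hom j u).

Lemma cochain_class_lin j a u v : is_cochain_cycle j u -> is_cochain_cycle j v ->
  cochain_class j (fun s => a *: u s + v s) = a *: cochain_class j u + cochain_class j v.
Proof.
move=> u0 v0; rewrite /cochain_class /ext_class.
rewrite -(sq_classP (coboundaries P j) a (cochain_hom_cocycle u0 : cocycles P j _)
  (cochain_hom_cocycle v0 : cocycles P j _)).
congr sq_class; apply: funext => x; exact: eval_cochainP.
Qed.

Let eps_sign n : eps ((-1) ^+ n) = (-1) ^+ n.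
Proof.
rewrite -signr_odd -[RHS]signr_odd; case: odd; last by rewrite !expr0 (cz_eps1 CZ).
by rewrite !expr1 (cz_epsN CZ) (cz_eps1 CZ).
Qed.

(** A cocycle phi on P is cohomologous to its pullback along [c c'], and the latter is evaluation of
    the cochain u. *)
Lemma cochain_class_onto j (x : Ext P j) : exists2 u, is_cochain_cycle j u &
  x = cochain_class j u.
Proof.
have [phi [phiH phi_d] ->] := sq_class_surj x.
have phiL : eps_linear eps phi by apply/hom_eps_linear.
pose u s := phi (c j (word j s)).
have phic : eps_linear eps (fun f => phi (c j f)) := eps_linear_semilin phiL (c_lin j).
have phicE f : phi (c j f) = eval_cochain u f by exact: (bar_hom phic f).
have u0 : is_cochain_cycle j u.
  move=> w sw; apply/eqP; rewrite -oppr_eq0; apply/eqP.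
  rewrite -(eval_cochain_word (fun s => - cob u s) sw).
  have -> : eval_cochain (fun s => - cob u s) (word j.+1 w) =
      - eval_cochain (cob u) (word j.+1 w).
    by rewrite /eval_cochain -sumrN; apply: eq_bigr => t _; rewrite mulNr.
  by rewrite -eval_cochain_d -phicE -c_d phi_d.
exists u => //; apply: sq_class_eq.
- by split.
- exact: cochain_hom_cocycle.
have [h [h_lin h0 h_d]] := res_homotopy_bar.
have E y : (phi - @cochain_hom j u) y = phi (y - c j (c' j y)).
  by rewrite (epsB _ _ phiL) phicE.
case: j x phi phiH phi_d phiL u phic phicE u0 E => [|j] x phi phiH phi_d phiL u phic phicE u0 E.
  move=> y; rewrite E -opprB -h0 -scaleN1r (eps_linear_scale _ _ phiL).
  by rewrite phi_d mulr0.
exists (fun y => (-1) ^+ j.+1 * phi (h j y)); split=> [|y].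
  apply/hom_eps_linear => a y z.
  by rewrite h_lin phiL mulrDr mulrCA.
rewrite E.
have -> : y - c j.+1 (c' j.+1 y) =
    ((-1) ^+ j.+1 : R) *: (h j (res_d P j y) - res_d P j.+1 (h j.+1 y)).
  rewrite h_d opprD addrCA subrr addr0 scalerN scalerA -expr2 sqrr_sign scale1r.
  by rewrite opprB.
rewrite (eps_linear_scale _ _ phiL) (epsB _ _ phiL) phi_d subr0 eps_sign.
by [].
Qed.

(** To return from P to words, the homotopy between [c' c] and the identity of the bar resolution is
    added to the primitive psi; this is the cochain [Y]. *)
Lemma cochain_class_eq0 j u : is_cochain_cycle j u ->
  cochain_class j u = 0 <-> exists y, forall w, size w = j -> u w = cob y w.
Proof.
move=> u0; have uC := cochain_hom_cocycle u0; rewrite /cochain_class.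
split=> [/(sq_class_eq0 _ (uC : cocycles P j _)) ub|[y uy]].
  have [h [h_lin h0 h_d]] := bar_homotopy_res.
  have uL := eval_cochain_lin (i := j) u.
  have cE w : size w = j -> @cochain_hom j u (c j (word j w)) =
      u w + eval_cochain u (c' j (c j (word j w)) - word j w).
    move=> sw; rewrite -(eval_cochain_word u sw) (epsB _ _ uL) addrC subrK //.
  have ud f : eval_cochain u (bar_d j f) = 0.
    by rewrite eval_cochain_d eval_cochain0 ?oppr0.
  case: j u u0 uC ub uL cE ud => [|j] u u0 uC ub uL cE ud.
    exists (fun=> 0) => w sw; rewrite (size0nil sw).
    have := cE [::] erefl; rewrite -h0 ud addr0 => <-; exact: ub.
  have [psi [psiH psiE]] := ub.
  have psiL : eps_linear eps psi by apply/hom_eps_linear.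
  pose Y f := psi (c j f) + (-1) ^+ j.+1 * eval_cochain u (h j f).
  have YL : eps_linear eps Y.
    by move=> a x z; rewrite /Y c_lin h_lin psiL uL /=; ring.
  exists (fun s => - Y (word j s)) => w sw.
  rewrite (cobarN mu (fun s => Y (word j s) : K^o)).
  rewrite -(eval_cochain_word (cob (fun s => Y (word j s) : K^o)) sw).
  rewrite -eval_cochain_d -(bar_hom YL) /Y.
  have := cE w sw; rewrite psiE c_d => ->.
  have -> : c' j.+1 (c j.+1 (word j.+1 w)) - word j.+1 w =
     ((-1) ^+ j.+1 : R) *: (bar_d j.+1 (h j.+1 (word j.+1 w)) - h j (bar_d j (word j.+1 w))).
    by rewrite h_d addrK scalerA -expr2 sqrr_sign scale1r.
  rewrite (eps_linear_scale _ _ uL) (epsB _ _ uL) ud eps_sign.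
  by rewrite sub0r mulrN subrK.
apply/(sq_class_eq0 _ (uC : cocycles P j _)); case: j u u0 uC uy => [|j] u u0 uC uy.
  by move=> x; apply: eval_cochain0 => w sw; rewrite uy // (size0nil sw).
exists (fun x => - eval_cochain y (c' j x)); split=> [|x].
  apply/hom_eps_linear => a x z; rewrite c'_lin eval_cochain_lin /=; ring.
rewrite -c'_d eval_cochain_d opprK; exact: eval_cochain_ext.
Qed.

(** The chain map [c (slant v (c' _))] lifts the class of v. Followed by u it gives the
    concatenation of u and v, up to a coboundary that comes from the homotopy between [c' c] and the
    identity. *)
Lemma cochain_class_mul (B : algType K) (iota : forall j, {linear Ext P j -> B}) i j u v :
  is_yoneda_algebra iota -> is_cochain_cycle i u -> is_cochain_cycle j v ->
  iota i (cochain_class i u) * iota j (cochain_class j v) =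
  iota (i + j)%N (cochain_class (i + j) (conv i u v)).
Proof.
move=> B_def u0 v0.
have uL := eval_cochain_lin (i := i) u.
pose Psi k (x : P (k + j)%N) : P k := c k (slant v (c' (k + j)%N x)).
have Psi_lin k : linear (@Psi k).
  by move=> a x y; rewrite /Psi c'_lin slant_lin c_lin.
pose PsiL k : {linear P (k + j)%N -> P k} :=
  HB.pack (@Psi k) (GRing.isLinear.Build _ _ _ _ (@Psi k) (@Psi_lin k)).
have Psi_d k x : res_d P k (PsiL k.+1 x) = PsiL k (res_d P (k + j)%N x).
  by rewrite /= /Psi c_d slant_d // c'_d.
have Psi_eps x : res_eps (PsiL 0 x) = @cochain_hom j v x.
  rewrite /= /Psi c_eps /bar_eps (coef_tuple _ [tuple]) ffunE /=.
  rewrite (cz_eps_sum CZ); apply: eq_bigr => w _.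
  by rewrite (cz_epsZ CZ).
rewrite (yoneda_mul B_def (ChainLift Psi_d Psi_eps)
  (cochain_hom_cocycle u0) (cochain_hom_cocycle v0)); congr (iota _ _).
have uvC := cochain_hom_cocycle (conv_cycle u0 v0).
have [uH u_d] := cochain_hom_cocycle u0.
apply: sq_class_eq => //.
  split; last by move=> x; rewrite -Psi_d u_d.
  by apply/hom_eps_linear => a x y; rewrite linearP cochain_hom_lin.
have [h [h_lin h0 h_d]] := bar_homotopy_res.
have ud f : eval_cochain u (bar_d i f) = 0.
  by rewrite eval_cochain_d eval_cochain0 ?oppr0.
suff: coboundaries P (i + j) ((fun x => @cochain_hom i u (c i (slant v (c' (i + j)%N x))))
    - @cochain_hom (i + j) (conv i u v)) by [].
have E x : @cochain_hom i u (c i (slant v (c' (i + j)%N x))) =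
   eval_cochain u (c' i (c i (slant v (c' (i + j)%N x))) - slant v (c' (i + j)%N x))
   + @cochain_hom (i + j) (conv i u v) x.
  by rewrite /cochain_hom -eval_slant -(eps_linear_add _ _ uL) subrK.
case: i u u0 uL uvC uH u_d ud {Psi_eps Psi_d PsiL Psi_lin Psi} E =>
    [|i] u u0 uL uvC uH u_d ud E /=.
  rewrite (_ : _ - _ = 0); first exact: (Defs.subspace0 (coboundaries P _)).
  apply: funext => x; apply/eqP; rewrite subr_eq0; apply/eqP.
  by rewrite -[RHS]add0r E -h0 ud.
exists (fun y => - ((-1) ^+ i.+1 * eval_cochain u (h i (slant v (c' (i + j)%N y))))).
split=> [|x].
  by apply/hom_eps_linear => a x y; rewrite c'_lin slant_lin h_lin uL /=; ring.
apply/eqP; rewrite [_ == _]subr_eq; apply/eqP.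
rewrite E; congr (_ + _); set z := slant v _.
have -> : c' i.+1 (c i.+1 z) - z =
    ((-1) ^+ i.+1 : R) *: (bar_d i.+1 (h i.+1 z) - h i (bar_d i z)).
  by rewrite h_d addrK scalerA -expr2 sqrr_sign scale1r.
rewrite (eps_linear_scale _ _ uL) (epsB _ _ uL) ud eps_sign sub0r mulrN.
by rewrite /z slant_d // c'_d.
Qed.

End ExtCochains.

(** * The structure of B *)

Section LastLetter.
Variables (K : fieldType) (p q : nat) (mu : 'I_q -> 'I_p -> 'I_p -> K).
Local Notation L := ('I_p + 'I_q)%type.
Local Notation cob := (cobar mu).
Local Notation cochain := (seq L -> K^o).

Definition cut (x : L) (u : cochain) : cochain := fun s => u (rcons s x).

Definition glue_last (F : L -> cochain) : cochain :=
  fun s => if rev s is x :: r then F x (rev r) else 0.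

Lemma cut_glue_last F x : cut x (glue_last F) = F x.
Proof. by apply: funext => s; rewrite /cut /glue_last rev_rcons revK. Qed.

(* The terms of [cobar u] in which the last two letters, the last one being
   [inl j], are merged. *)
Definition merge_last (n : nat) (j : 'I_p) (F : 'I_q -> cochain) : cochain :=
  fun w => \sum_a \sum_i mu a i j * conv n (F a) (word_delta K [:: inl i]) w.

(** A last letter from W cannot be merged with its predecessor, so removing it commutes with the
    differential. *)
Lemma cobar_cut_inr u a w : cob u (rcons w (inr a)) = cob (cut (inr a) u) w.
Proof.
case/lastP: w => [//|w x]; rewrite cobar_rcons big1 ?scaler0 ?addr0 // => b _.
by rewrite (_ : letter_mul mu b x (inr a) = 0) ?scale0r //; case: x.
Qed.

Lemma conv_delta n (u : cochain) x w y : size w = n ->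
  conv n u (word_delta K [:: x]) (rcons w y) = (x == y)%:R * u w.
Proof.
move=> wn; rewrite /conv -cats1 take_size_cat // drop_size_cat //.
by rewrite /word_delta eqseq_cons andbT eq_sym.
Qed.

Lemma merge_last_rcons n j F w y : size w = n ->
  merge_last n j F (rcons w y) = \sum_a letter_mul mu a y (inl j) * F a w.
Proof.
move=> wn; apply: eq_bigr => a _.
under eq_bigr do rewrite conv_delta //.
case: y => [i|b]; last first.
  by rewrite [RHS]mul0r big1 // => i _; rewrite mul0r mulr0.
rewrite (bigD1 i) //= eqxx mul1r big1 ?addr0 // => i' /negPf ii.
by rewrite (inj_eq (@inl_inj _ _)) ii mul0r mulr0.
Qed.

Lemma cobar_cut_inl u j n w : size w = n.+1 ->
  cob u (rcons w (inl j)) = cob (cut (inl j) u) w +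
    (-1) ^+ n * merge_last n j (fun a => cut (inr a) u) w.
Proof.
case/lastP: w => [//|w x]; rewrite size_rcons => -[wn].
by rewrite cobar_rcons wn merge_last_rcons.
Qed.

Lemma cut_eq n (u v : cochain) :
  (forall x s, size s = n -> cut x u s = cut x v s) ->
  forall w, size w = n.+1 -> u w = v w.
Proof.
move=> uv w; case/lastP: w => [//|w x]; rewrite size_rcons => -[wn].
exact: uv.
Qed.

Lemma cut_conv_sum n (F : 'I_p -> cochain) x s : size s = n ->
  cut x (fun w => \sum_i conv n (F i) (word_delta K [:: inl i]) w) s =
  if x is inl i then F i s else 0.
Proof.
move=> sn; rewrite /cut; under eq_bigr do rewrite conv_delta //.
case: x => [i|b]; last by rewrite big1 // => i _; rewrite mul0r.
rewrite (bigD1 i) //= eqxx mul1r big1 ?addr0 // => i' /negPf ii.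
by rewrite (inj_eq (@inl_inj _ _)) ii mul0r.
Qed.

End LastLetter.

(** The properties of Ext on which the analysis of B rests: [cl] presents B, degree by degree, as
    the cohomology of the cobar complex with concatenation as product. *)
Record cohomology_model (K : fieldType) (p q : nat) (mu : 'I_q -> 'I_p -> 'I_p -> K)
    (B : algType K) (gr : nat -> B -> Prop)
    (cl : nat -> (seq ('I_p + 'I_q) -> K^o) -> B) : Prop := {
  model_indep : forall c : 'I_q -> K,
    (forall i j, \sum_a c a * mu a i j = 0) -> forall a, c a = 0;
  model_lin : forall j c u v, is_cochain_cycle mu j u -> is_cochain_cycle mu j v ->
    cl j (fun s => c *: u s + v s) = c *: cl j u + cl j v;
  model_gr : forall j u, gr j (cl j u);
  model_onto : forall j b, gr j b -> exists2 u, is_cochain_cycle mu j u & b = cl j u;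
  model_eq0 : forall j u, is_cochain_cycle mu j u ->
    cl j u = 0 <-> exists y, forall w, size w = j -> u w = cobar mu y w;
  model_mul : forall i j u v, is_cochain_cycle mu i u -> is_cochain_cycle mu j v ->
    cl i u * cl j v = cl (i + j)%N (conv i u v);
  model_span : forall b, exists N (f : nat -> B),
    (forall j, gr j (f j)) /\ b = \sum_(j < N) f j;
  model_direct : forall N (f : nat -> B), (forall j, gr j (f j)) ->
    \sum_(j < N) f j = 0 -> forall j, (j < N)%N -> f j = 0 }.

Section Structure.
Variables (K : fieldType) (p q : nat) (mu : 'I_q -> 'I_p -> 'I_p -> K).
Local Notation L := ('I_p + 'I_q)%type.
Local Notation cob := (cobar mu).
Local Notation cochain := (seq L -> K^o).
Local Notation cyc := (is_cochain_cycle mu).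
Variables (B : algType K) (gr : nat -> B -> Prop) (cl : nat -> cochain -> B).
Hypothesis CM : cohomology_model mu gr cl.
Local Notation cl_lin := (model_lin CM).
Local Notation cl_gr := (model_gr CM).
Local Notation cl_onto := (model_onto CM).
Local Notation cl_eq0 := (model_eq0 CM).
Local Notation cl_mul := (model_mul CM).
Local Notation gr_span := (model_span CM).
Local Notation gr_direct := (model_direct CM).

Lemma cycP j c u v : cyc j u -> cyc j v -> cyc j (fun s => c *: u s + v s).
Proof. by move=> u0 v0 w sw; rewrite cobarP u0 // v0 // scaler0 addr0. Qed.

Lemma cyc0 j : cyc j (fun=> 0).
Proof. by move=> w sw; apply: cobar0. Qed.

Lemma cyc_ext j u v : (forall w, size w = j -> u w = v w) -> cyc j u -> cyc j v.
Proof.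
move=> uv u0 w sw; rewrite -(u0 w sw); apply: cobar_ext => s; rewrite sw => -[sj].
by rewrite uv.
Qed.

Lemma cl0 j : cl j (fun=> 0) = 0.
Proof.
apply/cl_eq0; first exact: cyc0.
by exists (fun=> 0) => w sw; rewrite cobar0.
Qed.

Lemma cl_ext j u v : cyc j u -> (forall w, size w = j -> u w = v w) ->
  cl j u = cl j v.
Proof.
move=> u0 uv; have v0 := cyc_ext uv u0.
apply/eqP; rewrite eq_sym -subr_eq0 addrC -scaleN1r -cl_lin //; apply/eqP.
apply/cl_eq0; first exact: cycP.
by exists (fun=> 0) => w sw; rewrite cobar0 // uv // scaleN1r addNr.
Qed.

Lemma cl_cohomologous j u v y : cyc j u -> cyc j v ->
  (forall w, size w = j -> u w = v w + cob y w) -> cl j u = cl j v.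
Proof.
move=> u0 v0 uv; apply/eqP; rewrite -subr_eq0 addrC -scaleN1r -cl_lin //.
apply/eqP/cl_eq0; first exact: cycP.
by exists y => w sw; rewrite uv // scaleN1r addKr.
Qed.

Lemma clZ j c u : cyc j u -> cl j (fun s => c *: u s) = c *: cl j u.
Proof.
move=> u0; rewrite -[RHS]addr0 -(cl0 j) -cl_lin //; last exact: cyc0.
by congr cl; apply: funext => s; rewrite addr0.
Qed.

Lemma cycZ j c u : cyc j u -> cyc j (fun s => c *: u s).
Proof.
by move=> u0 w sw; rewrite cobarZ u0 // scaler0.
Qed.

Lemma cyc_sum j I (r : seq I) (u : I -> cochain) : (forall i, cyc j (u i)) ->
  cyc j (fun s => \sum_(i <- r) u i s).
Proof. by move=> u0 w sw; rewrite cobar_sum big1 // => i _; apply: u0. Qed.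

Lemma cl_sum j I (r : seq I) (u : I -> cochain) : (forall i, cyc j (u i)) ->
  cl j (fun s => \sum_(i <- r) u i s) = \sum_(i <- r) cl j (u i).
Proof.
move=> u0; elim: r => [|i r IH].
  by rewrite big_nil -(cl0 j); congr cl; apply: funext => s; rewrite big_nil.
rewrite big_cons -IH -[cl j (u i)]scale1r -cl_lin //; last exact: cyc_sum.
by congr cl; apply: funext => s; rewrite big_cons scale1r.
Qed.

Lemma gr0 j : gr j 0. Proof. by rewrite -(cl0 j); apply: cl_gr. Qed.

Lemma grP j c x y : gr j x -> gr j y -> gr j (c *: x + y).
Proof. by move=> /cl_onto[u u0 ->] /cl_onto[v v0 ->]; rewrite -cl_lin //; apply: cl_gr. Qed.

Lemma grZ j c x : gr j x -> gr j (c *: x).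
Proof. by move=> jx; rewrite -[_ *: _]addr0; apply/grP/gr0. Qed.

Lemma grD j x y : gr j x -> gr j y -> gr j (x + y).
Proof. by move=> jx jy; rewrite -[x]scale1r; apply: grP. Qed.

Lemma grB j x y : gr j x -> gr j y -> gr j (x - y).
Proof. by move=> jx jy; rewrite addrC -scaleN1r; apply: grP. Qed.

Lemma gr_sum j I (r : seq I) (P : pred I) (F : I -> B) :
  (forall i, P i -> gr j (F i)) -> gr j (\sum_(i <- r | P i) F i).
Proof. by move=> FP; elim/big_ind: _ => //; [exact: gr0 | exact: grD]. Qed.

Lemma grM i j x y : gr i x -> gr j y -> gr (i + j)%N (x * y).
Proof. by move=> /cl_onto[u u0 ->] /cl_onto[v v0 ->]; rewrite cl_mul //; apply: cl_gr. Qed.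

Lemma cyc_unit : cyc 0 (word_delta K [::]).
Proof. by move=> w sw; rewrite cobar_small ?sw. Qed.

Lemma cl_unit : cl 0 (word_delta K [::]) = 1.
Proof.
rewrite -[LHS]mulr1; have [N [f [fgr ->]]] := gr_span 1.
rewrite mulr_sumr; apply: eq_bigr => j _.
have [u u0 ->] := cl_onto (fgr j).
rewrite cl_mul //; last exact: cyc_unit.
symmetry; apply: cl_ext => // w sw.
by rewrite /conv take0 drop0 /word_delta eqxx [RHS]mulr1.
Qed.

Lemma gr1 : gr 0 1. Proof. by rewrite -cl_unit; apply: cl_gr. Qed.

Lemma cl_degree0 u : cyc 0 u -> cl 0 u = (u [::])%:A.
Proof.
move=> u0; rewrite -cl_unit -clZ; last exact: cyc_unit.
by apply: cl_ext => // w /size0nil ->; rewrite /word_delta eqxx [RHS]mulr1.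
Qed.

(** The operators on B are all obtained from operations on cochains in this way. Since the value at
    b is computed from chosen cocycles, even additivity requires the invariance under
    coboundaries. *)
Lemma linear_from_cochains (V : lmodType K) (Phi : nat -> cochain -> V) :
  (forall j c u v, cyc j u -> cyc j v ->
     Phi j (fun s => c *: u s + v s) = c *: Phi j u + Phi j v) ->
  (forall j u y, cyc j u -> (forall w, size w = j -> u w = cob y w) -> Phi j u = 0) ->
  exists F : B -> V, (forall c x y, F (c *: x + y) = c *: F x + F y) /\
    forall j u, cyc j u -> F (cl j u) = Phi j u.
Proof.
move=> PhiL Phi0.
have Phi00 j : Phi j (fun=> 0) = 0.
  by apply: (Phi0 _ _ (fun=> 0)) => [|w _]; [exact: cyc0 | rewrite cobar0].
pose rep b (Nu : nat * (nat -> cochain)) := (forall j, cyc j (Nu.2 j)) /\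
  b = \sum_(j < Nu.1) cl j (Nu.2 j).
have repP b : exists Nu, rep b Nu.
  have [N [f [fgr ->]]] := gr_span b.
  have /choice[u uP] : forall j, exists u, cyc j u /\ f j = cl j u.
    by move=> j; have [u u0 uE] := cl_onto (fgr j); exists u.
  exists (N, u); split=> [j|]; first by have [] := uP j.
  by apply: eq_bigr => j _; have [] := uP j.
(* Representatives of different lengths are extended by zero cochains to a common length, where
   directness of the grading compares them. *)
pose pad N (u : nat -> cochain) j : cochain := if (j < N)%N then u j else fun=> 0.
have pad_cyc N u : (forall j, cyc j (u j)) -> forall j, cyc j (pad N u j).
  by move=> u0 j; rewrite /pad; case: ifP => // _; apply: cyc0.
have padE (W : zmodType) (Psi : nat -> cochain -> W) N M (u : nat -> cochain) :
    (N <= M)%N ->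
    (forall j, Psi j (fun=> 0) = 0) ->
    \sum_(j < N) Psi j (u j) = \sum_(j < M) Psi j (pad N u j).
  move=> NM Psi0; rewrite (big_ord_widen M (fun j => Psi j (u j))) // big_mkcond.
  by apply: eq_bigr => j _; rewrite /pad; case: ifP.
have lin b b' c Nu Nu' Nu'' : rep b Nu -> rep b' Nu' -> rep (c *: b + b') Nu'' ->
    \sum_(j < Nu''.1) Phi j (Nu''.2 j) =
    c *: (\sum_(j < Nu.1) Phi j (Nu.2 j)) + \sum_(j < Nu'.1) Phi j (Nu'.2 j).
  case: Nu Nu' Nu'' => [N u] [N' u'] [N'' u''] [/= u0 bE] [/= u'0 b'E] [/= u''0 b''E].
  pose M := maxn N (maxn N' N'').
  have NM : (N <= M)%N by rewrite leq_maxl.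
  have N'M : (N' <= M)%N by rewrite leq_max leq_maxl orbT.
  have N''M : (N'' <= M)%N by rewrite !leq_max leqnn !orbT.
  rewrite (padE _ Phi _ _ _ NM) // (padE _ Phi _ _ _ N'M) // (padE _ Phi _ _ _ N''M) //.
  rewrite scaler_sumr -big_split; apply: eq_bigr => j _ /=.
  have c1 := pad_cyc N u u0; have c2 := pad_cyc N' u' u'0; have c3 := pad_cyc N'' u'' u''0.
  rewrite -PhiL //; apply/eqP; rewrite -subr_eq0 addrC -scaleN1r -PhiL //; last exact: cycP.
  pose z j s := -1 *: (c *: pad N u j s + pad N' u' j s) + pad N'' u'' j s.
  have z0 k : cyc k (z k) by apply: cycP => //; apply: cycP.
  have /cl_eq0 : cl j (z j) = 0.
    apply: (gr_direct (N := M) (f := fun j => cl j (z j))) => [k||//].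
      exact: cl_gr.
    have zE k : cl k (z k) = - (c *: cl k (pad N u k) + cl k (pad N' u' k)) +
        cl k (pad N'' u'' k).
      by rewrite /z cl_lin // ?scaleN1r ?cl_lin //; apply: cycP.
    under eq_bigr do rewrite zE.
    rewrite big_split /= sumrN big_split /= -scaler_sumr.
    rewrite -(padE _ cl _ _ _ NM cl0) -(padE _ cl _ _ _ N'M cl0).
    by rewrite -(padE _ cl _ _ _ N''M cl0) -bE -b'E -b''E addNr.
  by move=> /(_ (z0 j)) [y yE]; apply/eqP; apply: (Phi0 j _ y).
have [R RP] := choice repP.
exists (fun b => \sum_(j < (R b).1) Phi j ((R b).2 j)); split=> [c x y|j u u0].
  exact: (lin x y c).
have Rep : rep (cl j u) (j.+1, fun k => if k == j then u else fun=> 0).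
  split=> [k|] /=; first by case: eqP => [->//|_]; apply: cyc0.
  rewrite big_ord_recr /= eqxx big1 ?add0r // => k _.
  by rewrite ltn_eqF // cl0.
have Rep0 : rep 0 (0%N, fun=> fun=> 0) by split=> [k|]; [exact: cyc0 | rewrite big_ord0].
have := lin (cl j u) 0 1 _ _ _ Rep Rep0.
rewrite scale1r addr0 => /(_ _ (RP _)) ->.
rewrite /= big_ord0 addr0 scale1r big_ord_recr /= eqxx big1 ?add0r // => k _.
by rewrite ltn_eqF // Phi00.
Qed.

End Structure.

(** * Operators on B induced by operations on words *)

Section Operators.
Variables (K : fieldType) (p q : nat) (mu : 'I_q -> 'I_p -> 'I_p -> K).
Local Notation L := ('I_p + 'I_q)%type.
Local Notation cob := (cobar mu).
Local Notation cochain := (seq L -> K^o).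
Local Notation cyc := (is_cochain_cycle mu).
Variables (B : algType K) (gr : nat -> B -> Prop) (cl : nat -> cochain -> B).
Hypothesis CM : cohomology_model mu gr cl.

Lemma cl_ind (Q : B -> Prop) : (forall x y, Q x -> Q y -> Q (x + y)) ->
  (forall j u, cyc j u -> Q (cl j u)) -> forall b, Q b.
Proof.
move=> QD Qcl b; have [N [f [fgr ->]]] := model_span CM b.
elim/big_ind: _ => // [|j _].
  by rewrite -(cl0 CM 0); apply/Qcl/cyc0.
by have [u u0 ->] := model_onto CM (fgr j); apply: Qcl.
Qed.

Lemma cyc_cut_inr a j u : cyc j.+1 u -> cyc j (cut (inr a) u).
Proof. by move=> u0 w sw; rewrite -cobar_cut_inr u0 // size_rcons sw. Qed.

(* [lam a] below removes a last letter e_a with e_a in m^2. *)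
Lemma lam_exists a : exists F : B -> B, (forall c x y, F (c *: x + y) = c *: F x + F y) /\
  forall j u, cyc j u -> F (cl j u) = if j is j'.+1 then cl j' (cut (inr a) u) else 0.
Proof.
apply: (linear_from_cochains CM
  (Phi := fun j u => if j is j'.+1 then cl j' (cut (inr a) u) else 0)).
  case=> [|j] c u v u0 v0; first by rewrite scaler0 addr0.
  by rewrite -(model_lin CM) //; apply: cyc_cut_inr.
case=> [//|j] u y u0 uy; apply/(model_eq0 CM); first exact: cyc_cut_inr.
by exists (cut (inr a) y) => w sw; rewrite /cut uy ?size_rcons ?sw // cobar_cut_inr.
Qed.

Definition lam a : B -> B := projT1 (cid (lam_exists a)).

Lemma lamP a c x y : lam a (c *: x + y) = c *: lam a x + lam a y.
Proof. exact: (projT2 (cid (lam_exists a))).1. Qed.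

Lemma lam_clE a j u : cyc j u ->
  lam a (cl j u) = if j is j'.+1 then cl j' (cut (inr a) u) else 0.
Proof. exact: (projT2 (cid (lam_exists a))).2. Qed.

Lemma lam_cl a j u : cyc j.+1 u -> lam a (cl j.+1 u) = cl j (cut (inr a) u).
Proof. exact: lam_clE. Qed.

HB.instance Definition _ a :=
  GRing.isLinear.Build K B B *:%R (lam a) (lamP a).

Lemma lam_gr0 a b : gr 0 b -> lam a b = 0.
Proof. by case/(model_onto CM) => u u0 ->; rewrite lam_clE. Qed.

Lemma lam_gr a j b : gr j.+1 b -> gr j (lam a b).
Proof. by case/(model_onto CM) => u u0 ->; rewrite lam_cl //; apply: (model_gr CM). Qed.

Lemma eps_exists : exists F : B -> K^o, (forall c x y, F (c *: x + y) = c *: F x + F y) /\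
  forall j u, cyc j u -> F (cl j u) = if j is 0%N then u [::] else 0.
Proof.
apply: (linear_from_cochains CM (Phi := fun j u => if j is 0%N then u [::] else 0 : K^o)).
  by case=> [|j] c u v u0 v0 //; rewrite scaler0 addr0.
by case=> [|j] u y u0 uy //; rewrite uy.
Qed.

Definition epsB : B -> K^o := projT1 (cid eps_exists).

Lemma epsBP c x y : epsB (c *: x + y) = c *: epsB x + epsB y.
Proof. exact: (projT2 (cid (eps_exists))).1. Qed.

Lemma epsB_cl j u : cyc j u -> epsB (cl j u) = if j is 0%N then u [::] else 0.
Proof. exact: (projT2 (cid (eps_exists))).2. Qed.

HB.instance Definition _ :=
  GRing.isLinear.Build K B K^o *:%R epsB epsBP.

Lemma epsB1 : epsB 1 = 1.
Proof. by rewrite -(cl_unit CM) epsB_cl //; apply: cyc_unit. Qed.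

Lemma epsB_gr j b : gr j.+1 b -> epsB b = 0.
Proof. by case/(model_onto CM) => u u0 ->; rewrite epsB_cl. Qed.

Lemma gr_epsB b : gr 0 b -> b = (epsB b : K)%:A.
Proof. by case/(model_onto CM) => u u0 ->; rewrite epsB_cl // (cl_degree0 CM). Qed.

Lemma cut_conv a i j (u v : cochain) w : size w = (i + j)%N ->
  cut a (conv i u v) w = conv i u (cut a v) w.
Proof.
move=> sw; rewrite /cut /conv -cats1 take_cat drop_cat sw.
case: ltnP => [_|ij]; first by rewrite cats1.
have j0 : j = 0%N by apply/eqP; rewrite -leqn0 -(leq_add2l i) addn0.
have si : size w = i by rewrite sw j0 addn0.
by rewrite j0 addn0 subnn cats0 /= -si take_size drop_size.
Qed.

Lemma conv_degree0 i (u v : cochain) w : size w = i -> conv i u v w = v [::] *: u w.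
Proof. by move=> <-; rewrite /conv take_size drop_size. Qed.

(** The last letter of a concatenation is that of the second factor, unless this factor has degree 0
    and is a scalar. *)
Lemma lamM a x y : lam a (x * y) = x * lam a y + (epsB y : K) *: lam a x.
Proof.
elim/cl_ind: x => [x x' xP x'P|i u u0].
  by rewrite !mulrDl !linearD /= xP x'P addrACA.
elim/cl_ind: y => [y y' yP y'P|j v v0].
  by rewrite !mulrDr !linearD /= scalerDl mulrDr yP y'P addrACA.
rewrite (model_mul CM) //; have uv0 := conv_cycle u0 v0.
case: j v v0 uv0 => [|j] v v0 uv0.
  rewrite [in X in _ * X]lam_clE // mulr0 add0r epsB_cl // -linearZ /= -(clZ CM) //.
  rewrite addn0 in uv0 *; congr lam; apply: (cl_ext CM) => // w sw.
  exact: conv_degree0.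
rewrite epsB_cl // scale0r addr0 addnS in uv0 *.
rewrite !lam_cl // (model_mul CM) //; last exact: cyc_cut_inr.
by apply: (cl_ext CM); [exact: cyc_cut_inr | move=> w; apply: cut_conv].
Qed.

Lemma epsBM x y : epsB (x * y) = epsB x * epsB y.
Proof.
elim/cl_ind: x => [x x' xP x'P|i u u0].
  by rewrite mulrDl (linearD epsB (x * y)) (linearD epsB x) /= mulrDl xP x'P.
elim/cl_ind: y => [y y' yP y'P|j v v0].
  by rewrite mulrDr (linearD epsB (_ * y)) (linearD epsB y) /= mulrDr yP y'P.
rewrite (model_mul CM) // !epsB_cl //; last exact: conv_cycle.
case: i j u v {u0 v0} => [|i] [|j] u v; rewrite ?addnS ?addSn ?mulr0 ?mul0r //.
by rewrite /conv /= [LHS]mulrC.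
Qed.

Lemma epsB_alg c : epsB c%:A = c.
Proof. by rewrite linearZ /= epsB1 [_ *: _]mulr1. Qed.

Lemma epsB_pos b : positive_part gr (b - (epsB b : K)%:A).
Proof.
have [[|N] [f [fgr bE]]] := model_span CM b.
  exists 0%N, (fun=> 0); split=> [j|]; first exact: (gr0 CM).
  by rewrite big_ord0 bE big_ord0 linear0 scale0r subr0.
exists N, (fun j => f j.+1); split=> [j|]; first exact: fgr.
have -> : epsB b = epsB (f 0%N).
  rewrite bE big_ord_recl linearD /= linear_sum big1 ?addr0 // => j _.
  exact: (epsB_gr (fgr j.+1)).
by rewrite -(gr_epsB (fgr 0%N)) bE big_ord_recl addrC addKr.
Qed.

(** The differential reads only words of positive weight, so every cochain supported in weight 0 is
    a cocycle. *)
Lemma restr0_cyc j u : cyc j (restr (pred1 0%N) u).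
Proof. by move=> w sw; rewrite cobar_restr. Qed.

(* [proj] below keeps the words all of whose letters lie outside m^2; it is the
   projection of B onto A. *)
Lemma proj_exists : exists F : B -> B, (forall c x y, F (c *: x + y) = c *: F x + F y) /\
  forall j u, cyc j u -> F (cl j u) = cl j (restr (pred1 0%N) u).
Proof.
apply: (linear_from_cochains CM (Phi := fun j u => cl j (restr (pred1 0%N) u))).
  move=> j c u v u0 v0; rewrite -(model_lin CM); try exact: restr0_cyc.
  by congr cl; apply: funext => s; rewrite /restr; case: ifP; rewrite ?scaler0 ?addr0.
move=> j u y u0 uy; apply/(model_eq0 CM); first exact: restr0_cyc.
(* The part of weight 0 of a coboundary is the coboundary of the part of weight 1. *)
exists (restr (pred1 1%N) y) => w sw; rewrite cobar_restr /restr /=.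
by rewrite uy.
Qed.

Definition proj : B -> B := projT1 (cid proj_exists).

Lemma projP c x y : proj (c *: x + y) = c *: proj x + proj y.
Proof. exact: (projT2 (cid (proj_exists))).1. Qed.

Lemma proj_cl j u : cyc j u -> proj (cl j u) = cl j (restr (pred1 0%N) u).
Proof. exact: (projT2 (cid (proj_exists))).2. Qed.

HB.instance Definition _ := GRing.isLinear.Build K B B *:%R proj projP.

Lemma proj_gr j b : gr j b -> gr j (proj b).
Proof. by case/(model_onto CM) => u u0 ->; rewrite proj_cl //; apply: (model_gr CM). Qed.

Lemma projK b : proj (proj b) = proj b.
Proof.
elim/cl_ind: b => [x y xP yP|j u u0]; first by rewrite !linearD /= xP yP.
rewrite !proj_cl //; last exact: restr0_cyc.
by congr cl; apply: funext => s; rewrite /restr /=; case: eqP.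
Qed.

Lemma epsB_proj b : epsB (proj b) = epsB b.
Proof.
elim/cl_ind: b => [x y xP yP|j u u0]; first by rewrite !linearD /= xP yP.
by rewrite proj_cl // !epsB_cl //; last exact: restr0_cyc.
Qed.

Lemma projM x y : proj (x * y) = proj x * proj y.
Proof.
elim/cl_ind: x => [x x' xP x'P|i u u0].
  by rewrite mulrDl (linearD proj (x * y)) (linearD proj x) /= mulrDl xP x'P.
elim/cl_ind: y => [y y' yP y'P|j v v0].
  by rewrite mulrDr (linearD proj (_ * y)) (linearD proj y) /= mulrDr yP y'P.
rewrite (model_mul CM) // !proj_cl ?(model_mul CM) //; try exact: conv_cycle;
  try exact: restr0_cyc.
congr cl; apply: funext => s; rewrite /restr /conv /=.
rewrite -{1}(cat_take_drop i s) /weight count_cat addn_eq0.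
by case: eqP; case: eqP; rewrite ?scaler0 ?scale0r.
Qed.

Lemma proj1 : proj 1 = 1.
Proof.
rewrite -(cl_unit CM) proj_cl; last exact: cyc_unit.
by apply: (cl_ext CM) => [|w /size0nil ->]; first exact: restr0_cyc.
Qed.

Lemma lam_proj a b : lam a (proj b) = 0.
Proof.
elim/cl_ind: b => [x y xP yP|j u u0]; first by rewrite !linearD /= xP yP addr0.
rewrite proj_cl // lam_clE; last exact: restr0_cyc.
case: j u0 => // j u0; rewrite -[RHS](cl0 CM j); congr cl; apply: funext => s.
by rewrite /cut /restr /weight -cats1 count_cat /= addn1.
Qed.

Definition xx i : B := cl 1 (word_delta K [:: inl i]).

Lemma xx_cyc (i : 'I_p) : cyc 1 (word_delta K [:: inl i]).
Proof.
case=> [|y [|z [|]]] // _; rewrite cobar_cons cobar_small // subr0.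
by rewrite big1 // => a _; rewrite scaler0.
Qed.

Lemma xx_gr i : gr 1 (xx i). Proof. exact: (model_gr CM). Qed.

Lemma epsB_xx i : epsB (xx i) = 0. Proof. exact: epsB_gr (xx_gr i). Qed.

Lemma proj_xx i : proj (xx i) = xx i.
Proof.
rewrite proj_cl; last exact: xx_cyc.
congr cl; apply: funext => s; rewrite /restr /word_delta.
by case: ifP => // /negbT wn; case: eqP wn => // ->.
Qed.

(** The coordinate along x_i in degree 1, well defined because coboundaries vanish on one-letter
    words. It reads off the scalars in the proofs of minimality. *)
Lemma chi_exists i : exists F : B -> K^o, (forall c x y, F (c *: x + y) = c *: F x + F y) /\
  forall j u, cyc j u -> F (cl j u) = if j is 1%N then u [:: inl i] else 0.
Proof.
apply: (linear_from_cochains CM (Phi := fun j u => if j is 1%N then u [:: inl i] else 0 : K^o)).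
  by case=> [|[|j]] c u v u0 v0 //; rewrite scaler0 addr0.
by case=> [|[|j]] u y u0 uy //; rewrite uy.
Qed.

Definition chi i : B -> K^o := projT1 (cid (chi_exists i)).

Lemma chiP i c x y : chi i (c *: x + y) = c *: chi i x + chi i y.
Proof. exact: (projT2 (cid (chi_exists i))).1. Qed.

Lemma chi_cl i j u : cyc j u -> chi i (cl j u) = if j is 1%N then u [:: inl i] else 0.
Proof. exact: (projT2 (cid (chi_exists i))).2. Qed.

HB.instance Definition _ i := GRing.isLinear.Build K B K^o *:%R (chi i) (chiP i).

Lemma chiMxx i b i' : chi i (b * xx i') = epsB b * (i == i')%:R.
Proof.
elim/cl_ind: b => [x y xP yP|j u u0].
  by rewrite mulrDl (linearD (chi i) (x * _)) (linearD epsB x) /= mulrDl xP yP.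
have xc := @xx_cyc i'.
rewrite (model_mul CM) // chi_cl ?epsB_cl //; last exact: conv_cycle.
case: j u0 => [|j] _; last by rewrite addnS mul0r; case: j.
by rewrite [LHS]mulrC /word_delta /= eqseq_cons andbT.
Qed.

(* The sequence of left B-modules B^q -> B^p -> B_+ -> B^q -> B^p with maps [dB],
   [f |-> \sum_i f i * xx i], [lam] and [dB] is exact. *)
Definition dB (t : 'I_q -> B) (i' : 'I_p) : B :=
  \sum_a \sum_i mu a i i' *: (t a * xx i).

Lemma cl_merge j i' (F : 'I_q -> cochain) : (forall a, cyc j (F a)) ->
  cyc j.+1 (merge_last mu j i' F) /\ cl j.+1 (merge_last mu j i' F) = dB (fun a => cl j (F a)) i'.
Proof.
move=> F0.
have C a i : cyc j.+1 (conv j (F a) (word_delta K [:: inl i])).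
  by rewrite -addn1; apply: conv_cycle => //; apply: xx_cyc.
pose G a i : cochain := fun s => mu a i i' *: conv j (F a) (word_delta K [:: inl i]) s.
have G0 a i : cyc j.+1 (G a i) by apply: cycZ.
have G1 a : cyc j.+1 (fun s => \sum_i G a i s) by exact: (@cyc_sum _ _ _ _ _ _ _ (G a)).
split; first exact: (@cyc_sum _ _ _ _ _ _ _ (fun a s => \sum_i G a i s)).
rewrite [LHS](@cl_sum _ _ _ _ _ _ _ CM _ _ _ (fun a s => \sum_i G a i s)) //.
apply: eq_bigr => a _; rewrite (@cl_sum _ _ _ _ _ _ _ CM _ _ _ (G a)) //.
apply: eq_bigr => i _; rewrite (clZ CM) // -addn1 -(model_mul CM) //.
exact: xx_cyc.
Qed.

Lemma dBE (t : 'I_q -> B) i' : dB t i' = \sum_a \sum_i mu a i i' *: (t a * xx i).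
Proof. by []. Qed.

Lemma dB_linear c (t t' : 'I_q -> B) i :
  dB (fun a => c *: t a + t' a) i = c *: dB t i + dB t' i.
Proof.
rewrite /dB scaler_sumr -big_split; apply: eq_bigr => a _ /=.
rewrite scaler_sumr -big_split; apply: eq_bigr => i' _ /=.
by rewrite mulrDl scalerDr -scalerAl !scalerA mulrC.
Qed.

Lemma dB_mull b (t : 'I_q -> B) i : dB (fun a => b * t a) i = b * dB t i.
Proof.
rewrite /dB mulr_sumr; apply: eq_bigr => a _.
rewrite mulr_sumr; apply: eq_bigr => i' _.
by rewrite -mulrA scalerAr.
Qed.

Lemma proj_dB (t : 'I_q -> B) i : proj (dB t i) = dB (fun a => proj (t a)) i.
Proof.
rewrite /dB linear_sum; apply: eq_bigr => a _; rewrite linear_sum.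
by apply: eq_bigr => i' _; rewrite linearZ /= projM proj_xx.
Qed.

Lemma dB_gr j t i : (forall a, gr j (t a)) -> gr j.+1 (dB t i).
Proof.
move=> jt; apply: (gr_sum CM) => a _; apply: (gr_sum CM) => i' _.
by apply: (grZ CM); rewrite -addn1; apply: (grM CM) => //; apply: xx_gr.
Qed.

(** The cocycle equation on words ending in a letter of V exhibits the merge term, whose class is
    [dB], as a coboundary. *)
Lemma dB_lam b i : dB (fun a => lam a b) i = 0.
Proof.
elim/cl_ind: b => [x y xP yP|[|j] u u0].
- rewrite -[RHS]addr0 -{1}xP -yP -[dB (fun a => lam a x) i]scale1r -dB_linear.
  by congr (dB _ i); apply: funext => a; rewrite scale1r linearD.
- by rewrite /dB big1 // => a _; rewrite big1 // => i' _; rewrite lam_clE // mul0r scaler0.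
have C a := @cyc_cut_inr a _ _ u0.
have [m0 mE] := cl_merge i C.
have -> : (fun a => lam a (cl j.+1 u)) = (fun a => cl j (cut (inr a) u)).
  by apply: funext => a; rewrite lam_cl.
rewrite -mE; apply/(model_eq0 CM) => //.
exists (fun s => - (-1) ^+ j *: cut (inl i) u s) => w sw.
rewrite (cobarZ mu (- (-1) ^+ j) (cut (inl i) u)).
have := cobar_cut_inl mu u i sw; rewrite u0 ?size_rcons ?sw // => /eqP.
rewrite eq_sym addr_eq0 => /eqP ->.
by rewrite scalerN scaleNr opprK [RHS]mulrA -expr2 sqrr_sign mul1r.
Qed.

Lemma xx_relation a : \sum_i' (\sum_i mu a i i' *: xx i) * xx i' = 0.
Proof.
pose G i' i : cochain := fun s =>
  mu a i i' *: conv 1 (word_delta K [:: inl i]) (word_delta K [:: inl i']) s.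
have G0 i' i : cyc 2 (G i' i).
  by apply: cycZ; apply: (conv_cycle (@xx_cyc i) (@xx_cyc i')).
have G1 i' : cyc 2 (fun s => \sum_i G i' i s) by exact: (@cyc_sum _ _ _ _ _ _ _ (G i')).
have -> : \sum_i' (\sum_i mu a i i' *: xx i) * xx i' = cl 2 (fun s => \sum_i' \sum_i G i' i s).
  rewrite (@cl_sum _ _ _ _ _ _ _ CM _ _ _ (fun i' s => \sum_i G i' i s)) //.
  apply: eq_bigr => i' _; rewrite (@cl_sum _ _ _ _ _ _ _ CM _ _ _ (G i')) // mulr_suml.
  apply: eq_bigr => i _; rewrite (clZ CM); last exact: (conv_cycle (@xx_cyc i) (@xx_cyc i')).
  by rewrite -scalerAl (model_mul CM (@xx_cyc i) (@xx_cyc i')).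
apply/(model_eq0 CM); first exact: (@cyc_sum _ _ _ _ _ _ _ (fun i' s => \sum_i G i' i s)).
exists (word_delta K [:: inr a]) => -[|y [|z [|]]] // _.
rewrite cobar_cons cobar_small // subr0; symmetry.
rewrite (bigD1 a) //= big1 ?addr0 => [|b /negPf ba]; last first.
  by rewrite /word_delta eqseq_cons andbT (inj_eq (@inr_inj _ _)) ba scaler0.
rewrite {1}/word_delta eqxx [LHS]mulr1; symmetry.
case: y => [i|b]; last first.
  by rewrite big1 // => i' _; rewrite big1 // => i _; rewrite /G /conv /word_delta /= !scaler0.
case: z => [i'|b]; last first.
  by rewrite big1 // => i' _; rewrite big1 // => i'' _;
    rewrite /G /conv /word_delta /= scale0r scaler0.
rewrite (bigD1 i') //= [X in _ + X]big1 ?addr0 => [|k /negPf ki]; last first.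
  rewrite big1 // => l _; rewrite /G /conv /word_delta /= eqseq_cons andbT.
  by rewrite (inj_eq (@inl_inj _ _)) eq_sym ki scale0r scaler0.
rewrite (bigD1 i) //= [X in _ + X]big1 ?addr0 => [|k /negPf ki]; last first.
  rewrite /G /conv /word_delta /= (eqseq_cons (inl i)) andbT.
  by rewrite (inj_eq (@inl_inj _ _)) eq_sym ki !scaler0.
by rewrite /G /conv /word_delta /= !eqxx scale1r [LHS]mulr1.
Qed.

(** If the cuts at letters from W are coboundaries, gluing their primitives gives a cochain whose
    coboundary removes them from u. What remains is supported on words ending in V, and its cuts are
    cocycles since the merge term has disappeared. *)
Lemma lam_ker j b : gr j.+1 b -> (forall a, lam a b = 0) ->
  exists2 f : 'I_p -> B, (forall i, gr j (f i)) & b = \sum_i f i * xx i.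
Proof.
case/(model_onto CM) => u u0 -> lam0.
have /choice[y yE] a : exists y, forall w, size w = j -> cut (inr a) u w = cob y w.
  by apply/(model_eq0 CM); [exact: cyc_cut_inr | rewrite -lam_cl].
pose g := glue_last (fun x => if x is inr a then y a else fun=> 0).
pose u' : cochain := fun s => u s - cob g s.
have u'0 : cyc j.+1 u'.
  move=> w sw; rewrite (cobarD mu u (fun s => - cob g s)) u0 // add0r.
  by rewrite (cobarN mu (cob g)) cobarK oppr0.
have cut0 a w : size w = j -> cut (inr a) u' w = 0.
  move=> sw; rewrite /u' {1}/cut cobar_cut_inr cut_glue_last -yE //.
  by rewrite /cut subrr.
pose v i := cut (inl i) u'.
have v0 i : cyc j (v i).
  move=> w sw; have := cobar_cut_inl mu u' i sw.
  rewrite u'0 ?size_rcons ?sw // => /esym/eqP; rewrite addr_eq0 => /eqP ->.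
  rewrite (_ : merge_last mu _ _ _ _ = 0) ?mulr0 ?oppr0 //.
  rewrite /merge_last big1 // => a _; rewrite big1 // => i' _.
  by rewrite /conv cut0 ?scaler0 ?mulr0 // size_take sw leqnn.
pose G i : cochain := conv j (v i) (word_delta K [:: inl i]).
have G0 i : cyc j.+1 (G i) by rewrite -addn1; apply: conv_cycle => //; apply: xx_cyc.
exists (fun i => cl j (v i)) => [i|]; first exact: (model_gr CM).
have -> : cl j.+1 u = cl j.+1 u'.
  by apply: (cl_cohomologous CM (y := g)) => // w _; rewrite /u' subrK.
rewrite (cl_ext CM (v := fun s => \sum_i G i s) u'0); last first.
  apply: cut_eq => x s ss; rewrite (cut_conv_sum v) //.
  by case: x => [//|a]; apply: cut0.
rewrite (@cl_sum _ _ _ _ _ _ _ CM _ _ _ G) //; apply: eq_bigr => i _.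
by rewrite (model_mul CM) ?addn1 //; apply: xx_cyc.
Qed.

(** Let the sum be represented by the coboundary of y. On words ending in W this says that the cuts
    of y are cocycles; on words ending in V it says that f i is, up to sign and a coboundary, their
    merge. Degree 0 is separate, as there is no coboundary on one-letter words. *)
Lemma xx_syzygy j (f : 'I_p -> B) : (forall i, gr j (f i)) -> \sum_i f i * xx i = 0 ->
  if j is j'.+1 then exists2 t : 'I_q -> B, (forall a, gr j' (t a)) & forall i, f i = dB t i
  else forall i, f i = 0.
Proof.
move=> jf; have /choice[u uP] : forall i, exists u, cyc j u /\ f i = cl j u.
  by move=> i; have [u u0 uE] := model_onto CM (jf i); exists u.
have u0 i := (uP i).1; have fE i := (uP i).2.
pose G i : cochain := conv j (u i) (word_delta K [:: inl i]).
have G0 i : cyc j.+1 (G i) by rewrite -addn1; apply: conv_cycle => //; apply: xx_cyc.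
have -> : \sum_i f i * xx i = cl j.+1 (fun s => \sum_i G i s).
  rewrite (@cl_sum _ _ _ _ _ _ _ CM _ _ _ G) //; apply: eq_bigr => i _.
  by rewrite fE (model_mul CM) ?addn1 //; apply: xx_cyc.
case/(model_eq0 CM) => [|y yE]; first exact: (@cyc_sum _ _ _ _ _ _ _ G).
have cutE x s : size s = j -> (if x is inl i then u i s else 0) = cob y (rcons s x).
  by move=> ss; rewrite -yE ?size_rcons ?ss // -(cut_conv_sum u x ss).
case: j jf u0 {uP} fE G G0 yE cutE => [|j] jf u0 fE G G0 yE cutE.
  move=> i; rewrite fE (cl_degree0 CM) //.
  by rewrite (cutE (inl i) [::]) // cobar_small // scale0r.
pose z a := cut (inr a) y.
have z0 a : cyc j (z a) by move=> w sw; rewrite -cobar_cut_inr -cutE.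
exists (fun a => (-1) ^+ j *: cl j (z a)) => [a|i].
  exact/(grZ CM)/(model_gr CM).
have [m0 mE] := cl_merge i z0.
have -> : (fun a => (-1) ^+ j *: cl j (z a)) = (fun a => (-1) ^+ j *: cl j (z a) + 0 * 0).
  by apply: funext => a; rewrite mul0r addr0.
rewrite dB_linear -mE -(clZ CM) // dB_mull mul0r addr0 fE.
apply: (cl_cohomologous CM (y := cut (inl i) y)) => //; first exact: cycZ.
by move=> w sw; rewrite (cutE (inl i)) // (cobar_cut_inl mu y i sw) addrC.
Qed.

(** On words ending in W the cocycle is prescribed by t; on words ending in V it has to compensate
    the merge term, whose class [dB t] is zero. *)
Lemma lam_onto j (t : 'I_q -> B) : (forall a, gr j (t a)) -> (forall i, dB t i = 0) ->
  exists2 b, gr j.+1 b & forall a, lam a b = t a.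
Proof.
move=> jt t0; have /choice[u uP] : forall a, exists u, cyc j u /\ t a = cl j u.
  by move=> a; have [u u0 uE] := model_onto CM (jt a); exists u.
have u0 a := (uP a).1; have tE : t = fun a => cl j (u a).
  by apply: funext => a; have [] := uP a.
have /choice[y yE] i : exists y, forall w, size w = j.+1 -> merge_last mu j i u w = cob y w.
  have [m0 mE] := cl_merge i u0.
  by apply/(model_eq0 CM) => //; rewrite mE -tE.
pose v := glue_last (fun x => if x is inr a then u a else
  if x is inl i then fun s => - (-1) ^+ j *: y i s else fun=> 0).
have v0 : cyc j.+1 v.
  move=> w; case/lastP: w => [//|w x]; rewrite size_rcons => -[sw].
  case: x => [i|a]; last by rewrite cobar_cut_inr cut_glue_last u0.
  rewrite (cobar_cut_inl mu v i sw) cut_glue_last (cobarZ mu _ (y i)) -yE //.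
  have -> : (fun a => cut (inr a) v) = u by apply: funext => a; rewrite cut_glue_last.
  by rewrite scaleNr addNr.
exists (cl j.+1 v) => [|a]; first exact: (model_gr CM).
by rewrite lam_cl // cut_glue_last tE.
Qed.

(** The values of a 1-cocycle on the letters from W satisfy the equations of [model_indep] and
    vanish. *)
Lemma proj_gr1 b : gr 1 b -> proj b = b.
Proof.
case/(model_onto CM) => u u0 ->; rewrite proj_cl //; symmetry; apply: (cl_ext CM) => //.
case=> [|[i|a] [|]] // _; rewrite /restr //=; move: a.
apply: (model_indep CM (c := fun a => u [:: inr a])) => i j.
have := u0 [:: inl i; inl j] erefl.
rewrite cobar_cons cobar_small // subr0 => {2}<-.
by apply: eq_bigr => c _; rewrite [LHS]mulrC.
Qed.

Lemma proj_gr0 b : gr 0 b -> proj b = b.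
Proof. by move=> /gr_epsB ->; rewrite linearZ /= proj1. Qed.

(** [lam] vanishes on the image of [proj], so [lam_ker] expresses its elements through the x_i with
    coefficients of smaller degree; applying [proj] again keeps the coefficients in the image. *)
Lemma proj_generated b : generated_subalgebra (gr 1) b <-> proj b = b.
Proof.
split=> [gb|<- S [S1 SP SM] Sg].
  apply: (gb (fun x => proj x = x)) => [|g]; last exact: proj_gr1.
  split=> [|c x y xE yE|x y xE yE]; [exact: proj1 | by rewrite projP xE yE |].
  by rewrite projM xE yE.
have S0 : S 0 by rewrite -(addNr 1) -scaleN1r; apply: SP.
have SD x y : S x -> S y -> S (x + y) by move=> Sx Sy; rewrite -[x]scale1r; apply: SP.
have Sgr j : forall x, gr j x -> S (proj x).
  elim: j => [|j IH] x jx.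
    by rewrite proj_gr0 // (gr_epsB jx) -[_%:A]addr0; apply: SP.
  rewrite -projK; have [f jf ->] := lam_ker (proj_gr jx) (fun a => lam_proj a x).
  rewrite linear_sum; elim/big_ind: _ => // i _.
  by rewrite /= projM proj_xx; apply: SM; [apply: IH | apply/Sg/xx_gr].
have [N [f [fgr ->]]] := model_span CM b.
by rewrite linear_sum; elim/big_ind: _ => // j _; apply: (Sgr j).
Qed.

End Operators.

(** * Freeness of the kernel of B -> A *)

Lemma big_pairs (V : nmodType) (k : nat -> nat) e (s : seq (nat * nat)) (F : nat * nat -> V) :
  uniq s -> all (fun t => t.2 < k t.1)%N s ->
  \sum_(t <- s | (t.1 < e)%N) F t =
  \sum_(j < e) \sum_(i < k j) (if (j : nat, i : nat) \in s then F (j : nat, i : nat) else 0).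
Proof.
elim: s => [_ _|t s IH /= /andP[ts us] /andP[tk sk]].
  by rewrite big_nil big1 // => j _; rewrite big1.
rewrite big_cons.
have -> : \sum_(j < e) \sum_(i < k j)
    (if (j : nat, i : nat) \in t :: s then F (j : nat, i : nat) else 0) =
  \sum_(j < e) \sum_(i < k j) (if (j : nat, i : nat) == t then F t else 0) +
  \sum_(t <- s | (t.1 < e)%N) F t.
  rewrite IH // -big_split; apply: eq_bigr => j _ /=; rewrite -big_split.
  apply: eq_bigr => i _ /=; rewrite inE; case: eqP => [->|_] /=; last by rewrite add0r.
  by rewrite (negPf ts) addr0.
have neq (j i : nat) : j != t.1 -> (j, i) == t = false.
  by move=> /negPf jt; apply/eqP => E; rewrite -E eqxx in jt.
case: ifP => te; last first.
  rewrite [X in _ = X + _]big1 ?add0r // => j _; rewrite big1 // => i _; rewrite neq //.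
  by apply: contraFneq te => <-.
congr (_ + _); rewrite (bigD1 (Ordinal te)) //= [X in _ + X]big1 => [|j jt]; last first.
  by rewrite big1 // => i _; rewrite neq.
rewrite addr0 (bigD1 (Ordinal tk)) //= -surjective_pairing eqxx big1 ?addr0 // => i it.
by case: eqP => // /(congr1 snd) E; case/negP: it; apply/eqP/val_inj.
Qed.

Section Freeness.
Variables (K : fieldType) (p q : nat) (mu : 'I_q -> 'I_p -> 'I_p -> K).
Local Notation L := ('I_p + 'I_q)%type.
Local Notation cochain := (seq L -> K^o).
Local Notation cyc := (is_cochain_cycle mu).
Variables (B : algType K) (gr : nat -> B -> Prop) (cl : nat -> cochain -> B).
Hypothesis CM : cohomology_model mu gr cl.
Local Notation lam := (lam CM).
Local Notation proj := (proj CM).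
Local Notation epsB := (epsB CM).
Local Notation xx := (xx cl).
Local Notation dB := (dB mu cl).

Lemma hcomp_exists (e : nat) : exists F : B -> B, (forall c x y, F (c *: x + y) = c *: F x + F y) /\
  forall j u, cyc j u -> F (cl j u) = if j == e then cl j u else 0.
Proof.
apply: (linear_from_cochains CM (Phi := fun j u => if j == e then cl j u else 0)).
  move=> j c u v u0 v0; case: ifP => _; last by rewrite scaler0 addr0.
  exact: (model_lin CM).
by move=> j u y u0 uy; case: ifP => // _; apply/(model_eq0 CM) => //; exists y.
Qed.

Definition hcomp e : B -> B := projT1 (cid (hcomp_exists e)).

Lemma hcompP e c x y : hcomp e (c *: x + y) = c *: hcomp e x + hcomp e y.
Proof. exact: (projT2 (cid (hcomp_exists e))).1. Qed.

Lemma hcomp_cl e j u : cyc j u -> hcomp e (cl j u) = if j == e then cl j u else 0.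
Proof. exact: (projT2 (cid (hcomp_exists e))).2. Qed.

HB.instance Definition _ e := GRing.isLinear.Build K B B *:%R (hcomp e) (hcompP e).

Lemma hcomp_id e b : gr e b -> hcomp e b = b.
Proof. by case/(model_onto CM) => u u0 ->; rewrite hcomp_cl // eqxx. Qed.

Lemma hcomp_neq e j b : gr j b -> j != e -> hcomp e b = 0.
Proof. by case/(model_onto CM) => u u0 -> /negPf je; rewrite hcomp_cl // je. Qed.

Lemma hcomp_gr e b : gr e (hcomp e b).
Proof.
elim/(cl_ind CM): b => [x y xP yP|j u u0]; first by rewrite linearD; apply: (grD CM).
rewrite hcomp_cl //; case: eqP => [->|_]; [exact: (model_gr CM) | exact: (gr0 CM)].
Qed.

Lemma hcomp_sum b : exists N, b = \sum_(j < N) hcomp j b.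
Proof.
have [N [f [fgr bE]]] := model_span CM b; exists N; rewrite {1}bE.
apply: eq_bigr => j _; rewrite bE linear_sum (bigD1 j) //= hcomp_id //.
rewrite big1 ?addr0 // => i ij; exact: (hcomp_neq (fgr i)).
Qed.

Lemma hcomp_proj e b : hcomp e (proj b) = proj (hcomp e b).
Proof.
elim/(cl_ind CM): b => [x y xP yP|j u u0]; first by rewrite !linearD /= xP yP.
rewrite proj_cl // !hcomp_cl //; last exact: restr0_cyc.
by case: eqP => _; rewrite ?linear0 // proj_cl.
Qed.

Lemma hcompM e j x b : gr j x ->
  hcomp e (x * b) = if (j <= e)%N then x * hcomp (e - j) b else 0.
Proof.
move=> jx; elim/(cl_ind CM): b => [y z yP zP|i u u0].
  by rewrite mulrDr !linearD /= yP zP; case: ifP => _; rewrite ?addr0 // mulrDr.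
have ju : gr (j + i)%N (x * cl i u) by apply: (grM CM) => //; apply: (model_gr CM).
case: leqP => [je|ej].
  rewrite (hcomp_cl (e - j)) //; case: eqP => [iE|ie].
    by rewrite iE subnKC // in ju *; apply: hcomp_id.
  rewrite mulr0; apply: (hcomp_neq ju); apply/eqP => E; apply: ie.
  by rewrite -E addKn.
by apply: (hcomp_neq ju); rewrite gtn_eqF // ltn_addr.
Qed.

(* The part of degree j of the kernel of A^q -> A^p, where A is identified with
   the image of [proj]. *)
Definition relations j (t : 'I_q -> B) : Prop :=
  [/\ forall a, gr j (t a), forall a, proj (t a) = t a & forall i, dB t i = 0].

(** In degree j the image of [proj] is spanned by the classes of the finitely many words of length
    j. *)
Lemma relations_basis j : exists l : seq ('I_q -> B),
  [/\ {in l, forall t, relations j t}, lfree l & forall t, relations j t -> lspan l t].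
Proof.
pose g (aw : 'I_q * j.-tuple L) : 'I_q -> B := fun a =>
  if a == aw.1 then cl j (restr (pred1 0%N) (word_delta K aw.2)) else 0.
have [|||l [lU lF lS]] := @basis_extension K ('I_q -> B) (map g (enum {: 'I_q * j.-tuple L}))
  (relations j) [::]; [|by []|by []|by exists l].
move=> t [jt pt _].
have /choice[u uP] a : exists u, cyc j u /\ t a = cl j u.
  by have [u u0 uE] := model_onto CM (jt a); exists u.
pose U a (w : j.-tuple L) : cochain :=
  fun s => (u a w : K) *: restr (pred1 0%N) (word_delta K w) s.
suff -> : t = \sum_(aw <- enum {: 'I_q * j.-tuple L}) (u aw.1 aw.2 : K) *: g aw.
  exact: lspan_sum.
apply: funext => a; rewrite fct_sumE big_enum /=.
rewrite -(pair_bigA _ (fun b (w : j.-tuple L) => ((u b w : K) *: g (b, w)) a)) /=.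
rewrite (bigD1 a) //= [X in _ + X]big1 ?addr0 => [|b /negPf ba]; last first.
  by rewrite big1 // => w _; rewrite -[LHS]/(_ *: g (b, w) a) /g /= eq_sym ba scaler0.
have U0 w : cyc j (U a w) by apply: cycZ; apply: restr0_cyc.
transitivity (cl j (fun s => \sum_w U a w s)); last first.
  rewrite (@cl_sum _ _ _ _ _ _ _ CM _ _ _ (U a)) //; apply: eq_bigr => w _.
  rewrite (clZ CM); last exact: restr0_cyc.
  by rewrite -[RHS]/(_ *: g (a, w) a) /g /= eqxx.
have [u0 uE] := uP a; rewrite -pt uE proj_cl //.
apply: (cl_ext CM) => [|w /eqP sw]; first exact: restr0_cyc.
rewrite (bigD1 (Tuple sw)) //= big1 ?addr0 => [|v /eqP vw].
  by rewrite /U /restr /word_delta eqxx /=; case: eqP => _; rewrite ?scaler0 // [RHS]mulr1.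
rewrite /U /restr /word_delta; case: ifP => _; last by rewrite scaler0.
by case: eqP => [E|_]; [case: vw; apply: val_inj | rewrite scaler0].
Qed.

(** [lam_onto] realises each basis relation, and subtracting [proj b] moves the lift into the kernel
    without changing [lam]. *)
Lemma nn_exists : exists (l : nat -> seq ('I_q -> B)) (nn : nat -> nat -> B),
  (forall j, [/\ {in l j, forall t, relations j t}, lfree (l j)
     & forall t, relations j t -> lspan (l j) t]) /\
  forall j i, [/\ gr j.+1 (nn j i), proj (nn j i) = 0
     & forall a, lam a (nn j i) = (l j)`_i a].
Proof.
have [l lP] := choice relations_basis.
have lR j i : relations j (l j)`_i.
  have [il|il] := ltnP i (size (l j)); first by have [+ _ _] := lP j; apply; apply: mem_nth.
  rewrite nth_default //; split=> [a|a|i']; [exact: (gr0 CM) | exact: linear0 |].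
  have := dB_lam CM 0 i'; congr (dB _ i' = 0); apply: funext => a; exact: linear0.
have /choice[nn nnP] (ji : nat * nat) : exists n, [/\ gr ji.1.+1 n, proj n = 0
    & forall a, lam a n = (l ji.1)`_(ji.2) a].
  case: ji => j i /=; have [jt _ t0] := lR j i.
  have [b bj bE] := lam_onto CM jt t0; exists (b - proj b).
  split; first by apply: (grB CM) => //; apply: proj_gr.
    by rewrite linearB /= projK subrr.
  by move=> a; rewrite linearB /= lam_proj subr0 bE.
by exists l, (fun j i => nn (j, i)); split=> // j i; apply: (nnP (j, i)).
Qed.

Section Generators.
Variables (l : nat -> seq ('I_q -> B)) (nn : nat -> nat -> B).
Hypothesis lU : forall j, {in l j, forall t, relations j t}.
Hypothesis lF : forall j, lfree (l j).
Hypothesis lS : forall j t, relations j t -> lspan (l j) t.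
Hypothesis nn_gr : forall j i, gr j.+1 (nn j i).
Hypothesis nn_proj : forall j i, proj (nn j i) = 0.
Hypothesis nn_lam : forall j i a, lam a (nn j i) = (l j)`_i a.
Local Notation k j := (size (l j)).

Definition nsum e (b : nat -> nat -> B) : B := \sum_(j < e) \sum_(i < k j) nn j i * b j i.

(* The coefficients which occur in a homogeneous [nsum e b] of degree e. *)
Definition nfam e (b : nat -> nat -> B) : Prop := forall j i, gr (e - j.+1)%N (b j i).

Lemma nsumP e c b b' :
  nsum e (fun j i => c *: b j i + b' j i) = c *: nsum e b + nsum e b'.
Proof.
rewrite /nsum scaler_sumr -big_split; apply: eq_bigr => j _ /=.
rewrite scaler_sumr -big_split; apply: eq_bigr => i _ /=.
by rewrite mulrDr scalerAr.
Qed.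

Lemma nsum_ext e b b' : (forall j i, (j < e)%N -> (i < k j)%N -> b j i = b' j i) ->
  nsum e b = nsum e b'.
Proof. by move=> bb'; apply: eq_bigr => j _; apply: eq_bigr => i _; rewrite bb'. Qed.

Lemma nsum0 e b : (forall j i, (j < e)%N -> (i < k j)%N -> b j i = 0) -> nsum e b = 0.
Proof. by move=> b0; rewrite /nsum big1 // => j _; rewrite big1 // => i _; rewrite b0 ?mulr0. Qed.

Lemma nsum_sum e I (r : seq I) (b : I -> nat -> nat -> B) :
  nsum e (fun j i => \sum_(m <- r) b m j i) = \sum_(m <- r) nsum e (b m).
Proof.
rewrite /nsum exchange_big; apply: eq_bigr => j _ /=.
by rewrite exchange_big; apply: eq_bigr => i _; rewrite mulr_sumr.
Qed.

Lemma nsum_mulr e b x : nsum e (fun j i => b j i * x) = nsum e b * x.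
Proof.
rewrite /nsum mulr_suml; apply: eq_bigr => j _; rewrite mulr_suml.
by apply: eq_bigr => i _; rewrite mulrA.
Qed.

Lemma nsum_recr e b : nsum e.+1 b = nsum e b + \sum_(i < k e) nn e i * b e i.
Proof. by rewrite /nsum big_ord_recr. Qed.

Lemma nsum_proj e b : proj (nsum e b) = 0.
Proof.
rewrite linear_sum big1 // => j _; rewrite linear_sum big1 // => i _.
by rewrite /= projM nn_proj mul0r.
Qed.

Lemma nsum_lam e b a : lam a (nsum e b) = nsum e (fun j i => lam a (b j i)) +
  \sum_(j < e) \sum_(i < k j) (epsB (b j i) : K) *: (l j)`_i a.
Proof.
rewrite /nsum linear_sum -big_split; apply: eq_bigr => j _ /=.
rewrite linear_sum -big_split; apply: eq_bigr => i _ /=.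
by rewrite lamM nn_lam.
Qed.

Lemma nsum_gr e b : nfam e b -> gr e (nsum e b).
Proof.
move=> eb; apply: (gr_sum CM) => j _; apply: (gr_sum CM) => i _.
by rewrite -[X in gr X _](subnKC (ltn_ord j)); apply: (grM CM).
Qed.

Lemma nsum_dB e (d : 'I_q -> nat -> nat -> B) m :
  dB (fun a => nsum e (d a)) m = nsum e (fun j i => dB (fun a => d a j i) m).
Proof.
rewrite dBE.
rewrite (nsum_sum _ _ (fun a j i => \sum_i' mu a i' m *: (d a j i * xx i'))).
apply: eq_bigr => a _; rewrite (nsum_sum _ _ (fun i' j i => mu a i' m *: (d a j i * xx i'))).
apply: eq_bigr => i' _; rewrite -[LHS]addr0 -[X in _ + X](nsum0 (e := e) (b := fun _ _ => 0)) //.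
by rewrite -nsum_mulr -nsumP; apply: nsum_ext => j i _ _; rewrite addr0.
Qed.

Definition inj_deg e := forall b, nfam e b -> nsum e b = 0 ->
  forall j i, (j < e)%N -> (i < k j)%N -> b j i = 0.

Definition surj_deg e := forall n, gr e n -> proj n = 0 ->
  exists2 b, nfam e b & n = nsum e b.

Lemma surj_deg0 : surj_deg 0.
Proof.
move=> n n0 pn; exists (fun _ _ => 0) => [j i|]; first exact: (gr0 CM).
by rewrite nsum0 // -pn proj_gr0.
Qed.

(* [lam], followed by [proj], kills the coefficients of top degree; by induction
   the other coefficients are killed by [lam], so they are combinations of the
   [xx m], and [xx_syzygy] turns the relation into one of smaller degree. *)
Lemma inj_step e : inj_deg e -> (forall e', e = e'.+1 -> surj_deg e') -> inj_deg e.+1.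
Proof.
move=> injE surjE b eb b0.
have be_gr j i : (j < e)%N -> gr (e - j.+1).+1 (b j i).
  by move=> je; rewrite -subSn //; apply: eb.
have beE i : b e i = (epsB (b e i) : K)%:A by apply: gr_epsB; rewrite -(subnn e.+1); apply: eb.
have nsumE a : nsum e (fun j i => lam a (b j i)) +
    \sum_(i < k e) (epsB (b e i) : K) *: (l e)`_i a = 0.
  transitivity (lam a (nsum e.+1 b)); last by rewrite b0 linear0.
  rewrite nsum_recr linearD /= nsum_lam linear_sum.
  rewrite [X in _ = _ + X + _]big1 ?addr0 => [|j _]; last first.
    by rewrite big1 // => i _; rewrite (epsB_gr CM (be_gr _ _ (ltn_ord j))) scale0r.
  congr (_ + _); apply: eq_bigr => i _; rewrite /= lamM nn_lam.
  by rewrite {2}beE linearZ /= lam_gr0 ?scaler0 ?mulr0 ?add0r //; apply: (gr1 CM).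
(* [proj] kills the first sum of [nsumE] and leaves a linear relation between the members of the
   free list [l e]. *)
have eps0 i : (i < k e)%N -> epsB (b e i) = 0.
  apply: (lF (c := fun i => (epsB (b e i) : K))); apply: funext => a; rewrite fct_sumE.
  have := congr1 proj (nsumE a); rewrite linear0 linearD /= nsum_proj add0r linear_sum => E.
  rewrite -[RHS]E; apply: eq_bigr => i' _; rewrite linearZ /=.
  have [_ + _] := lU (mem_nth 0 (ltn_ord i')); by move=> ->.
have lam0 a j i : (j < e)%N -> (i < k j)%N -> lam a (b j i) = 0.
  move=> je ik.
  pose lb j i := if (j < e)%N then lam a (b j i) else 0.
  have lb0 : forall j i, (j < e)%N -> (i < k j)%N -> lb j i = 0.
    apply: injE => [j' i'|].
      by rewrite /lb; case: ifP => [j'e|_]; [apply: lam_gr; exact: be_gr | exact: (gr0 CM)].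
    rewrite -[RHS](nsumE a) [X in _ + X]big1 ?addr0 => [|i' _]; last by rewrite eps0 ?scale0r.
    by apply: nsum_ext => j' i' j'e _; rewrite /lb j'e.
  by have := lb0 j i je ik; rewrite /lb je.
have /choice[g gP] (ji : nat * nat) : exists g : 'I_p -> B,
    (forall m, gr (e - ji.1.+1) (g m)) /\
    ((ji.1 < e)%N -> (ji.2 < k ji.1)%N -> b ji.1 ji.2 = \sum_m g m * xx m).
  case: ji => j i /=; have [/andP[je ik]|nji] := boolP ((j < e) && (i < k j))%N.
    by have [g gg gE] := lam_ker (be_gr j i je) (fun a => lam0 a j i je ik); exists g.
  exists (fun=> 0); split=> [m|je ik]; first exact: (gr0 CM).
  by rewrite je ik in nji.
pose c m j i := g (j, i) m.
have c_gr m : nfam e (c m) by move=> j i; have [+ _] := gP (j, i); apply.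
have bE j i : (j < e)%N -> (i < k j)%N -> b j i = \sum_m c m j i * xx m.
  by move=> je ik; have [_] := gP (j, i); apply.
have csum : \sum_m nsum e (c m) * xx m = 0.
  rewrite -[RHS]b0 nsum_recr [X in _ + X]big1 ?addr0 => [|i _]; last first.
    by rewrite beE eps0 // scale0r mulr0.
  rewrite (nsum_ext bE) (nsum_sum _ _ (fun m j i => c m j i * xx m)).
  by apply: eq_bigr => m _; rewrite nsum_mulr.
move=> j i; rewrite ltnS leq_eqVlt => /orP[/eqP -> ik|je ik].
  by rewrite beE eps0 // scale0r.
have := xx_syzygy CM (fun m => nsum_gr (c_gr m)) csum.
case: e {eb} injE surjE {b0 nsumE csum} be_gr beE eps0 lam0 gP c_gr bE je => // e
   injE surjE be_gr beE eps0 lam0 gP c_gr bE je [t jt tE].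
have /choice[d dP] a : exists d, nfam e d /\ t a - proj (t a) = nsum e d.
  have [||d ed dE] := surjE e erefl (t a - proj (t a)).
  - by apply: (grB CM) => //; apply: proj_gr.
  - by rewrite linearB /= projK subrr.
  by exists d.
pose D m j i := if (j < e)%N then dB (fun a => d a j i) m else 0.
(* Applying [proj] to nsum (c m) = dB t m gives dB (proj t) = 0, so t may be replaced by t - proj t,
   the [nsum] of d; injectivity in the smaller degree then compares coefficients. *)
have cE m j' i' : (j' < e.+1)%N -> (i' < k j')%N -> c m j' i' - D m j' i' = 0.
  apply: (injE (fun j i => c m j i - D m j i)).
    move=> j2 i2; apply: (grB CM); first exact: c_gr.
    rewrite /D; case: ifP => [j2e|_]; last exact: (gr0 CM).
    by rewrite subSS -subnSK //; apply: (dB_gr CM) => a; have [+ _] := dP a; apply.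
  have -> : nsum e.+1 (fun j i => c m j i - D m j i) = nsum e.+1 (c m) - nsum e.+1 (D m).
    rewrite [RHS]addrC -scaleN1r -nsumP; apply: nsum_ext => j2 i2 _ _.
    by rewrite scaleN1r addrC.
  have -> : nsum e.+1 (D m) = nsum e (fun j i => dB (fun a => d a j i) m).
    rewrite nsum_recr [X in _ + X]big1 ?addr0 => [|i2 _]; last by rewrite /D ltnn mulr0.
    by apply: nsum_ext => j2 i2 je2 _; rewrite /D je2.
  rewrite -nsum_dB; apply/eqP; rewrite subr_eq0; apply/eqP.
  have -> : (fun a => nsum e (d a)) = (fun a => -1 *: proj (t a) + t a).
    by apply: funext => a; have [_ <-] := dP a; rewrite scaleN1r addrC.
  by rewrite dB_linear -proj_dB -tE nsum_proj scaler0 add0r.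
rewrite bE // (eq_bigr (fun m => D m j i * xx m)) => [|m _]; last first.
  by have /eqP := cE m j i je ik; rewrite subr_eq0 => /eqP ->.
rewrite /D; have [_|_] := ltnP j e; last by rewrite big1 // => m _; rewrite mul0r.
under eq_bigr do rewrite mulr_suml.
rewrite exchange_big big1 // => a _ /=.
(* The coefficients [D m] combine with the x_m to multiples of the quadratic relations of A. *)
transitivity (d a j i * \sum_i' (\sum_i mu a i i' *: xx i) * xx i'); last first.
  by rewrite (xx_relation CM) mulr0.
rewrite mulr_sumr; apply: eq_bigr => m _.
rewrite mulrA; congr (_ * _); rewrite mulr_sumr; apply: eq_bigr => m' _.
by rewrite scalerAr.
Qed.

(* Subtracting a suitable [nsum] from n makes [lam] vanish; the difference is then
   a combination of the [xx m] with coefficients of smaller degree. *)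
Lemma surj_step e : surj_deg e -> inj_deg e.+1 -> surj_deg e.+1.
Proof.
move=> surjE injE n n_gr n_proj.
pose s a := proj (lam a n).
have sR : relations e s.
  split=> [a|a|i]; [by apply: proj_gr; apply: lam_gr | exact: projK |].
  by rewrite /s -proj_dB dB_lam linear0.
have [c cE] := lS sR.
have sE a : s a = \sum_(i < k e) c i *: (l e)`_i a by rewrite cE fct_sumE.
have /choice[d dP] a : exists d, nfam e d /\ lam a n - s a = nsum e d.
  have [||d ed dE] := surjE (lam a n - s a); last by exists d.
    by apply: (grB CM); [apply: lam_gr | have [+ _ _] := sR].
  by rewrite linearB /= /s projK subrr.
pose D m j i := if (j < e)%N then dB (fun a => d a j i) m else 0.
have degE j : (j < e)%N -> (e.+1 - j.+1 = (e - j.+1).+1)%N by move=> je; rewrite subSS -subnSK.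
have nsumD f b : (forall j i, (j < e)%N -> f j i = b j i) ->
    nsum e.+1 (fun j i => if (j < e)%N then f j i else 0) = nsum e b.
  move=> fb; rewrite nsum_recr [X in _ + X]big1 ?addr0 => [|i _]; last first.
    by rewrite ltnn mulr0.
  by apply: nsum_ext => j i je _; rewrite je fb.
(* Injectivity in degree e + 1 is used here: it shows that each coefficient family d satisfies the
   condition under which [lam_onto] lifts it. *)
have D0 m j i : (j < e)%N -> (i < k j)%N -> dB (fun a => d a j i) m = 0.
  move=> je ik; have : D m j i = 0; last by rewrite /D je.
  apply: injE => //; last exact: leqW.
    move=> j' i'; rewrite /D; case: ifP => [j'e|_]; last exact: (gr0 CM).
    by rewrite degE //; apply: (dB_gr CM) => a; have [+ _] := dP a; apply.
  rewrite (nsumD _ (fun j i => dB (fun a => d a j i) m)) // -nsum_dB.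
  have -> : (fun a => nsum e (d a)) = (fun a => -1 *: s a + lam a n).
    by apply: funext => a; have [_ <-] := dP a; rewrite scaleN1r addrC.
  by have [_ _ s0] := sR; rewrite dB_linear s0 scaler0 add0r dB_lam.
have /choice[f fP] (ji : nat * nat) : exists f, gr (e - ji.1.+1).+1 f /\
    ((ji.1 < e)%N -> (ji.2 < k ji.1)%N -> forall a, lam a f = d a ji.1 ji.2).
  case: ji => j i /=; have [/andP[je ik]|nji] := boolP ((j < e) && (i < k j))%N.
    have [||f jf fE] := lam_onto CM (j := e - j.+1) (t := fun a => d a j i).
    - by move=> a; have [+ _] := dP a; apply.
    - by move=> m; apply: D0.
    by exists f.
  by exists 0; split=> [|je ik]; [exact: (gr0 CM) | rewrite je ik in nji].
(* The coefficients of generators of degree e + 1 are scalars and account for the part s of [lam n]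
   in A; those of generators of lower degree lift d and account for the rest. *)
pose b0 j i := if (j < e)%N then f (j, i) else if j == e then (c i)%:A else 0.
have b0_gr : nfam e.+1 b0.
  move=> j i; rewrite /b0; case: ltnP => [je|ej].
    by rewrite degE //; have [] := fP (j, i).
  case: eqP => [->|_]; last exact: (gr0 CM).
  by rewrite subnn; apply: (grZ CM); apply: (gr1 CM).
pose n' := n - nsum e.+1 b0.
have n'_gr : gr e.+1 n' by apply: (grB CM) => //; apply: nsum_gr.
have n'_proj : proj n' = 0 by rewrite linearB /= n_proj nsum_proj subrr.
have n'_lam a : lam a n' = 0.
  rewrite linearB /= nsum_lam nsum_recr [X in _ + X + _]big1 ?addr0; last first.
    move=> i _; rewrite /b0 ltnn eqxx linearZ /= lam_gr0 ?scaler0 ?mulr0 //.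
    exact: (gr1 CM).
  rewrite big_ord_recr /= [X in _ + (X + _)]big1 ?add0r; last first.
    move=> j _; rewrite big1 // => i _; rewrite /b0 ltn_ord.
    by have [fg _] := fP (j : nat, i : nat); rewrite (epsB_gr CM fg) scale0r.
  have -> : \sum_(i < k e) (epsB (b0 e i) : K) *: (l e)`_i a = s a.
    by rewrite sE; apply: eq_bigr => i _; rewrite /b0 ltnn eqxx epsB_alg.
  have -> : nsum e (fun j i => lam a (b0 j i)) = nsum e (d a).
    apply: nsum_ext => j i je ik; rewrite /b0 je.
    by have [_ fE] := fP (j, i); rewrite fE.
  by have [_ <-] := dP a; rewrite subrK subrr.
have [g g_gr gE] := lam_ker n'_gr n'_lam.
have /choice[h hP] m : exists h, nfam e h /\ g m - proj (g m) = nsum e h.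
  have [||h eh hE] := surjE (g m - proj (g m)); last by exists h.
    by apply: (grB CM) => //; apply: proj_gr.
  by rewrite linearB /= projK subrr.
pose b1 j i := if (j < e)%N then \sum_m h m j i * xx m else 0.
exists (fun j i => 1 *: b0 j i + b1 j i).
  move=> j i; apply: (grP CM); first exact: b0_gr.
  rewrite /b1; case: ifP => [je|_]; last exact: (gr0 CM).
  rewrite degE //; apply: (gr_sum CM) => m _; rewrite -[(e - j.+1).+1]addn1.
  apply: (grM CM); last exact: (xx_gr CM).
  by have [+ _] := hP m; apply.
rewrite nsumP scale1r (nsumD _ (fun j i => \sum_m h m j i * xx m)) //.
rewrite (nsum_sum _ _ (fun m j i => h m j i * xx m)).
under [X in _ + X]eq_bigr => m _ do rewrite nsum_mulr -(hP m).2 mulrBl.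
rewrite sumrB -gE.
(* The parts [proj (g m)] are not of the form [nsum], but together they contribute [proj n'], which
   is zero. *)
have -> : \sum_m proj (g m) * xx m = proj n'.
  by rewrite gE linear_sum; apply: eq_bigr => m _; rewrite /= projM proj_xx.
by rewrite n'_proj subr0 addrC subrK.
Qed.

(** The two inductions are interleaved: injectivity in degree e + 1 uses surjectivity in degree e -
    1, and surjectivity in degree e + 1 uses injectivity in that same degree. *)
Lemma inj_surj_deg e : inj_deg e /\ surj_deg e.
Proof.
elim/ltn_ind: e => -[|e] IH; first by split=> //; exact: surj_deg0.
have [injE surjE] := IH e (ltnSn e).
have injS : inj_deg e.+1.
  by apply: inj_step => // e' E; have [|//] := IH e'; rewrite E leqnSn.
by split=> //; apply: surj_step.
Qed.

Local Notation T := {t : nat * nat | (t.2 < k t.1)%N}.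
Let nnT (t : T) := nn (val t).1 (val t).2.
Let ext (V : nmodType) (b : T -> V) (ji : nat * nat) : V :=
  if insub ji is Some t then b t else 0.

Let extE (V : nmodType) (b : T -> V) t : ext b (val t) = b t.
Proof. by rewrite /ext valK. Qed.

Let all_val (s : seq T) : all (fun t => t.2 < k t.1)%N (map val s).
Proof. by apply/allP => _ /mapP[t _ ->]; exact: (valP t). Qed.

Lemma nn_span n : proj n = 0 -> exists s : seq (B * T), n = \sum_(bt <- s) nnT bt.2 * bt.1.
Proof.
move=> n0; pose Q (x : B) := exists s : seq (B * T), x = \sum_(bt <- s) nnT bt.2 * bt.1.
have Q0 : Q 0 by exists [::]; rewrite big_nil.
have QD x y : Q x -> Q y -> Q (x + y).
  by move=> [s ->] [t ->]; exists (s ++ t); rewrite big_cat.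
have [N ->] := hcomp_sum n; apply: (big_ind Q) => // e _.
have [_ /(_ (hcomp e n) (hcomp_gr e n))[]] := inj_surj_deg e.
  by rewrite -hcomp_proj n0 linear0.
move=> b _ ->; apply: (big_ind Q) => // j _; apply: (big_ind Q) => // i _.
exists [:: (b j i, exist (fun t => (t.2 < k t.1)%N) (j : nat, i : nat) (ltn_ord i))].
by rewrite big_seq1.
Qed.

(** As [nn j i] has degree j + 1, the component of degree d of its coefficient is seen in degree d +
    j + 1 of the sum, where [inj_deg] applies. *)
Lemma nn_free (s : seq T) (b : T -> B) : uniq s -> \sum_(t <- s) nnT t * b t = 0 ->
  forall t, t \in s -> b t = 0.
Proof.
move=> us s0 t ts; have [N ->] := hcomp_sum (b t); rewrite big1 // => d _.
pose j : nat := (val t).1; pose e := (d + j.+1)%N.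
pose s' := map val s; have us' : uniq s' by rewrite map_inj_uniq //; apply: val_inj.
pose b' j i := if (j, i) \in s' then hcomp (e - j.+1) (ext b (j, i)) else 0.
have b'0 : nsum e b' = 0.
  transitivity (hcomp e (\sum_(t <- s) nnT t * b t)); last by rewrite s0 linear0.
  rewrite linear_sum.
  pose F u : B := nn u.1 u.2 * hcomp (e - u.1.+1) (ext b u).
  transitivity (\sum_(u <- s' | (u.1 < e)%N) F u).
    rewrite (@big_pairs B (fun j => k j) e s' F us' (all_val s)).
    apply: eq_bigr => j' _; apply: eq_bigr => i _.
    by rewrite /b'; case: ifP => // _; rewrite mulr0.
  rewrite big_map big_mkcond; apply: eq_bigr => t' _.
  by rewrite /F extE /= (hcompM e _ (nn_gr _ _)).
have [/(_ b' _ b'0 j (val t).2) + _] := inj_surj_deg e.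
rewrite /b' -surjective_pairing map_f // extE /e addnK; apply => //.
- move=> j' i'; case: ifP => _; [exact: hcomp_gr | exact: (gr0 CM)].
- by rewrite ltn_addl.
exact: (valP t).
Qed.

(** [lam] sends the generators to the chosen basis relations, which [proj] fixes; [hcomp] separates
    the degrees and [lF] applies in each. *)
Lemma nn_indep (s : seq T) (c : T -> K) : uniq s ->
  (forall a, \sum_(t <- s) c t *: proj (lam a (nnT t)) = 0) -> forall t, t \in s -> c t = 0.
Proof.
move=> us s0 t ts; pose j : nat := (val t).1.
pose s' := map val s; have us' : uniq s' by rewrite map_inj_uniq //; apply: val_inj.
pose c' i := if (j, i) \in s' then ext (c : T -> K^o) (j, i) else 0.
have := lF (c := c') _ (valP t).
rewrite /c' -surjective_pairing map_f // extE; apply; apply: funext => a; rewrite fct_sumE.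
transitivity (hcomp j (\sum_(t <- s) c t *: proj (lam a (nnT t)))); last by rewrite s0 linear0.
rewrite linear_sum; pose F u : B := if u.1 == j then ext (c : T -> K^o) u *: (l u.1)`_u.2 a else 0.
transitivity (\sum_(u <- s' | (u.1 < j.+1)%N) F u).
  rewrite (@big_pairs B (fun j => k j) j.+1 s' F us' (all_val s)) big_ord_recr /=.
  rewrite [X in _ = X + _]big1 ?add0r => [|j' _]; last first.
    by rewrite big1 // => i _; rewrite /F /= ltn_eqF // if_same.
  apply: eq_bigr => i _; rewrite /F /= eqxx -[LHS]/(c' i *: (l j)`_i a) /c'.
  by case: ifP => // _; rewrite scale0r.
rewrite big_map big_mkcond; apply: eq_bigr => t' _.
rewrite /F extE linearZ /= /nnT nn_lam.
have [lgr lproj _] := lU (mem_nth 0 (valP t')); rewrite lproj ltnS.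
case: eqP => [jE|/eqP jt]; first by rewrite jE in lgr *; rewrite leqnn hcomp_id.
by rewrite if_same (hcomp_neq (lgr a) jt) scaler0.
Qed.

End Generators.

Theorem kernel_free : exists (T : choiceType) (nn : T -> B),
  [/\ forall t, proj (nn t) = 0,
      forall n, proj n = 0 -> exists s : seq (B * T), n = \sum_(bt <- s) nn bt.2 * bt.1,
      forall (s : seq T) (b : T -> B), uniq s -> \sum_(t <- s) nn t * b t = 0 ->
        forall t, t \in s -> b t = 0
    & forall (s : seq T) (c : T -> K), uniq s ->
        (forall a, \sum_(t <- s) c t *: proj (lam a (nn t)) = 0) ->
        forall t, t \in s -> c t = 0].
Proof.
have [l [nn [lP nnP]]] := nn_exists.
have lU j : {in l j, forall t, relations j t} by have [] := lP j.
have lF j : lfree (l j) by have [] := lP j.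
have lS j t : relations j t -> lspan (l j) t by have [_ _] := lP j; apply.
have nn_gr j i : gr j.+1 (nn j i) by have [] := nnP j i.
have nn_proj j i : proj (nn j i) = 0 by have [] := nnP j i.
have nn_lam j i a : lam a (nn j i) = (l j)`_i a by have [_ _] := nnP j i; apply.
exists {t : nat * nat | (t.2 < size (l t.1))%N}, (fun t => nn (val t).1 (val t).2).
split=> [//|||].
- exact: nn_span.
- exact: nn_free.
exact: nn_indep.
Qed.

End Freeness.

(** * The extension A -> B *)

Section MinimalComplex.
Variables (K : fieldType) (p q : nat) (mu : 'I_q -> 'I_p -> 'I_p -> K).
Variables (B : algType K) (gr : nat -> B -> Prop).
Variable cl : nat -> (seq ('I_p + 'I_q) -> K^o) -> B.
Hypothesis CM : cohomology_model mu gr cl.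
Local Notation lam := (lam CM).
Local Notation proj := (proj CM).
Local Notation epsB := (epsB CM).
Local Notation xx := (xx cl).
Local Notation dB := (dB mu cl).
Local Notation chi := (chi CM).
Local Notation hcomp := (hcomp CM).

Lemma proj_expand b : exists f : 'I_p -> B, proj b = (epsB b : K)%:A + \sum_i f i * xx i.
Proof.
elim/(cl_ind CM): b => [x y [f fE] [g gE]|j u u0].
  exists (fun i => f i + g i); rewrite !linearD /= fE gE scalerDl addrACA.
  by rewrite -big_split; congr (_ + _); apply: eq_bigr => i _; rewrite mulrDl.
have jcl := model_gr CM j u; case: j u0 jcl => [|j] u0 jcl.
  exists (fun=> 0); rewrite big1 ?addr0 => [|i _]; last by rewrite mul0r.
  by rewrite proj_gr0 //; apply: gr_epsB.
have [f _ fE] := lam_ker (proj_gr CM jcl) (fun a => lam_proj CM a (cl j.+1 u)).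
by exists f; rewrite (epsB_gr CM jcl) scale0r add0r.
Qed.

Lemma hcompMxx e b i : hcomp e.+1 (b * xx i) = hcomp e b * xx i.
Proof.
elim/(cl_ind CM): b => [x y xP yP|j u u0]; first by rewrite mulrDl !linearD mulrDl /= xP yP.
have jcl : gr j.+1 (cl j u * xx i).
  by rewrite -addn1; apply: (grM CM); [apply: (model_gr CM) | apply: (xx_gr CM)].
rewrite (hcomp_cl CM) //; case: eqP => [jE|/eqP je]; first by rewrite hcomp_id // -jE.
by rewrite mul0r (hcomp_neq CM jcl).
Qed.

Lemma hcomp_finite b : exists N, forall M, (N <= M)%N -> b = \sum_(j < M) hcomp j b.
Proof.
elim/(cl_ind CM): b => [x y [N xE] [N' yE]|j u u0].
  exists (maxn N N') => M; rewrite geq_max => /andP[NM N'M].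
  rewrite {1}(xE M) // {1}(yE M) // -big_split; apply: eq_bigr => j _.
  by rewrite linearD.
exists j.+1 => M jM; rewrite (bigD1 (Ordinal jM)) //= hcomp_id; last exact: (model_gr CM).
rewrite big1 ?addr0 // => i ij; apply: (hcomp_neq CM (model_gr CM j u)).
by apply: contraNneq ij => E; apply/eqP/val_inj.
Qed.

Lemma xx_exact (f : 'I_p -> B) : \sum_i f i * xx i = 0 -> exists t, forall i, f i = dB t i.
Proof.
move=> f0; have f0e e : \sum_i hcomp e (f i) * xx i = 0.
  have := congr1 (hcomp e.+1) f0; rewrite linear0 linear_sum => E; rewrite -[RHS]E.
  by apply: eq_bigr => i _; rewrite /= hcompMxx.
have /choice[t tE] e : exists t, forall i, hcomp e (f i) = dB t i.
  have := xx_syzygy CM (fun i => hcomp_gr CM e (f i)) (f0e e).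
  case: e {f0e} => [|e]; last by move=> [t _ tE]; exists t.
  move=> f00; exists (fun a => lam a 0) => i; by rewrite f00 dB_lam.
have /choice[N NE] i := hcomp_finite (f i).
pose M := \max_i N i.
exists (fun a => \sum_(e < M) t e a) => i.
rewrite (NE i M) ?leq_bigmax // dBE.
under eq_bigr do rewrite tE; rewrite exchange_big; apply: eq_bigr => a _ /=.
rewrite exchange_big; apply: eq_bigr => i' _ /=.
by rewrite mulr_suml scaler_sumr.
Qed.

Lemma xx_minimal (f : 'I_p -> B) : \sum_i f i * xx i = 0 -> forall i, epsB (f i) = 0.
Proof.
move=> f0 i; have := congr1 (chi i) f0; rewrite linear0 linear_sum (bigD1 i) //=.
rewrite chiMxx eqxx mulr1 big1 ?addr0 // => i' /negPf ii.
by rewrite chiMxx eq_sym ii mulr0.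
Qed.

(** Applying [chi i] to [dB t j] leaves the sum of the eps (t a) mu a i j, so independence of the
    structure constants applies. *)
Lemma dB_minimal (t : 'I_q -> B) : (forall i, dB t i = 0) -> forall a, epsB (t a) = 0.
Proof.
move=> t0; apply: (model_indep CM (c := fun a => epsB (t a) : K)) => i j.
have := congr1 (chi i) (t0 j); rewrite linear0 linear_sum => E.
rewrite -[RHS]E; apply: eq_bigr => a _; rewrite linear_sum (bigD1 i) //= big1 ?addr0.
  by rewrite linearZ /= chiMxx eqxx mulr1 mulrC.
by move=> i' /negPf ii; rewrite linearZ /= chiMxx eq_sym ii mulr0 scaler0.
Qed.

(** * The subalgebra A and the beginning of its minimal resolution *)

Section Subalgebra.
Variables (A : algType K) (inc : {lrmorphism A -> B}).
Hypothesis inc_inj : injective inc.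
Hypothesis A_def : forall b, (exists a, inc a = b) <-> generated_subalgebra (gr 1) b.
Local Notation grA := (fun j a => gr j (inc a)).

Lemma proj_inc a : proj (inc a) = inc a.
Proof. by apply/(proj_generated CM)/A_def; exists a. Qed.

Lemma rho_exists b : exists a, inc a = proj b.
Proof. by apply/A_def/(proj_generated CM); rewrite projK. Qed.

Definition rho b : A := projT1 (cid (rho_exists b)).

Lemma inc_rho b : inc (rho b) = proj b.
Proof. exact: projT2 (cid (rho_exists b)). Qed.

Lemma rhoP c x y : rho (c *: x + y) = c *: rho x + rho y.
Proof. by apply: inc_inj; rewrite linearP /= !inc_rho projP. Qed.

Lemma rhoM : monoid_morphism rho.
Proof.
split=> [|x y]; apply: inc_inj; first by rewrite inc_rho proj1 rmorph1.
by rewrite rmorphM /= !inc_rho projM.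
Qed.

HB.instance Definition _ := GRing.isLinear.Build K B A *:%R rho rhoP.
HB.instance Definition _ := GRing.isMonoidMorphism.Build B A rho rhoM.

Lemma rho_inc a : rho (inc a) = a.
Proof. by apply: inc_inj; rewrite inc_rho proj_inc. Qed.

Definition epsA a : K := epsB (inc a).
Definition xA i := rho (xx i).

Lemma inc_xA i : inc (xA i) = xx i.
Proof. by rewrite inc_rho proj_xx. Qed.

Definition dK0 (x : {ffun 'I_p -> A^o}) : {ffun 'I_1 -> A^o} :=
  [ffun=> \sum_i (x i : A) * xA i].

Definition dK1 (t : {ffun 'I_q -> A^o}) : {ffun 'I_p -> A^o} :=
  [ffun i' => \sum_a \sum_i mu a i i' *: ((t a : A) * xA i)].

Lemma dK0P : linear dK0.
Proof.
move=> c x y; apply/ffunP => o; rewrite !ffunE scaler_sumr -big_split.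
apply: eq_bigr => i _; rewrite /= !ffunE mulrDl; congr (_ + _).
by rewrite -[c *: x i]/(c * (x i : A)) -mulrA.
Qed.

Lemma dK1P : linear dK1.
Proof.
move=> c x y; apply/ffunP => i'; rewrite !ffunE scaler_sumr -big_split.
apply: eq_bigr => a _; rewrite /= scaler_sumr -big_split; apply: eq_bigr => i _.
rewrite /= !ffunE mulrDl scalerDr; congr (_ + _).
by rewrite -[c *: x a]/(c * (x a : A)) -mulrA scalerAr.
Qed.

HB.instance Definition _ := GRing.isLinear.Build A _ _ _ dK0 dK0P.
HB.instance Definition _ := GRing.isLinear.Build A _ _ _ dK1 dK1P.

Lemma inc_dK0 x o : inc (dK0 x o) = \sum_i inc (x i) * xx i.
Proof.
by rewrite ffunE rmorph_sum; apply: eq_bigr => i _; rewrite rmorphM /= inc_xA.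
Qed.

Lemma inc_dK1 t i : inc (dK1 t i) = dB (fun a => inc (t a)) i.
Proof.
rewrite ffunE linear_sum; apply: eq_bigr => a _; rewrite linear_sum.
by apply: eq_bigr => i' _; rewrite linearZ /= rmorphM /= inc_xA.
Qed.

Definition minimal_rank i := nth 0%N [:: 1%N; p; q] i.
Local Notation KK i := {ffun 'I_(minimal_rank i) -> A^o}.

(** The ranks are 0 from index 3 on: the complex breaks off after A^q, and the kernel S of its last
    map is what the homological argument resolves. *)
Definition minimal_d i : {linear KK i.+1 -> KK i} :=
  match i return {linear KK i.+1 -> KK i} with
  | 0 => (dK0 : {linear {ffun 'I_p -> A^o} -> {ffun 'I_1 -> A^o}})
  | 1 => (dK1 : {linear {ffun 'I_q -> A^o} -> {ffun 'I_p -> A^o}})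
  | _.+2 => (\0 : {linear _ -> _})
  end.

Lemma tor_of_subalgebra (FA : graded_resolution grA) (FB : graded_resolution gr) :
  (exists phi : resolution_lift inc FA FB,
    forall i j : nat, (1 <= i)%N ->
    exists (f : {linear Tor FA i j -> Tor FB i j})
           (g : {linear Tor FB i j -> Tor FA i.+2 j.+1}),
      tor_induced phi f /\ short_exact f g) /\
  (forall i, graded_fin_dim (Tor FB i.+1) <->
     graded_fin_dim (Tor FA i.+1) /\ graded_fin_dim (Tor FA i.+3)) /\
  (forall i, (i < 2)%N -> graded_fin_dim (Tor FA i.+1)).
Proof.
have [T [nn [nn0 nn_span nn_free nn_indep]]] := kernel_free CM.
(* What is left after removing a last letter e_a, projected to A; by [dB_lam] these components form
   an element of S. *)
pose sigma b : KK 2 := [ffun a => rho (lam a b)].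
have rho_deg j b : gr j b -> grA j (rho b) by move=> jb; rewrite inc_rho; apply: proj_gr.
have grA_span a : exists N (f : nat -> A), (forall j, grA j (f j)) /\ a = \sum_(j < N) f j.
  have [N [f [fgr aE]]] := model_span CM (inc a).
  exists N, (fun j => rho (f j)); split=> [j|]; first exact: rho_deg.
  by rewrite -[LHS]rho_inc aE linear_sum.
have rho0 b : rho b = 0 -> proj b = 0 by move=> b0; rewrite -inc_rho b0 linear0.
have epsA_mul x y : epsA (x * y) = epsA x * epsA y by rewrite /epsA rmorphM epsBM.
have inc_deg j a : grA j a -> gr j (inc a) by [].
have Agr : is_graded_module grA (grA : nat -> A^o -> Prop).
  split.
  - by move=> j; rewrite linear0; apply: (gr0 CM).
  - move=> j c x y jx jy.
    suff: gr j (inc (c%:A * (x : A) + y)) by [].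
    by rewrite mulr_algl linearP; apply: (grP CM).
  - exact: grA_span.
  - move=> N f fgr f0 j jN; apply: inc_inj; rewrite linear0.
    have f0' : \sum_(j < N) inc (f j) = 0.
      by have := congr1 inc f0; rewrite linear0 linear_sum.
    exact: (model_direct CM (f := fun j => inc (f j)) fgr f0' jN).
  by move=> i j a x ia jx; rewrite rmorphM; apply: (grM CM).
have grA_1 : grA 0%N 1 by rewrite rmorph1; apply: (gr1 CM).
have eps_inc a : epsB (inc a) = epsA a by [].
have eps_rho b : epsA (rho b) = epsB b by rewrite /epsA inc_rho epsB_proj.
have epsA_alg c : epsA c%:A = c by rewrite /epsA linearZ rmorph1; apply: epsB_alg.
have epsA_pos a : positive_part grA (a - (epsA a)%:A).
  have [N [f [fgr fE]]] := epsB_pos CM (inc a).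
  exists N, (fun j => rho (f j)); split=> [j|]; first exact: rho_deg.
  transitivity (rho (inc a - (epsB (inc a) : K)%:A)); last by rewrite fE linear_sum.
  by rewrite (linearB rho) (linearZ_LR rho) /= rhoM.1 rho_inc.
have epsA_lin c a b : epsA (c *: a + b) = c * epsA a + epsA b.
  by rewrite /epsA linearP linearP.
have epsA_aug a : positive_part grA a -> epsA a = 0.
  by move=> [N [f [fgr ->]]]; rewrite /epsA !linear_sum big1 // => j _; apply: (epsB_gr CM (fgr j)).
have dK_deg i j x : degK grA (kk := minimal_rank) (i := i.+1) j x ->
    degK grA (kk := minimal_rank) (i := i) j (minimal_d i x).
  case: i x => [|[|i]] x jx.
  - case: j jx => [|j] jx a.
      have -> : x = 0 by apply/ffunP => i; rewrite ffunE; apply: jx.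
      by rewrite linear0 ffunE; apply: (grmod0 Agr).
    suff: gr j.+1 (inc (dK0 x a)) by [].
    rewrite inc_dK0; apply: (gr_sum CM) => i _.
    by rewrite -addn1; apply: (grM CM); [exact: jx | exact: (xx_gr CM)].
  - have x0 : (forall a, x a = 0) -> minimal_d 1 x = 0.
      by move=> x0; rewrite (_ : x = 0) ?linear0 //; apply/ffunP => a; rewrite ffunE x0.
    case: j jx => [|[|j]] jx a.
    + by rewrite x0 // ffunE.
    + by rewrite x0 // ffunE; apply: (grmod0 Agr).
    suff: gr j.+1 (inc (dK1 x a)) by [].
    by rewrite inc_dK1; apply: (dB_gr CM).
  by move=> a; rewrite ffunE; apply: (grmod0 (shift_by_graded i.+2 Agr) j).
have dKK i x : minimal_d i (minimal_d i.+1 x) = 0.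
  case: i x => [|i] x; first last.
    have -> : minimal_d i.+2 x = 0 by [].
    exact: linear0.
  apply/ffunP => o; apply: inc_inj; rewrite [in RHS]ffunE [RHS]linear0 [LHS]inc_dK0.
  under eq_bigr do rewrite inc_dK1 mulr_suml.
  rewrite exchange_big big1 // => a _ /=.
  transitivity (inc (x a) * \sum_i' (\sum_i mu a i i' *: xx i) * xx i'); last first.
    by rewrite (xx_relation CM) mulr0.
  rewrite mulr_sumr; apply: eq_bigr => i' _; rewrite mulrA; congr (_ * _).
  by rewrite mulr_sumr; apply: eq_bigr => i _; rewrite scalerAr.
pose epsK (x : KK 0) := epsA (x ord0).
have epsK_lin : eps_linear epsA (M := KK 0) epsK.
  by move=> c x y; rewrite /epsK !ffunE /epsA linearD rmorphM linearD /= epsBM.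
have epsK_deg j x : degK grA (kk := minimal_rank) (i := 0) j.+1 x -> epsK x = 0.
  by move=> jx; apply: (epsB_gr CM (jx ord0)).
pose uK : KK 0 := [ffun=> 1].
have uK_deg : degK grA (kk := minimal_rank) (i := 0) 0 uK.
  by move=> a; rewrite ffunE.
have epsK_u : epsK uK = 1.
  by rewrite /epsK ffunE /epsA rmorph1 epsB1.
have K_exact0 x : epsK x = 0 <-> exists y, minimal_d 0 y = x.
  split=> [x0|[y <-]].
    have [f fE] := proj_expand (inc (x ord0)).
    rewrite proj_inc (x0 : epsB _ = 0) scale0r add0r in fE.
    exists [ffun i => rho (f i)]; apply/ffunP => o; apply: inc_inj.
    rewrite inc_dK0 (ord1 o) -[RHS]proj_inc fE linear_sum; apply: eq_bigr => i _.
    by rewrite ffunE inc_rho /= projM proj_xx.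
  rewrite /epsK /epsA inc_dK0 linear_sum big1 // => i _.
  by rewrite /= epsBM epsB_xx mulr0.
have K_exact1 x : minimal_d 0 x = 0 -> exists y, minimal_d 1 y = x.
  move=> x0; have [|t tE] := xx_exact (f := fun i => inc (x i)).
    by rewrite -(inc_dK0 x ord0) [dK0 x]x0 ffunE linear0.
  exists [ffun a => rho (t a)]; apply/ffunP => i; apply: inc_inj.
  rewrite inc_dK1 -[RHS]proj_inc tE proj_dB; congr (dB _ i).
  by apply: funext => a; rewrite ffunE inc_rho.
have K_min0 x : epsK x = 0 -> forall a, epsA (x a) = 0.
  by move=> x0 a; rewrite (ord1 a).
have K_min1 x : minimal_d 0 x = 0 -> forall a, epsA (x a) = 0.
  move=> x0; apply: (xx_minimal (f := fun i => inc (x i))).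
  by rewrite -(inc_dK0 x ord0) [dK0 x]x0 ffunE linear0.
have K_min2 x : minimal_d 1 x = 0 -> forall a, epsA (x a) = 0.
  move=> x0; apply: (dB_minimal (t := fun a => inc (x a))) => i.
  by rewrite -inc_dK1 [dK1 x]x0 ffunE linear0.
have sigmaD b b' : sigma (b + b') = sigma b + sigma b'.
  by apply/ffunP => a; rewrite !ffunE !linearD.
have sigmaM b b' : sigma (b * b') = rho b *: sigma b' + (epsB b' : K)%:A *: sigma b.
  apply/ffunP => a; rewrite !ffunE lamM linearD rmorphM /= linearZ.
  by congr (_ + _); rewrite -[RHS]/(_%:A * _) mulr_algl.
have sigma_inc a : sigma (inc a) = 0.
  by apply/ffunP => b; rewrite !ffunE -proj_inc lam_proj linear0.
have sigma_deg j b : gr j b -> degK grA (kk := minimal_rank) (i := 2) j.+1 (sigma b).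
  move=> jb a; rewrite ffunE; case: j jb => [|j] jb /=.
    by rewrite lam_gr0 // linear0.
  by rewrite inc_rho; apply: proj_gr; apply: lam_gr.
have sigma_d b : minimal_d 1 (sigma b) = 0.
  apply/ffunP => i; apply: inc_inj; rewrite [LHS]inc_dK1 ffunE [RHS]linear0.
  transitivity (proj (dB (fun a => lam a b) i)); last by rewrite dB_lam linear0.
  by rewrite proj_dB; congr (dB _ i); apply: funext => a; rewrite ffunE inc_rho.
have sigma_onto j t : degK grA (kk := minimal_rank) (i := 2) j.+1 t -> minimal_d 1 t = 0 ->
    exists2 b, gr j b & sigma b = t.
  move=> jt t0; case: j jt => [|j] jt.
    exists 0; first exact: (gr0 CM).
    by apply/ffunP => a; rewrite ffunE !linear0 [RHS](jt a).
  have [//||b jb bE] := lam_onto CM (j := j) (t := fun a => inc (t a)).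
    by move=> i; rewrite -inc_dK1 [dK1 t]t0 ffunE linear0.
  by exists b => //; apply/ffunP => a; rewrite ffunE bE rho_inc.
have rho_nn t : rho (nn t) = 0.
  by apply: inc_inj; rewrite inc_rho nn0 linear0.
have rho_span b : rho b = 0 -> exists l : seq (B * T), b = \sum_(p <- l) nn p.2 * p.1.
  by move=> /rho0; apply: nn_span.
have sigma_indep (s : seq T) (c : T -> K) : uniq s ->
    \sum_(t <- s) (c t)%:A *: sigma (nn t) = 0 -> {in s, forall t, c t = 0}.
  move=> us s0; apply: nn_indep us _ => a.
  have := congr1 (fun x : KK 2 => inc (x a)) s0.
  rewrite sum_ffunE ffunE linear0 linear_sum => E; rewrite -[RHS]E.
  apply: eq_bigr => t _; rewrite !ffunE -inc_rho -linearZ; congr (inc _).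
  exact: (esym (mulr_algl _ _)).
exact: (tor_extension rho_inc inc_deg rho_deg Agr grA_1 grA_span (grD CM) (model_span CM)
  eps_inc eps_rho epsA_alg (epsB_alg CM) epsA_pos (epsB_pos CM) epsA_lin epsA_mul
  epsA_aug FA FB dK_deg dKK epsK_lin epsK_deg uK_deg epsK_u
  K_exact0 K_exact1 K_min0 K_min1 K_min2 sigmaD sigmaM sigma_inc sigma_deg sigma_d
  sigma_onto rho_nn rho_span nn_free sigma_indep).
Qed.

End Subalgebra.

End MinimalComplex.

(** * The Yoneda algebra as a cohomology model, and the conclusion *)

Lemma yoneda_cohomology_model (K : fieldType) (R : algType K) (m : R -> Prop) (p q : nat)
    (e : 'I_p + 'I_q -> R) (eps : R -> K) (co : 'I_p + 'I_q -> R -> K)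
    (mu : 'I_q -> 'I_p -> 'I_p -> K) (P : resolution m) (B : algType K)
    (iota : forall j, {linear Ext P j -> B}) :
  cube_zero_basis m e eps co mu -> is_yoneda_algebra iota ->
  exists cl, cohomology_model mu (ext_degree iota) cl.
Proof.
move=> CZ B_def.
have [c [c_lin c_eps c_d]] := exists_bar_to_res CZ P.
have [c' [c'_lin c'_eps c'_d]] := exists_res_to_bar CZ P.
have iota_inj j (x : Ext P j) : iota j x = 0 -> x = 0.
  (* The family with x in degree j and 0 elsewhere; x is transported along the equality of
     indices. *)
  move=> x0; pose y i : Ext P i :=
    if j =P i is ReflectT ji then ecast i (Ext P i) ji x else 0.
  have yj : y j = x by rewrite /y; case: eqP => // ji; rewrite eq_axiomK.
  have yi i : (i < j)%N -> y i = 0.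
    by move=> ij; rewrite /y; case: eqP => // ji; rewrite ji ltnn in ij.
  rewrite -yj; apply: (yoneda_direct B_def (N := j.+1) (x := y)) => //.
  rewrite big_ord_recr /= yj x0 addr0 big1 // => i _.
  by rewrite yi // linear0.
exists (fun j u => iota j (cochain_class eps c' j u)); split.
- exact: (cz_indep CZ).
- by move=> j a u v u0 v0; rewrite (cochain_class_lin CZ c'_lin c'_d a u0 v0) linearP.
- by move=> j u; exists (cochain_class eps c' j u).
- move=> j _ [x <-].
  have [u u0 ->] := cochain_class_onto CZ c_lin c'_lin c_eps c'_eps c_d c'_d x.
  by exists u.
- move=> j u u0.
  rewrite -(cochain_class_eq0 CZ c_lin c'_lin c_eps c'_eps c_d c'_d u0).
  by split=> [/iota_inj|->] //; rewrite linear0.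
- move=> i j u v.
  exact: (cochain_class_mul CZ c_lin c'_lin c_eps c'_eps c_d c'_d B_def).
- move=> b; have [N [x ->]] := yoneda_span B_def b.
  by exists N, (fun j => iota j (x j)); split=> // j; exists (x j).
move=> N f fgr f0 j jN; pose x i := projT1 (cid (fgr i)).
have xE i : iota i (x i) = f i by exact: projT2 (cid (fgr i)).
rewrite -xE (yoneda_direct B_def (N := N) (x := x)) ?linear0 //.
by under eq_bigr do rewrite xE.
Qed.

Theorem theorem2p1
  (K : fieldType) (char0 : [pchar K] =i pred0) (n : nat)
  (* R = E(x_1, ..., x_n) / J, J generated by G *)
  (G : ext K n -> Prop)
  (G_deg : forall g, G g -> exists2 d, (2 <= d)%N & ext_homog d g)
  (R : algType K) (pi : {lrmorphism ext K n -> R})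
  (R_def : is_quotient_by pi G)
  (m_cube : forall x y z : R, augmentation_ideal pi x ->
     augmentation_ideal pi y -> augmentation_ideal pi z -> x * y * z = 0)
  (* B = Ext_R(k, k) *)
  (P : resolution (augmentation_ideal pi))
  (B : algType K) (iota : forall j, {linear Ext P j -> B})
  (B_def : is_yoneda_algebra iota)
  (* A is the subalgebra generated by Ext^1 *)
  (A : algType K) (inc : {lrmorphism A -> B}) (inc_inj : injective inc)
  (A_def : forall b, (exists a, inc a = b) <->
     generated_subalgebra (ext_degree iota 1) b)
  (FA : graded_resolution (fun j a => ext_degree iota j (inc a)))
  (FB : graded_resolution (ext_degree iota)) :
  (exists phi : resolution_lift inc FA FB,
     forall i j : nat, (1 <= i)%N ->
     exists (f : {linear Tor FA i j -> Tor FB i j})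
            (g : {linear Tor FB i j -> Tor FA i.+2 j.+1}),
       tor_induced phi f /\ short_exact f g) /\
  (finitely_generated FB <-> graded_fin_dim (Tor FA 3)) /\
  (finitely_presented FB <->
     graded_fin_dim (Tor FA 3) /\ graded_fin_dim (Tor FA 4)) /\
  (finitely_presented FB /\ finitely_many_relations_between_relations FB <->
     [/\ graded_fin_dim (Tor FA 3), graded_fin_dim (Tor FA 4)
       & graded_fin_dim (Tor FA 5)]).
Proof.
have [eps [epsL epsM eps1 mE]] := exterior_quotient_eps G_deg R_def.
have [s sP] := exterior_quotient_span R_def.
have [p [q [e [co [mu CZ]]]]] := cube_zero_basis_exists sP epsL epsM eps1 mE m_cube.
have [cl CM] := yoneda_cohomology_model CZ B_def.
have [ses [fin small]] := tor_of_subalgebra CM inc_inj A_def FA FB.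
(* [fin i] ties Tor^B_{i+1} to Tor^A_{i+1} and Tor^A_{i+3}. With Tor^A_1 and Tor^A_2 finite, the
   cases i = 0, 1, 2 leave Tor^A_3, then Tor^A_4, then Tor^A_3 with Tor^A_5. *)
have fin1 := fin 0%N; have fin2 := fin 1%N; have fin3 := fin 2%N.
have small1 := small 0%N isT; have small2 := small 1%N isT.
split; first exact: ses.
rewrite /finitely_presented /finitely_generated /finitely_many_relations_between_relations.
split; first by tauto.
split; first by tauto.
by split=> [?|[]]; [split|]; tauto.
Qed.
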